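(* Let $d\to\infty$ and let $k=k(d)$, $n=n(d)$ be (positive-integer-valued) functions of $d$ such that $k\sim\alpha n$ and $d\sim\beta n$ as $d\to\infty$, for some constants $0<\alpha<\beta<1$. If $I_\alpha(\beta)+\alpha\log\alpha+(1-\alpha)\log(1-\alpha)>0$, then $$\binom nk-\mathbb{E}f_{k-1}(C_{n-1,d})=O(e^{-\eta n})$$ for some $\eta>0$, and the polytope $C_{n-1,d}$ is $k$-neighborly with probability converging to $1$, more precisely, $$\mathbb{P}\left[f_{k-1}(C_{n-1,d})=\binom nk\right]=1-O(e^{-\eta n}).$$ If, on the other hand, $I_\alpha(\beta)+\alpha\log\alpha+(1-\alpha)\log(1-\alpha)<0$, then $$\lim_{d\to\infty}\left(\binom nk-\mathbb{E}f_{k-1}(C_{n-1,d})\right)=+\infty.$$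
   Context: For each (sufficiently large) $d$, let $\xi_1,\ldots,\xi_{n-1}$ (with $n=n(d)$, $n-1\geq d$) be random vectors in $\mathbb{R}^d$ (possibly dependent, with joint law allowed to depend on $d$), and let $S_0=0$, $S_i=\xi_1+\cdots+\xi_i$, $1\leq i\leq n-1$. Standing assumptions: (Exchangeability) for every permutation $\sigma$ of $\{1,\ldots,n-1\}$, $(\xi_{\sigma(1)},\ldots,\xi_{\sigma(n-1)})$ has the same distribution as $(\xi_1,\ldots,\xi_{n-1})$; (General position) for every $1\leq i_1<\cdots<i_d\leq n-1$ the probability that $S_{i_1},\ldots,S_{i_d}$ are linearly dependent is $0$. Let $C_{n-1,d}:=\operatorname{conv}(S_0,S_1,\ldots,S_{n-1})\subset\mathbb{R}^d$, the convex hull of $n$ points, and let $f_\ell(C_{n-1,d})$ be the number of $\ell$-dimensional faces of this polytope. The maximal possible value of $f_{k-1}(C_{n-1,d})$ is $\binom nk$, and $C_{n-1,d}$ is called $k$-neighborly if $f_{k-1}(C_{n-1,d})=\binom nk$. For $0<\alpha<\beta<1$, $$I_\alpha(\beta)=-\alpha\log\left(h^{-1}\left(\tfrac{\beta}{\alpha}\right)-1\right)+\log\left(1-h^{-1}(\beta)\right)+\beta\log\left(-\frac{\log h^{-1}(\frac{\beta}{\alpha})}{\log h^{-1}(\beta)}\right)-\alpha\log\alpha-(1-\alpha)\log(1-\alpha),$$ where $h^{-1}$ is the inverse function of the continuous strictly increasing bijection $h:[0,\infty)\to[0,\infty)$ given by $h(x)=-\frac{x\log x}{1-x}$ for $x\in(0,1)\cup(1,\infty)$,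 $h(0)=0$, $h(1)=1$. $a\sim b$ means that the ratio tends to $1$. *)

(* Defs.v *)
From mathcomp Require Import all_boot all_order all_algebra all_fingroup finmap.
From mathcomp Require Import all_classical all_reals all_analysis.

Set Implicit Arguments.
Unset Strict Implicit.
Unset Printing Implicit Defensive.

Import Order.TTheory GRing.Theory Num.Theory.
Import numFieldNormedType.Exports.

Local Open Scope classical_set_scope.
Local Open Scope ring_scope.

Section Polytopes.
Context {R : realType} {d : nat}.
Local Notation V := 'rV[R]_d.
Implicit Types Q F A : set V.

Definition conv_hull A : set V := smallest (@convex_set R V) A.

Definition aff_hull A : set V :=
  [set x | exists m (a : 'I_m -> R) (p : 'I_m -> V),
     [/\ forall i, A (p i), \sum_i a i = 1 & x = \sum_i a i *: p i]].

(* The empty set has no dimension in this sense. *)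
Definition has_affdim A (l : nat) : Prop :=
  exists (x0 : V) (W : {vspace V}),
    aff_hull A = [set x | x - x0 \in W] /\ \dim W = l.

(* F is cut out by a valid inequality <x, c> <= c0 of Q; c = 0 yields the
   improper faces Q and set0. *)
Definition is_face Q F : Prop :=
  exists (c : 'cV[R]_d) (c0 : R),
    (forall x, Q x -> (x *m c) 0 0 <= c0) /\
    F = [set x | Q x /\ (x *m c) 0 0 = c0].

(* Meaningful for polytopes, whose set of faces is finite: fset_set sends
   infinite sets to the empty one. *)
Definition num_faces (l : nat) Q : nat :=
  #|` fset_set [set F | is_face Q F /\ has_affdim F l]|.

(* Q is to be the convex hull of n points. *)
Definition neighborly (n k : nat) Q : Prop := num_faces k.-1 Q = 'C(n, k).

End Polytopes.

Section RandomWalk.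
Context {R : realType} {disp : measure_display} {T : measurableType disp}.
Variable P : probability T R.
Context {m d : nat}.
(* The increments xi_1, ..., xi_m are numbered from 0. *)
Variable xi : 'I_m -> T -> 'rV[R]_d.

Definition random_vectors : Prop :=
  forall i, measurable_fun [set: T]
    (xi i : T -> g_sigma_algebraType (@open 'rV[R]_d)).

(* Joint laws are compared on the Borel sets of (R^d)^m, seen as the space of
   m x d matrices. *)
Definition exchangeable : Prop :=
  forall (s : {perm 'I_m}) (B : set 'M[R]_(m, d)), <<s @open 'M[R]_(m, d) >> B ->
    P [set w | B (\matrix_(i < m) xi (s i) w)] =
    P [set w | B (\matrix_(i < m) xi i w)].

Definition partial_sum (i : nat) (w : T) : 'rV[R]_d :=
  \sum_(j < m | (j < i)%N) xi j w.

Definition general_position : Prop :=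
  forall i : 'I_d -> 'I_m, {homo i : a b / (a < b)%N} ->
    P [set w | ~~ row_free (\matrix_(a < d) partial_sum (i a).+1 w)] = 0%E.

Definition walk_hull (w : T) : set 'rV[R]_d :=
  conv_hull [set partial_sum i w | i in [set i | (i <= m)%N]].

End RandomWalk.

Section RateFunction.
Context {R : realType}.

Definition h (x : R) : R :=
  if x == 0 then 0 else if x == 1 then 1 else - (x * ln x / (1 - x)).

Definition hinv : R -> R := 'pinv_(fun=> 0) `[0, +oo[ h.

Definition rate (alpha beta : R) : R :=
  - alpha * ln (hinv (beta / alpha) - 1) + ln (1 - hinv beta)
  + beta * ln (- (ln (hinv (beta / alpha)) / ln (hinv beta)))
  - alpha * ln alpha - (1 - alpha) * ln (1 - alpha).

End RateFunction.

(* Main.v *)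
Require Import Defs.
From mathcomp Require Import all_boot all_order all_algebra all_fingroup finmap.
From mathcomp Require Import all_classical all_reals all_analysis.
From mathcomp Require Import measurable_realfun.
From mathcomp Require Import ring lra zify.
Import Order.TTheory GRing.Theory Num.Theory.
Import numFieldNormedType.Exports.
Local Open Scope classical_set_scope.
Local Open Scope ring_scope.

(** The points S_0, ..., S_(n-1) are in general position, so every face of
dimension k - 1 < d is a simplex on k of them, and binom(n, k) - f_(k-1) is the
number of k-sets of indices that are not the vertex set of a face. The
expectation of this number of missing faces is squeezed between two explicit
sums, whose exponential order is - J.

From faces to linear relations. Close the walk by the step that leads back to
the origin. By Gordan's theorem ([gordan], [not_exposedP]) a k-set I is not
exposed exactly when the n closed steps satisfy a linear relation whose
coefficients decrease along the cycle outside I; under general position the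
decrease may be taken strict, that is, strict along each of the k cyclic blocks
into which I cuts the path ([weak_descent_strict], [not_exposed_descends]).

Averaging over the orders of the increments. By exchangeability the expected
number of missing faces is 1 / (n - 1)! times the expected number of pairs of
an order s and a k-set I for which this happens. Such pairs correspond
bijectively to a labelling of the n steps by k blocks together with a chamber
of the arrangement of the hyperplanes x_i = x_j, for i and j with equal label,
and the pairs sought are those whose chamber meets the space of relations
([descending_pairs_count]). The space of relations is almost surely generic of
codimension d ([blocks_free_ae], [generic_relations]), and deletion-restriction
bounds the number of chambers that it meets, whatever the walk: k times this
number is at most the sum over j > d of the products of the Stirling number of
the first kind (n, j) and the number of surjections from j points onto k, and
at least the single product with j = d + 2 ([chamber_count_upper],
[chamber_count_lower]). Only the exponential order matters, so the gap between
the two bounds does no harm.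

Asymptotics. The generating functions t (t + 1) ... (t + n - 1) and
(exp u - 1)^k give upper bounds for both factors at any t and u, and
log-concavity of both triangles shows that the best of them is attained up to
polynomial factors ([ln_cycle_coef_le], [ln_cycle_coef_ge], [ln_surj_coef_le],
[ln_surj_coef_ge]). The optimal parameters solve the equations that define
h^-1(beta) = exp(- t) and h^-1(beta / alpha) = exp u, and the resulting
exponent is - J n ([rate_saddle]). If J > 0, then t <= u, so the bound for the
terms with j > d is governed by j = d and their sum is exponentially small
([tail_negligible]); since the hull is neighborly unless some face is missing,
the probability statements follow. If J < 0, the term with j = d + 2 tends to
infinity ([single_term_diverges]). *)

(** * Chambers of a graph that meet a linear space *)

Section Chambers.
Context {R : realFieldType}.

Lemma finite_pos_lower_bound {I : finType} (P : pred I) (a : I -> R) :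
  (forall i, P i -> 0 < a i) -> exists2 m, 0 < m & forall i, P i -> m <= a i.
Proof.
move=> a_gt0; exists (\big[Num.min/1]_(i | P i) a i).
  by apply: (big_ind (fun x => 0 < x)) => // x y x0 y0; rewrite lt_min x0.
move=> i Pi; rewrite (bigD1 i) //= ge_min lexx //.
Qed.

Definition lin_closed {n} (W : set ('I_n -> R)) : Prop :=
  W (fun=> 0) /\
  forall a x y, W x -> W y -> W (fun i => a * x i + y i).

Definition separates {n} (G : {set 'I_n * 'I_n}) (x : 'I_n -> R) : Prop :=
  forall e, e \in G -> x e.1 != x e.2.

Definition ascents {n} (G : {set 'I_n * 'I_n}) (x : 'I_n -> R) :=
  [set e in G | x e.1 < x e.2]%SET.

(** An edge [e] of the graph [G] stands for the hyperplane [x e.1 = x e.2]. A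
chamber is recorded by the orientation of the edges that it induces, which
makes chambers elements of a finite type. *)
Definition chambers {n} (G : {set 'I_n * 'I_n}) (W : set ('I_n -> R)) :
    {set {set 'I_n * 'I_n}} :=
  [set s | `[< exists x, [/\ W x, separates G x & ascents G x = s] >]]%SET.

Lemma chambersP {n} (G : {set 'I_n * 'I_n}) W s :
  reflect (exists x, [/\ W x, separates G x & ascents G x = s])
    (s \in chambers G W).
Proof. by rewrite inE; apply: asboolP. Qed.

Lemma mem_chambers {n} (G : {set 'I_n * 'I_n}) (W : set ('I_n -> R)) x :
  W x -> separates G x -> ascents G x \in chambers G W.
Proof. by move=> Wx Gx; apply/chambersP; exists x. Qed.

Lemma lt_perturb (a b p q m M t : R) : 0 <= M -> `|p| <= M -> `|q| <= M ->
  `|t| * (M + M + 1) < m -> m <= `|a - b| ->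
  ((a + t * p < b + t * q) = (a < b)) /\ ((a + t * p == b + t * q) = (a == b)).
Proof.
move=> M0 pM qM tm mab.
have tp : `|t * p| <= `|t| * M by rewrite normrM ler_wpM2l.
have tq : `|t * q| <= `|t| * M by rewrite normrM ler_wpM2l.
have t0 := normr_ge0 t.
have : `|t| * M + `|t| * M < m by nra.
move: tp tq; rewrite !ler_norml => /andP[p1 p2] /andP[q1 q2] mm.
case: (ltrgtP a b) mab => [ab|ba|->].
- move=> mab; have h : a + t * p < b + t * q by lra.
  by split; [apply/idP|apply/negbTE; rewrite lt_eqF].
- move=> mab; have h : b + t * q < a + t * p by lra.
  by split; apply/negbTE; [rewrite -leNgt ltW|rewrite gt_eqF].
- move=> mab; exfalso; move: (mulr_ge0 t0 M0) mm mab; lra.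
Qed.

(** Only finitely many differences have to keep their sign. *)
Lemma chamber_open {n} (G : {set 'I_n * 'I_n}) (x u : 'I_n -> R) :
  separates G x -> exists2 t0 : R, 0 < t0 & forall t, `|t| <= t0 ->
    separates G (fun i => t * u i + x i) /\
    ascents G (fun i => t * u i + x i) = ascents G x.
Proof.
move=> Gx.
have [m m0 mP] : exists2 m, 0 < m & forall e, e \in G -> m <= `|x e.1 - x e.2|.
  by apply: finite_pos_lower_bound => e /Gx; rewrite normr_gt0 subr_eq0.
pose M : R := \sum_i `|u i|.
have M0 : 0 <= M by apply: sumr_ge0.
have uM i : `|u i| <= M by rewrite /M (bigD1 i) //= lerDl sumr_ge0.
exists (m / 2 / (M + M + 1)); first by rewrite !divr_gt0 //; lra.
move=> t ht.
have tm : `|t| * (M + M + 1) < m.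
  move: ht; rewrite ler_pdivlMr; last lra.
  by move=> /le_lt_trans; apply; lra.
have key e : e \in G ->
    ((t * u e.1 + x e.1 < t * u e.2 + x e.2) = (x e.1 < x e.2)) /\
    ((t * u e.1 + x e.1 == t * u e.2 + x e.2) = (x e.1 == x e.2)).
  move=> eG; rewrite ![t * _ + _]addrC.
  exact: (lt_perturb _ _ _ _ _ _ _ M0 (uM _) (uM _) tm (mP _ eG)).
split=> [e eG|]; first by rewrite (key e eG).2 Gx.
by apply/setP => e; rewrite !inE; case eG: (e \in G) => //=; rewrite (key e eG).1.
Qed.

Section Add_edge.
Context {n : nat} (G : {set 'I_n * 'I_n}) (W : set ('I_n -> R)).
Context (e : 'I_n * 'I_n).
Hypothesis Wlin : lin_closed W.
Hypothesis eG : e \notin G.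

Let below := chambers G (fun x => W x /\ x e.1 < x e.2).
Let above := chambers G (fun x => W x /\ x e.2 < x e.1).

Let wall := chambers G (fun x => W x /\ x e.1 = x e.2).

Lemma separatesU1 x :
  separates (e |: G) x <-> x e.1 != x e.2 /\ separates G x.
Proof.
split=> [h|[h1 h2] e'].
  by split=> [|e' e'G]; apply: h; rewrite !inE ?eqxx ?e'G ?orbT.
by rewrite !inE => /predU1P[->//|/h2].
Qed.

Lemma ascentsU1 x :
  ascents (e |: G) x = if x e.1 < x e.2 then e |: ascents G x else ascents G x.
Proof.
case: ifPn => h; apply/setP => e'; rewrite !inE; case: eqVneq => [->|] //=.
by rewrite (negbTE h) (negbTE eG).
Qed.

Lemma ascents_sub (x : 'I_n -> R) : ascents G x \subset G.
Proof. by apply/fintype.subsetP => e'; rewrite inE => /andP[]. Qed.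

Lemma mem_chambers_notin (W' : set ('I_n -> R)) s :
  s \in chambers G W' -> e \notin s.
Proof.
move=> /chambersP[x [_ _ <-]]; apply: contra eG.
by move/(fintype.subsetP (ascents_sub x)).
Qed.

Lemma card_chambersU1_sides : #|chambers (e |: G) W| = (#|below| + #|above|)%N.
Proof.
have -> : chambers (e |: G) W = ([set (e |: s)%SET | s in below] :|: above)%SET.
  apply/setP => s; apply/idP/idP.
    case/chambersP => x [Wx /separatesU1[xe Gx] <-].
    rewrite ascentsU1 finset.in_setU; case: ifPn => h; apply/orP; [left|right].
      by apply: imset_f; apply: mem_chambers.
    by apply: mem_chambers => //; split=> //; rewrite lt_neqAle eq_sym xe leNgt.
  rewrite finset.in_setU => /orP[/imsetP[s' /chambersP[x [[Wx xe] Gx <-]] ->]|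
                          /chambersP[x [[Wx xe] Gx <-]]].
    apply/chambersP; exists x; split=> //; last by rewrite ascentsU1 xe.
    by apply/separatesU1; rewrite lt_eqF.
  apply/chambersP; exists x; split=> //.
    by apply/separatesU1; rewrite gt_eqF.
  by rewrite ascentsU1 ltNge ltW.
rewrite cardsU disjoint_setI0 ?cards0 ?subn0; last first.
  apply/pred0P => s /=; apply/negbTE/negP => /andP[/imsetP[s' _ ->]].
  by move/mem_chambers_notin; rewrite !inE eqxx.
rewrite card_in_imset // => s s' /mem_chambers_notin h /mem_chambers_notin h'.
by move=> /(congr1 (fun s => s :\ e)%SET); rewrite !finset.setU1K.
Qed.

(** A chamber of [G] that meets both sides of the new hyperplane also meets the
hyperplane: a convex combination of two witnesses lies on it, and in [W] by
linearity. *)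
Lemma card_chambersU1_le :
  (#|chambers (e |: G) W| <= #|chambers G W| + #|wall|)%N.
Proof.
rewrite card_chambersU1_sides -cardsUI leq_add // subset_leq_card //.
  apply/fintype.subsetP => s.
  by rewrite inE => /orP[] /chambersP[x [[Wx _] Gx <-]]; apply: mem_chambers.
apply/fintype.subsetP => s; rewrite inE => /andP[].
move=> /chambersP[x [[Wx xe] Gx <-]] /chambersP[y [[Wy ye] Gy]] eqyx.
have ltyx e' : e' \in G -> (y e'.1 < y e'.2) = (x e'.1 < x e'.2).
  by move=> e'G; have /setP/(_ e') := eqyx; rewrite !inE e'G.
(* With these weights the combination of x and y takes equal values at both
   ends of e. *)
pose a := y e.1 - y e.2; pose b := x e.2 - x e.1.
have a0 : 0 < a by rewrite subr_gt0.
have b0 : 0 < b by rewrite subr_gt0.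
have sgn e' : e' \in G -> x e'.1 < x e'.2 ->
    a * x e'.1 + (b * y e'.1 + 0) < a * x e'.2 + (b * y e'.2 + 0).
  by move=> e'G h; rewrite !addr0 ltrD ?ltr_pM2l ?ltyx.
have sgn' e' : e' \in G -> ~~ (x e'.1 < x e'.2) ->
    a * x e'.2 + (b * y e'.2 + 0) < a * x e'.1 + (b * y e'.1 + 0).
  move=> e'G h; rewrite !addr0 ltrD ?ltr_pM2l //.
    by rewrite lt_neqAle eq_sym Gx //= leNgt.
  by rewrite lt_neqAle eq_sym Gy //= leNgt ltyx.
apply/chambersP; exists (fun i => a * x i + (b * y i + 0)); split.
- split; first by apply: Wlin.2 => //; apply: Wlin.2 => //; exact: Wlin.1.
  by rewrite /a /b; ring.
- move=> e' e'G; case: (boolP (x e'.1 < x e'.2)) => h.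
    by rewrite lt_eqF // sgn.
  by rewrite gt_eqF // sgn'.
- apply/setP => e'; rewrite !inE; case e'G: (e' \in G) => //=.
  case: (boolP (x e'.1 < x e'.2)) => h; first by rewrite sgn.
  by apply/negbTE; rewrite -leNgt ltW // sgn'.
Qed.

(** Since [u] leaves the new hyperplane, moving a point of the hyperplane along
[u] in both directions shows that a chamber that meets the wall is cut into
two. *)
Lemma card_chambersU1 u : W u -> u e.1 != u e.2 ->
  #|chambers (e |: G) W| = (#|chambers G W| + #|wall|)%N.
Proof.
move=> Wu ue; apply/eqP; rewrite eqn_leq card_chambersU1_le /=.
rewrite card_chambersU1_sides -cardsUI.
have shift x t : separates G x -> W x ->
    [/\ W (fun i => t * u i + x i),
    separates G (fun i => t * u i + x i) &
    ascents G (fun i => t * u i + x i) = ascents G x] ->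
    (t * u e.1 + x e.1 < t * u e.2 + x e.2 -> ascents G x \in below) /\
    (t * u e.2 + x e.2 < t * u e.1 + x e.1 -> ascents G x \in above).
  move=> Gx Wx [Wt Gt <-]; split=> h; exact: mem_chambers.
rewrite leq_add // subset_leq_card //; apply/fintype.subsetP => s.
  case/chambersP => x [Wx Gx <-]; rewrite inE.
  have [t0 t00 t0P] := chamber_open G x u Gx.
  case: (ltrgtP (x e.1) (x e.2)) => h.
  - by apply/orP; left; apply: mem_chambers.
  - by apply/orP; right; apply: mem_chambers.
  - have [|G1 E1] := t0P t0; first by rewrite (gtr0_norm t00).
    have [|h1 h2] := shift x t0 Gx Wx; first by split=> //; apply: Wlin.2.
    move: ue; rewrite neq_lt => /orP[ue|ue].
      by rewrite h1 // h ltrD2r ltr_pM2l.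
    by rewrite h2 ?orbT // h ltrD2r ltr_pM2l.
case/chambersP => x [[Wx h] Gx <-]; rewrite inE.
have [t0 t00 t0P] := chamber_open G x u Gx.
have [|G1 E1] := t0P t0; first by rewrite (gtr0_norm t00).
have [|G2 E2] := t0P (- t0); first by rewrite normrN (gtr0_norm t00).
have [|h1 h2] := shift x t0 Gx Wx; first by split=> //; apply: Wlin.2.
have [|h3 h4] := shift x (- t0) Gx Wx; first by split=> //; apply: Wlin.2.
move: ue; rewrite neq_lt => /orP[ue|ue]; apply/andP; split.
- by apply: h1; rewrite h ltrD2r ltr_pM2l.
- by apply: h4; rewrite h ltrD2r !mulNr ltrN2 ltr_pM2l.
- by apply: h3; rewrite h ltrD2r !mulNr ltrN2 ltr_pM2l.
- by apply: h2; rewrite h ltrD2r ltr_pM2l.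
Qed.

End Add_edge.
End Chambers.

(** * Deleting a coordinate *)

Section Labels.
Context {R : realFieldType}.

Lemma ascents_eqP {n} (G : {set 'I_n * 'I_n}) (x y : 'I_n -> R) :
  ascents G x = ascents G y <->
  forall e, e \in G -> (x e.1 < x e.2) = (y e.1 < y e.2).
Proof.
split=> [/setP E e eG|E]; first by have := E e; rewrite !inE eG.
by apply/setP => e; rewrite !inE; case eG: (e \in G) => //=; apply: E.
Qed.

(** Chambers are compared through their points: [r] induces an injection
because the chamber on the right determines the one on the left. *)
Lemma leq_chambers {n m} (G : {set 'I_n * 'I_n}) (W : set ('I_n -> R))
    (G' : {set 'I_m * 'I_m}) (W' : set ('I_m -> R))
    (r : ('I_n -> R) -> ('I_m -> R) -> Prop) :
  (forall x, W x -> separates G x ->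
     exists y, [/\ W' y, separates G' y & r x y]) ->
  (forall x1 y1 x2 y2, r x1 y1 -> r x2 y2 ->
     separates G x1 -> separates G x2 ->
     ascents G' y1 = ascents G' y2 -> ascents G x1 = ascents G x2) ->
  (#|chambers G W| <= #|chambers G' W'|)%N.
Proof.
move=> tot inj.
have key s : s \in chambers G W -> exists s', s' \in chambers G' W' /\
   exists x y, [/\ separates G x, ascents G x = s, ascents G' y = s' & r x y].
  move=> /chambersP[x [Wx Gx <-]]; have [y [Wy Gy rxy]] := tot x Wx Gx.
  exists (ascents G' y); split; first exact: mem_chambers.
  by exists x, y.
have /boolp.choice[phi phiP] : forall s, exists s', s \in chambers G W ->
    s' \in chambers G' W' /\
   exists x y, [/\ separates G x, ascents G x = s, ascents G' y = s' & r x y].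
  move=> s; case: (boolP (s \in chambers G W)) => [/key[s' h]|_].
    by exists s'.
  by exists finset.set0.
rewrite -(card_in_imset (f := phi)); first last.
  move=> s1 s2 /phiP[_ [x1 [y1 [G1 <- <- r1]]]] /phiP[_ [x2 [y2 [G2 <- <- r2]]]].
  exact: inj r1 r2 G1 G2.
apply: subset_leq_card; apply/fintype.subsetP => _ /imsetP[s /phiP[h _] ->].
exact: h.
Qed.

Definition vcons {n} {T : Type} (t : T) (x : 'I_n -> T) : 'I_n.+1 -> T :=
  fun i => if unlift ord0 i is Some j then x j else t.

Lemma vcons0 {n T} (t : T) (x : 'I_n -> T) : vcons t x ord0 = t.
Proof. by rewrite /vcons unlift_none. Qed.

Lemma vconsS {n T} (t : T) (x : 'I_n -> T) i : vcons t x (lift ord0 i) = x i.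
Proof. by rewrite /vcons liftK. Qed.

Lemma vcons_eta {n T} (x : 'I_n.+1 -> T) :
  x = vcons (x ord0) (fun i => x (lift ord0 i)).
Proof. by apply: funext => i; rewrite /vcons; case: unliftP => [j|] ->. Qed.

(** For this union of complete graphs, one on each colour class, a chamber is a
choice of a linear order on every class. *)
Definition monochrome {n} {K : eqType} (f : 'I_n -> K) : {set 'I_n * 'I_n} :=
  [set e : 'I_n * 'I_n | (e.1 < e.2)%N && (f e.1 == f e.2)]%SET.

(** Together with [merge], the two operations of a deletion-restriction
recursion. *)
Definition project {n} (W : set ('I_n.+1 -> R)) : set ('I_n -> R) :=
  fun x => exists t, W (vcons t x).

Definition merge {n} (i : 'I_n) (W : set ('I_n.+1 -> R)) : set ('I_n -> R) :=
  fun x => W (vcons (x i) x).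

Lemma monochrome_chamberP {n} {K : eqType} (f : 'I_n -> K) (x y : 'I_n -> R) :
  separates (monochrome f) x -> separates (monochrome f) y ->
  ascents (monochrome f) x = ascents (monochrome f) y <->
  forall i j, f i = f j -> (x i < x j) = (y i < y j).
Proof.
move=> fx fy; rewrite ascents_eqP; split=> [E i j fij|E e]; last first.
  by rewrite inE => /andP[_ /eqP]; apply: E.
have [ij|ji|/val_inj->] := ltngtP i j; last by rewrite !ltxx.
  by rewrite (E (i, j)) // inE /= ij fij eqxx.
have ji_in : (j, i) \in monochrome f by rewrite inE /= ji fij eqxx.
have := E _ ji_in; have /= := fx _ ji_in; have /= := fy _ ji_in.
by case: (ltrgtP (x j) (x i)); case: (ltrgtP (y j) (y i)).
Qed.

Lemma separates_monochromeP {n} {K : eqType} (f : 'I_n -> K) (x : 'I_n -> R) :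
  separates (monochrome f) x <->
  forall i j, f i = f j -> i != j -> x i != x j.
Proof.
split=> [fx i j fij|fx e]; last first.
  rewrite inE => /andP[h /eqP fe]; apply: fx => //.
  by apply: contraTneq h => ->; rewrite ltnn.
rewrite neq_ltn => /orP[ij|ji].
  by apply: (fx (i, j)); rewrite inE /= ij fij eqxx.
by rewrite eq_sym; apply: (fx (j, i)); rewrite inE /= ji fij eqxx.
Qed.

Section Recursion.
Context {n : nat} {K : eqType} (f : 'I_n.+1 -> K) (W : set ('I_n.+1 -> R)).
Hypothesis Wlin : lin_closed W.
Let f' (i : 'I_n) : K := f (lift ord0 i).

Let lift2 (e : 'I_n * 'I_n) : 'I_n.+1 * 'I_n.+1 :=
  (lift ord0 e.1, lift ord0 e.2).
Let old_edges := (lift2 @: monochrome f')%SET.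
Let new_edges (l : seq 'I_n) := [set (ord0 : 'I_n.+1, lift ord0 j : 'I_n.+1) | j in l]%SET.

Let old_edgesP i j : ((lift ord0 i, lift ord0 j) \in old_edges)
  = ((i, j) \in monochrome f').
Proof.
apply/imsetP/idP => [[[a b] abP [/val_inj-> /val_inj->]]|h] //.
by exists (i, j).
Qed.

Let old_separates (x : 'I_n.+1 -> R) : separates old_edges x <->
  separates (monochrome f') (fun i => x (lift ord0 i)).
Proof.
split=> h e; last by move=> /imsetP[e' e'f ->]; apply: (h e').
by move=> ef; apply: (h (lift2 e)); apply: imset_f.
Qed.

Let old_ascents (x y : 'I_n.+1 -> R) : ascents old_edges x = ascents old_edges y <->
  ascents (monochrome f') (fun i => x (lift ord0 i)) =
  ascents (monochrome f') (fun i => y (lift ord0 i)).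
Proof.
rewrite !ascents_eqP; split=> h e; last by move=> /imsetP[e' e'f ->]; apply: h.
by move=> ef; apply: (h (lift2 e)); apply: imset_f.
Qed.

Let card_old : #|chambers old_edges W| = #|chambers (monochrome f') (project W)|.
Proof.
apply/eqP; rewrite eqn_leq; apply/andP; split.
  apply: (leq_chambers _ _ _ _ (fun x y => y = fun i => x (lift ord0 i))).
    move=> x Wx /old_separates sx; exists (fun i => x (lift ord0 i)); split=> //.
    by exists (x ord0); rewrite -vcons_eta.
  by move=> x1 _ x2 _ -> -> _ _ /old_ascents.
apply: (leq_chambers _ _ _ _ (fun y x => y = fun i => x (lift ord0 i))).
  move=> y [t Wt] sy; exists (vcons t y).
  have E : y = (fun i => vcons t y (lift ord0 i)).
    by apply: funext => i; rewrite vconsS.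
  by split=> //; apply/old_separates; rewrite -E.
by move=> _ x1 _ x2 -> -> _ _ /old_ascents.
Qed.

Let edges l := (old_edges :|: new_edges l)%SET.

Let new_edgesP l i j : ((i, j) \in new_edges l) =
  (i == ord0) && (if unlift ord0 j is Some j' then j' \in l else false).
Proof.
apply/imsetP/andP => [[j' j'l [-> ->]]|[/eqP->]].
  by rewrite liftK.
by case: unliftP => // j' -> j'l; exists j'.
Qed.

Let edges_cons i l : edges (i :: l) = ((ord0, lift ord0 i) |: edges l)%SET.
Proof.
apply/setP => -[a b]; rewrite !inE !new_edgesP.
rewrite xpair_eqE; case: (unliftP ord0 b) => [b'|] ->.
  rewrite inE (inj_eq lift_inj); case: (a == ord0); case: (b' == i) => //=;
  by rewrite ?orbT.
by rewrite (negbTE (neq_lift _ _)) !andbF.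
Qed.

Let card_wall i l : (forall j, j \in l -> f' j = f' i) -> i \notin l ->
  #|chambers (edges l) (fun x => W x /\ x ord0 = x (lift ord0 i))|
  = #|chambers (monochrome f') (merge i W)|.
Proof.
move=> lf il; apply/eqP; rewrite eqn_leq; apply/andP; split.
  apply: (leq_chambers _ _ _ _ (fun x y => x = vcons (y i) y)).
    move=> x [Wx xi] sx; exists (fun j => x (lift ord0 j)); split.
    - by rewrite /merge -xi -vcons_eta.
    - by apply/old_separates => e eG; apply: sx; rewrite inE eG.
    - by rewrite -xi -vcons_eta.
  move=> _ x1 _ x2 -> -> s1 s2.
  have s1' : separates (monochrome f') x1.
    move=> e eG; have := s1 (lift2 e); rewrite /= !vconsS; apply.
    by rewrite !inE imset_f.
  have s2' : separates (monochrome f') x2.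
    move=> e eG; have := s2 (lift2 e); rewrite /= !vconsS; apply.
    by rewrite !inE imset_f.
  move/(monochrome_chamberP _ _ _ s1' s2') => E.
  apply/ascents_eqP => -[a b]; rewrite inE new_edgesP => /orP[].
    move=> /imsetP[[a' b'] + [-> ->]]; rewrite inE => /andP[_ /= /eqP fab].
    by rewrite !vconsS; apply: E.
  move=> /andP[/eqP->]; case: unliftP => // b' -> b'l.
  by rewrite /= !vcons0 !vconsS; apply: E; rewrite lf.
apply: (leq_chambers _ _ _ _ (fun y x => x = vcons (y i) y)).
  move=> y Wy sy; exists (vcons (y i) y); split=> //.
    by split=> //; rewrite vcons0 vconsS.
  move=> [a b]; rewrite inE new_edgesP => /orP[].
    move=> /imsetP[[a' b'] h [-> ->]].
    by rewrite !vconsS; apply: (sy (a', b')).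
  move=> /andP[/eqP->]; case: unliftP => // b' -> b'l.
  rewrite /= vcons0 vconsS; move/separates_monochromeP: sy; apply.
    by rewrite lf.
  by apply: contraNneq il => ->.
move=> x1 _ x2 _ -> -> s1 s2 /ascents_eqP E; apply/ascents_eqP => e eG.
by have := E (lift2 e); rewrite /= !vconsS; apply; rewrite !inE imset_f.
Qed.

Let edges_notin i l : i \notin l -> (ord0, lift ord0 i) \notin edges l.
Proof.
move=> il; rewrite inE new_edgesP eqxx liftK (negbTE il) orbF.
by apply/imsetP => -[[a b] _ [/eqP]].
Qed.

Let monochrome_edges :
  monochrome f = edges [seq i <- index_enum 'I_n | f' i == f ord0].
Proof.
apply/setP => -[a b]; rewrite finset.in_setU new_edgesP.
case: (unliftP ord0 a) => [a'|] ->; case: (unliftP ord0 b) => [b'|] ->.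
- by rewrite old_edgesP !inE /= ltnS orbF.
- rewrite inE /= orbF.
  by apply/esym/negbTE/imsetP => -[[? ?] _ [_ /eqP]].
- rewrite inE /= mem_filter mem_index_enum andbT eq_sym.
  case: (_ == _); rewrite ?orbT ?orbF //.
  by apply/esym/negbTE/imsetP => -[[? ?] _ [/eqP]].
- rewrite inE ltnn /= orbF.
  by apply/esym/negbTE/imsetP => -[[? ?] _ [/eqP]].
Qed.

Let edges_nil : edges [::] = old_edges.
Proof. by apply/setP => -[a b]; rewrite inE new_edgesP; case: unlift => *; rewrite ?andbF orbF. Qed.

(** The edges at the first vertex are added one at a time. On the wall where
the first coordinate equals the [i]-th, the edges already added coincide with
edges at [i], because all these vertices have one colour; what remains is an
arrangement on the other coordinates. *)
Lemma card_chambers_recur_le :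
  (#|chambers (monochrome f) W| <= #|chambers (monochrome f') (project W)| +
     \sum_(i | f' i == f ord0) #|chambers (monochrome f') (merge i W)|)%N.
Proof.
rewrite monochrome_edges -big_filter.
have : uniq [seq i <- index_enum 'I_n | f' i == f ord0].
  by rewrite filter_uniq // index_enum_uniq.
have : {in [seq i <- index_enum 'I_n | f' i == f ord0], forall i, f' i = f ord0}.
  by move=> i; rewrite mem_filter => /andP[/eqP].
elim: [seq _ <- _ | _] => [|i l IH] fl /=.
  by rewrite big_nil addn0 edges_nil card_old.
move=> /andP[il ul]; rewrite big_cons edges_cons.
apply: leq_trans (card_chambersU1_le _ _ _ Wlin (edges_notin _ _ il)) _.
rewrite card_wall // => [|j jl]; last first.
  by rewrite !fl ?inE ?eqxx ?jl ?orbT.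
rewrite addnC [leqRHS]addnCA leq_add2l IH // => j jl.
by apply: fl; rewrite inE jl orbT.
Qed.

(** No wall contains [W], so that every addition of an edge is an equality. *)
Lemma card_chambers_recur :
  (forall i, exists2 u, W u & u ord0 != u (lift ord0 i)) ->
  (#|chambers (monochrome f) W| = #|chambers (monochrome f') (project W)| +
     \sum_(i | f' i == f ord0) #|chambers (monochrome f') (merge i W)|)%N.
Proof.
move=> Wu; rewrite monochrome_edges -big_filter.
have : uniq [seq i <- index_enum 'I_n | f' i == f ord0].
  by rewrite filter_uniq // index_enum_uniq.
have : {in [seq i <- index_enum 'I_n | f' i == f ord0], forall i, f' i = f ord0}.
  by move=> i; rewrite mem_filter => /andP[/eqP].
elim: [seq _ <- _ | _] => [|i l IH] fl /=.
  by rewrite big_nil addn0 edges_nil card_old.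
move=> /andP[il ul]; rewrite big_cons edges_cons.
have [u Wu' ui] := Wu i.
rewrite (card_chambersU1 _ _ _ Wlin (edges_notin _ _ il) u Wu' ui).
rewrite card_wall // => [|j jl]; last first.
  by rewrite !fl ?inE ?eqxx ?jl ?orbT.
rewrite addnC [RHS]addnCA IH // => j jl.
by apply: fl; rewrite inE jl orbT.
Qed.

End Recursion.
End Labels.

(** * Generic spaces and sums over labellings *)

(** Unsigned Stirling numbers of the first kind, which count the permutations
of [n] points with [j] cycles. *)
Fixpoint stirling1 (n j : nat) : nat :=
  match n, j with
  | 0, 0 => 1
  | 0, _.+1 => 0
  | n'.+1, 0 => n' * stirling1 n' 0
  | n'.+1, j'.+1 => stirling1 n' j' + n' * stirling1 n' j
  end.

(** The number of surjections from [m] points onto [k] points. *)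
Fixpoint surj (m k : nat) : nat :=
  match m, k with
  | 0, 0 => 1
  | 0, _.+1 => 0
  | _.+1, 0 => 0
  | m'.+1, k'.+1 => k * (surj m' k + surj m' k')
  end.

Lemma stirling1S0 n : stirling1 n.+1 0 = 0%N.
Proof. by elim: n => //= n; case: (n) => // n' ->; rewrite muln0. Qed.

Lemma stirling1_gt n j : (n < j)%N -> stirling1 n j = 0%N.
Proof.
elim: n j => [|n IH] [|j] //; rewrite ltnS => nj /=.
by rewrite (IH _ nj) (IH j.+1) ?muln0 // ltnS ltnW.
Qed.

Section Generic.
Context {R : realFieldType}.

(** This is what remains of the general position of a walk in dimension [d] for
the space [W] of linear relations between its closed steps. That space contains
the constant vectors, which is why both conditions apply at [d.+1] classes. *)
Definition generic {n} (d : nat) (W : set ('I_n -> R)) : Prop :=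
  forall (L : finType) (g : 'I_n -> L),
    ((d < #|codom g|)%N ->
       forall w, exists v : L -> R, W (fun i => w i - v (g i))) /\
    ((#|codom g| <= d.+1)%N ->
       forall v : L -> R, W (fun i => v (g i)) ->
       forall i j, v (g i) = v (g j)).

Lemma lin_closed_project {n} (W : set ('I_n.+1 -> R)) :
  lin_closed W -> lin_closed (project W).
Proof.
move=> [W0 WD]; split=> [|a x y [t Wt] [s Ws]].
  exists 0; rewrite (_ : vcons _ _ = fun=> 0) //.
  by apply: funext => i; rewrite /vcons; case: unlift.
exists (a * t + s); rewrite (_ : vcons _ _ =
  fun i => a * vcons t x i + vcons s y i); first exact: WD.
by apply: funext => i; rewrite /vcons; case: unlift.
Qed.

Lemma lin_closed_merge {n} (W : set ('I_n.+1 -> R)) i :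
  lin_closed W -> lin_closed (merge i W).
Proof.
move=> [W0 WD]; split=> [|a x y Wx Wy]; rewrite /merge.
  rewrite (_ : vcons _ _ = fun=> 0) //.
  by apply: funext => j; rewrite /vcons; case: unlift.
rewrite (_ : vcons _ _ =
  fun j => a * vcons (x i) x j + vcons (y i) y j); first exact: WD.
by apply: funext => j; rewrite /vcons; case: unlift.
Qed.

Lemma vcons_comp {n} {T T' : Type} (h : T -> T') (t : T) (x : 'I_n -> T) :
  vcons (h t) (fun i => h (x i)) = fun i => h (vcons t x i).
Proof. by apply: funext => i; rewrite /vcons; case: unlift. Qed.

Lemma codom_vcons {n} {L : finType} (t : L) (g : 'I_n -> L) :
  codom (vcons t g) =i [predU1 t & codom g].
Proof.
move=> y; rewrite !inE; apply/codomP/idP => [[i ->]|].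
  rewrite /vcons; case: unliftP => [j _|_]; last by rewrite eqxx.
  by rewrite codom_f orbT.
move=> /predU1P[->|/codomP[i ->]]; first by exists ord0; rewrite vcons0.
by exists (lift ord0 i); rewrite vconsS.
Qed.

(** The first coordinate joins the class of [i], so that the classes stay the
same in number. *)
Lemma generic_merge {n} d (W : set ('I_n.+1 -> R)) i :
  generic d W -> generic d (merge i W).
Proof.
move=> Wd L g; have cg : #|codom (vcons (g i) g)| = #|codom g|.
  rewrite (eq_card (codom_vcons _ _)); apply: eq_card => y.
  by rewrite !inE; case: eqP => // ->; rewrite codom_f.
have [h1 h2] := Wd _ (vcons (g i) g); rewrite cg in h1 h2; split=> c.
  move=> w; have [v Wv] := h1 c (vcons (w i) w); exists v; rewrite /merge.
  suff -> : vcons (w i - v (g i)) (fun j => w j - v (g j)) =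
            fun j => vcons (w i) w j - v (vcons (g i) g j) by [].
  by apply: funext => j; rewrite /vcons; case: unlift.
move=> v Wv a b; have := h2 c v; rewrite -vcons_comp => /(_ Wv).
by move=> /(_ (lift ord0 a) (lift ord0 b)); rewrite !vconsS.
Qed.

(** The first coordinate forms a class of its own, labelled [None], which uses
up one dimension. *)
Lemma generic_project {n} d (W : set ('I_n.+1 -> R)) :
  generic d W -> generic d.-1 (project W).
Proof.
move=> Wd L g; have cg : #|codom (vcons None (Some \o g))| = #|codom g|.+1.
  rewrite (eq_card (codom_vcons _ _)) cardU1 (_ : None \notin _); last first.
    by apply/codomP => -[].
  rewrite add1n; congr _.+1.
  have someI : injective (@Some L) by move=> ? ? [].
  rewrite -(fintype.card_image someI (mem (codom g))).
  apply: eq_card => y; apply/codomP/fintype.imageP.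
    by move=> [i ->]; exists (g i) => //; apply: codom_f.
  by move=> [_ /codomP[i ->] ->]; exists i.
have [h1 h2] := Wd _ (vcons None (Some \o g)); rewrite cg in h1 h2; split=> c.
  move=> w; have [|v Wv] := h1 _ (vcons 0 w); first by case: (d) c.
  exists (fun l => v (Some l)); exists (0 - v None).
  suff -> : vcons (0 - v None) (fun i => w i - v (Some (g i))) =
    fun i => vcons 0 w i - v (vcons None (Some \o g) i) by [].
  by apply: funext => j; rewrite /vcons; case: unlift.
move=> v [t Wv] i j; have [d0|d0] := posnP d.
  have /fintype.card_le1_eqP E : (#|codom g| <= 1)%N by rewrite d0 in c.
  by congr v; apply: E; apply: codom_f.
have c' : (#|codom g|.+1 <= d.+1)%N by rewrite ltnS -(prednK d0).
pose v' (l : option L) := if l is Some l' then v l' else t.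
have E : (fun k => v' (vcons None (Some \o g) k)) = vcons t (fun k => v (g k)).
  by rewrite -vcons_comp.
have := h2 c' v'; rewrite E => /(_ Wv (lift ord0 i) (lift ord0 j)).
by rewrite !vconsS.
Qed.

Section Labelings.
Context {K : finType} (v0 : K).

(** The label of the last index is pinned: this index will stand for the
closing step of a walk, which determines where the numbering of the blocks
begins. *)
Definition labelings n (A : {set K}) : {set {ffun 'I_n.+1 -> K}} :=
  [set f : {ffun 'I_n.+1 -> K} | ((f @: [set: 'I_n.+1]) == A)
     && (f ord_max == v0)]%SET.

Definition chamber_count n (A : {set K}) (W : set ('I_n.+1 -> R)) : nat :=
  \sum_(f in labelings n A) #|chambers (monochrome f) W|.

Definition fcons {n} (v : K) (f : {ffun 'I_n -> K}) : {ffun 'I_n.+1 -> K} :=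
  [ffun i => vcons v f i].

Lemma fconsE {n} v (f : {ffun 'I_n -> K}) : fcons v f = vcons v f :> (_ -> _).
Proof. by apply: funext => i; rewrite ffunE. Qed.

Lemma labelings_v0 n A f : f \in labelings n A -> v0 \in A.
Proof.
by rewrite inE => /andP[/eqP<- /eqP<-]; apply: imset_f; rewrite inE.
Qed.

Lemma mem_labelings n A f i : f \in labelings n A -> f i \in A.
Proof. by rewrite inE => /andP[/eqP<- _]; apply: imset_f; rewrite inE. Qed.

(** The two cases are whether the first label occurs again later. *)
Lemma fcons_labelings n A v (f : {ffun 'I_n.+1 -> K}) :
  (fcons v f \in labelings n.+1 A) =
  (v \in A) && ((f \in labelings n A) || (f \in labelings n (A :\ v)%SET)).
Proof.
have im : (fcons v f @: [set: 'I_n.+2] = v |: (f @: [set: 'I_n.+1]))%SET.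
  apply/setP => y; rewrite fconsE in_setU1; apply/imsetP/predU1P.
    move=> [i _ ->]; rewrite /vcons; case: unlift => [j|]; [right|by left].
    by apply: imset_f; rewrite inE.
  move=> [->|/imsetP[i _ ->]]; first by exists ord0; rewrite ?inE ?vcons0.
  by exists (lift ord0 i); rewrite ?inE ?vconsS.
have mx : fcons v f ord_max = f ord_max.
  by rewrite fconsE (_ : ord_max = lift ord0 ord_max) ?vconsS //; apply: val_inj.
rewrite !inE im mx -andb_orl andbA; congr (_ && _).
apply/eqP/andP => [E|[vA /orP[/eqP->|/eqP->]]].
- have vA : v \in A by rewrite -E finset.setU11.
  split=> //; rewrite -E; case: (boolP (v \in f @: [set: 'I_n.+1])%SET) => h.
    by rewrite (finset.setUidPr _) ?eqxx // finset.sub1set.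
  by rewrite finset.setU1K ?eqxx ?orbT.
- by apply/finset.setUidPr; rewrite finset.sub1set.
- by rewrite finset.setD1K.
Qed.

Lemma sum_labelings n A (F : {ffun 'I_n.+2 -> K} -> nat) :
  (\sum_(f in labelings n.+1 A) F f = \sum_(v in A)
    (\sum_(f in labelings n A) F (fcons v f) +
     \sum_(f in labelings n (A :\ v)%SET) F (fcons v f)))%N.
Proof.
rewrite (reindex (fun p : K * {ffun 'I_n.+1 -> K} => fcons p.1 p.2)); last first.
  exists (fun f : {ffun _} => (f ord0, [ffun i => f (lift ord0 i)])) => [[v f]|f] _.
    congr pair; rewrite /= ?ffunE ?vcons0 //.
    by apply/ffunP => i; rewrite !ffunE vconsS.
  apply/ffunP => i; rewrite ffunE /= [in RHS](vcons_eta f).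
  by rewrite /vcons; case: unlift => // j; rewrite ffunE.
rewrite (eq_bigl (fun p => (p.1 \in A) && ((p.2 \in labelings n A)
   || (p.2 \in labelings n (A :\ p.1)%SET)))); last first.
  by move=> p; apply: fcons_labelings.
rewrite -(pair_big_dep (mem A) (fun v f => (f \in labelings n A)
   || (f \in labelings n (A :\ v)%SET)) (fun v f => F (fcons v f))) /=.
apply: eq_bigr => v vA.
rewrite (bigID (fun f => f \in labelings n A)) /=; congr addn.
  by apply: eq_bigl => f; case: (_ \in labelings n A); rewrite ?andbF.
apply: eq_bigl => f; case: (boolP (f \in labelings n A)) => h; rewrite ?andbF ?andbT //=.
apply/esym/negbTE; move: h; rewrite !inE => /andP[/eqP-> _]; rewrite negb_and.
apply/orP; left; apply/eqP => /setP/(_ v).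
by rewrite !inE eqxx vA.
Qed.

Lemma sum_fibers n A (f : {ffun 'I_n.+1 -> K}) (r : 'I_n.+1 -> nat) :
  f \in labelings n A ->
  (\sum_(v in A) \sum_(i | f i == v) r i = \sum_i r i)%N.
Proof.
move=> fA; rewrite [RHS](partition_big f (mem A)) //= => i _.
exact: mem_labelings fA.
Qed.

Lemma fconsS n v (f : {ffun 'I_n -> K}) : (fun i => fcons v f (lift ord0 i)) = f.
Proof. by apply: funext => i; rewrite fconsE vconsS. Qed.

Lemma fcons0 n v (f : {ffun 'I_n -> K}) : fcons v f ord0 = v.
Proof. by rewrite fconsE vcons0. Qed.

Lemma recursion_sum n (A : {set K}) (W : set ('I_n.+2 -> R)) :
  (\sum_(f in labelings n.+1 A)
     (#|chambers (monochrome (fun i => f (lift ord0 i))) (project W)| +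
      \sum_(i | f (lift ord0 i) == f ord0)
         #|chambers (monochrome (fun i => f (lift ord0 i))) (merge i W)|) =
   #|A| * chamber_count n A (project W) +
   \sum_(v in A) chamber_count n (A :\ v)%SET (project W) +
   \sum_i chamber_count n A (merge i W))%N.
Proof.
rewrite sum_labelings big_split /=.
have -> : (\sum_(v in A) \sum_(f in labelings n (A :\ v)%SET)
     (#|chambers (monochrome (fun i => fcons v f (lift ord0 i))) (project W)| +
      \sum_(i | fcons v f (lift ord0 i) == fcons v f ord0)
         #|chambers (monochrome (fun i => fcons v f (lift ord0 i))) (merge i W)|)
   = \sum_(v in A) chamber_count n (A :\ v)%SET (project W))%N.
  apply: eq_bigr => v _; apply: eq_bigr => f fA.
  rewrite fconsS big1 ?addn0 // => i /eqP.
  rewrite fcons0 fconsE vconsS => fv.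
  by have := mem_labelings _ _ _ i fA; rewrite fv !inE eqxx.
rewrite [RHS]addnAC; congr addn.
rewrite (eq_bigr (fun v => chamber_count n A (project W) +
   \sum_(f in labelings n A) \sum_(i | f i == v)
       #|chambers (monochrome f) (merge i W)|)%N); last first.
  move=> v _; rewrite -big_split /=; apply: eq_bigr => f fA.
  rewrite fconsS; congr addn; apply: eq_bigl => i.
  by rewrite fcons0 fconsE vconsS.
rewrite big_split /= sum_nat_const; congr addn.
rewrite exchange_big /= [RHS]exchange_big /=; apply: eq_bigr => f fA.
exact: sum_fibers.
Qed.

(** The first two sums come from the projection, according to whether the first
label occurs again, and the last one comes from the walls. *)
Lemma chamber_count_recur_le n (A : {set K}) (W : set ('I_n.+2 -> R)) : lin_closed W ->
  (chamber_count n.+1 A W <=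
   #|A| * chamber_count n A (project W) +
   \sum_(v in A) chamber_count n (A :\ v)%SET (project W) +
   \sum_i chamber_count n A (merge i W))%N.
Proof.
move=> Wlin; rewrite -recursion_sum; apply: leq_sum => f _.
exact: card_chambers_recur_le.
Qed.

Lemma chamber_count_recur n (A : {set K}) (W : set ('I_n.+2 -> R)) : lin_closed W ->
  (forall i, exists2 u, W u & u ord0 != u (lift ord0 i)) ->
  (chamber_count n.+1 A W =
   #|A| * chamber_count n A (project W) +
   \sum_(v in A) chamber_count n (A :\ v)%SET (project W) +
   \sum_i chamber_count n A (merge i W))%N.
Proof.
move=> Wlin Wu; rewrite -recursion_sum; apply: eq_bigr => f _.
exact: card_chambers_recur.
Qed.

Lemma chamber_count_notin n (A : {set K}) (W : set ('I_n.+1 -> R)) :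
  v0 \notin A -> chamber_count n A W = 0%N.
Proof.
by move=> h; rewrite /chamber_count big1 // => f /labelings_v0; rewrite (negbTE h).
Qed.

Lemma sum_chamber_count_v0 n (A : {set K}) (W : set ('I_n.+1 -> R)) :
  (\sum_(v in A) chamber_count n (A :\ v)%SET W =
   \sum_(v in A :\ v0) chamber_count n (A :\ v)%SET W)%N.
Proof.
rewrite [LHS](bigID (fun v => v == v0)) /= big1 ?add0n; last first.
  by move=> v /andP[_ /eqP->]; rewrite chamber_count_notin // !inE eqxx.
by apply: eq_bigl => v; rewrite !inE andbC.
Qed.

End Labelings.
End Generic.

(** * Bounds on the number of chambers *)

Section Chamber_bounds.
Context {R : realFieldType} {K : finType} (v0 : K).

Notation count := (chamber_count v0).

Definition cycle_sum (d n k : nat) : nat :=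
  \sum_(d.+1 <= j < n.+2) stirling1 n.+1 j * surj j k.

Lemma card_chambers_edgeless {n} (G : {set 'I_n * 'I_n}) (W : set ('I_n -> R)) :
  G = finset.set0 -> (#|chambers G W| <= 1)%N.
Proof.
move=> ->; rewrite -(cards1 (finset.set0 : {set 'I_n * 'I_n})).
apply: subset_leq_card; apply/fintype.subsetP => s /chambersP[x [_ _ <-]].
by apply/set1P/setP => e; rewrite !inE.
Qed.

Lemma monochrome_ord1 (f : 'I_1 -> K) : monochrome f = finset.set0.
Proof. by apply/setP => -[i j]; rewrite !inE !ord1 ltnn. Qed.

Lemma labelings0 (A : {set K}) f : f \in labelings v0 0 A ->
  f = [ffun=> v0] /\ A = [set v0]%SET.
Proof.
rewrite inE => /andP[/eqP<- /eqP f0].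
have E i : f i = v0 by rewrite -f0; congr (f _); rewrite !ord1.
split; first by apply/ffunP => i; rewrite ffunE.
apply/setP => v; rewrite inE; apply/imsetP/eqP => [[i _ ->]|->]; first exact: E.
by exists ord0; rewrite ?inE ?E.
Qed.

Lemma chamber_count0_le (A : {set K}) (W : set ('I_1 -> R)) :
  (count 0 A W <= (A == [set v0]%SET))%N.
Proof.
rewrite /chamber_count; case: eqP => [->|nA].
  apply: (@leq_trans (\sum_(f in labelings v0 0 [set v0]%SET) 1)%N).
    by apply: leq_sum => f _; rewrite card_chambers_edgeless ?monochrome_ord1.
  rewrite sum1_card.
  apply: (@leq_trans #|[set ([ffun=> v0] : {ffun 'I_1 -> K})]%SET|); last first.
    by rewrite cards1.
  apply: subset_leq_card; apply/fintype.subsetP => f /labelings0[-> _].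
  exact/set1P.
by rewrite big1 // => f /labelings0[_ /nA].
Qed.

(** The right-hand side satisfies the recursion with equality. The bound is
attained by the whole space, as [descending_pairs_count] shows. *)
Lemma chamber_count_le n (A : {set K}) (W : set ('I_n.+1 -> R)) :
  lin_closed W -> (count n A W <= n`! * 'C(n.+1, #|A|))%N.
Proof.
elim: n A W => [|n IH] A W Wlin.
  apply: leq_trans (chamber_count0_le A W) _; case: eqP => // ->.
  by rewrite cards1.
case: (boolP (v0 \in A)) => [v0A|]; last by move/chamber_count_notin->.
apply: leq_trans (chamber_count_recur_le _ _ _ _ Wlin) _.
rewrite sum_chamber_count_v0.
have cA : #|A| = #|(A :\ v0)%SET|.+1 by rewrite (cardsD1 v0 A) v0A.
set k := #|(A :\ v0)%SET| in cA *.
apply: (@leq_trans (#|A| * (n`! * 'C(n.+1, #|A|)) +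
   k * (n`! * 'C(n.+1, k)) + n.+1 * (n`! * 'C(n.+1, #|A|)))%N).
  apply: leq_add; first apply: leq_add.
  - by rewrite leq_mul2l IH ?orbT //; exact: lin_closed_project.
  - rewrite -sum_nat_const leq_sum // => v; rewrite !inE => /andP[_ vA].
    have <- : #|(A :\ v)%SET| = k by apply: succn_inj; rewrite -cA (cardsD1 v A) vA.
    by apply: IH; exact: lin_closed_project.
  - rewrite -[X in (X * _)%N](card_ord n.+1) -sum_nat_const leq_sum // => i _.
    by apply: IH; exact: lin_closed_merge.
rewrite cA factS [in leqRHS]binS.
have E : (k.+1 * 'C(n.+1, k.+1) = (n.+1 - k) * 'C(n.+1, k))%N by rewrite mul_bin_left.
have [kn|kn] := leqP k n.+1; last first.
  by rewrite !bin_small ?muln0 // ltnW.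
have nE : n.+1 = (n.+1 - k + k)%N by rewrite subnK.
move: E; set x := 'C(_, k.+1); set y := 'C(_, k); set z := n`!.
set m := (n.+1 - k)%N in nE * => E.
apply/eq_leq; rewrite mulnCA E [in LHS]nE [X in (X * z * _)%N]nE; ring.
Qed.

(** Vectors of [W] cannot separate two coordinates of the same label, so only
labellings whose first label occurs once contribute. *)
Lemma chamber_count_const n (A : {set K}) (W : set ('I_n.+2 -> R)) :
  lin_closed W -> (forall x, W x -> forall i j, x i = x j) ->
  (count n.+1 A W <= \sum_(v in A) count n (A :\ v)%SET (project W))%N.
Proof.
move=> Wlin Wc; rewrite {1}/chamber_count sum_labelings leq_sum // => v vA.
rewrite big1 ?add0n => [|f fA]; last first.
  have : v \in (f @: [set: 'I_n.+1])%SET by move: fA; rewrite inE => /andP[/eqP->].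
  move=> /imsetP[i _ vi]; apply/eqP; rewrite cards_eq0; apply/eqP/setP => s.
  rewrite finset.in_set0; apply/chambersP => -[x [Wx sx _]].
  have := sx (ord0, lift ord0 i); rewrite /= (Wc x Wx _ (lift ord0 i)) eqxx.
  by move=> h; have := h _; rewrite inE /= !fconsE vcons0 vconsS vi eqxx => /(_ isT).
apply: leq_sum => f fA.
apply: leq_trans (card_chambers_recur_le _ _ Wlin) _.
rewrite fconsS big1 ?addn0 // => i /eqP.
rewrite fcons0 fconsE vconsS => fv.
by have := mem_labelings _ _ _ _ i fA; rewrite fv !inE eqxx.
Qed.

(** The recurrences of both number triangles, multiplied and summed over [j].
*)
Lemma cycle_sum_recur d n k :
  (k.+1 * (cycle_sum d.-1 n k.+1 + cycle_sum d.-1 n k) + n.+1 * cycle_sum d n k.+1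
    <= cycle_sum d n.+1 k.+1)%N.
Proof.
rewrite [in leqRHS]/cycle_sum big_add1 /=.
have E j : (stirling1 n.+2 j.+1 * surj j.+1 k.+1 =
  k.+1 * (stirling1 n.+1 j * surj j k.+1 + stirling1 n.+1 j * surj j k) +
  n.+1 * (stirling1 n.+1 j.+1 * surj j.+1 k.+1))%N.
  rewrite [stirling1 n.+2 _](_ : _ = stirling1 n.+1 j + n.+1 * stirling1 n.+1 j.+1)%N //.
  rewrite [surj j.+1 k.+1](_ : _ = k.+1 * (surj j k.+1 + surj j k))%N //.
  ring.
under eq_bigr do rewrite E.
rewrite big_split /= -!big_distrr big_split /=; apply: leq_add.
  rewrite leq_mul2l /= /cycle_sum; apply: leq_add; case: d => [|d] //=.
  - by rewrite [leqRHS]big_ltn // leq_addl.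
  - by rewrite [leqRHS]big_ltn // leq_addl.
rewrite leq_mul2l /= /cycle_sum [leqLHS]big_add1 /=.
rewrite -[leqLHS]addn0.
have [dn|nd] := leqP d n.+1; last by rewrite big_geq // ltnW.
rewrite [leqRHS]big_nat_recr //= leq_add //.
Qed.

(** Averaging over the labels other than [v0]; the summand that removes [v0]
vanishes because the last index carries this label. *)
Lemma sum_removal_le n (A : {set K}) (W : set ('I_n.+1 -> R)) b :
  (forall v, v \in (A :\ v0)%SET ->
     #|(A :\ v0)%SET| * count n (A :\ v)%SET W <= b)%N ->
  (\sum_(v in A) count n (A :\ v)%SET W <= b)%N.
Proof.
move=> h; rewrite sum_chamber_count_v0.
set k := #|_| in h; have [k0|k0] := posnP k.
  by move/eqP: k0; rewrite cards_eq0 => /eqP->; rewrite finset.big_set0.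
rewrite -(leq_pmul2l k0) big_distrr /= -sum_nat_const; exact: leq_sum.
Qed.

Lemma le_sum_removal n (A : {set K}) (W : set ('I_n.+1 -> R)) b :
  (0 < #|(A :\ v0)%SET|)%N ->
  (forall v, v \in (A :\ v0)%SET ->
     b <= #|(A :\ v0)%SET| * count n (A :\ v)%SET W)%N ->
  (b <= \sum_(v in A) count n (A :\ v)%SET W)%N.
Proof.
move=> k0 h; rewrite sum_chamber_count_v0.
rewrite -(leq_pmul2l k0) big_distrr /= -sum_nat_const; exact: leq_sum.
Qed.

Lemma card_removal (A : {set K}) v : v0 \in A -> v \in (A :\ v0)%SET ->
  #|(A :\ v)%SET| = #|(A :\ v0)%SET|.
Proof.
move=> v0A; rewrite !inE => /andP[_ vA]; apply: succn_inj.
by have := cardsD1 v0 A; have := cardsD1 v A; rewrite v0A vA => ->.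
Qed.

Lemma codom_id_card n : #|codom (fun i : 'I_n => i)| = n.
Proof.
rewrite -[RHS](card_ord n) -[RHS](fintype.card_codom (f := fun i : 'I_n => i)) //.
Qed.

(** Induction along the recursion: projecting lowers [d] by one, merging keeps
it, and [cycle_sum] satisfies the opposite inequality. When [d] reaches the
number of coordinates minus one, merging is no longer possible, but then [W]
only contains constant vectors. *)
Lemma chamber_count_upper n d (A : {set K}) (W : set ('I_n.+1 -> R)) :
  lin_closed W -> generic d W -> (d <= n)%N ->
  (#|A| * count n A W <= cycle_sum d n #|A|)%N.
Proof.
elim: n d A W => [|n IH] d A W Wlin Wd dn.
  move: dn; rewrite leqn0 => /eqP->.
  have := chamber_count0_le A W; case: eqP => [-> h|_].
    by rewrite /cycle_sum cards1 mul1n big_nat1.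
  by rewrite leqn0 => /eqP->; rewrite muln0.
case: (boolP (v0 \in A)) => [v0A|h]; last by rewrite chamber_count_notin // muln0.
have cA : #|A| = #|(A :\ v0)%SET|.+1 by rewrite (cardsD1 v0 A) v0A.
have W'lin := lin_closed_project _ Wlin.
have W'd := generic_project _ _ Wd.
have removal : (\sum_(v in A) count n (A :\ v)%SET (project W) <=
    cycle_sum d.-1 n #|(A :\ v0)%SET|)%N.
  apply: sum_removal_le => v vA; rewrite -(card_removal _ _ v0A vA).
  by apply: IH => //; case: (d) dn.
apply: (@leq_trans (#|A| * (cycle_sum d.-1 n #|A| +
     cycle_sum d.-1 n #|(A :\ v0)%SET|) + n.+1 * cycle_sum d n #|A|)%N); last first.
  by rewrite cA; exact: cycle_sum_recur.
move: dn; rewrite leq_eqVlt ltnS => /predU1P[E|dn].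
  have Wc x : W x -> forall i j, x i = x j.
    have [_ Wd2] := Wd _ (fun i : 'I_n.+2 => i).
    by move=> Wx i j; apply: Wd2 => //; rewrite codom_id_card E.
  apply: (@leq_trans (#|A| * cycle_sum d.-1 n #|(A :\ v0)%SET|)%N).
    rewrite leq_mul2l; apply/orP; right.
    exact: leq_trans (chamber_count_const _ _ _ Wlin Wc) removal.
  by rewrite mulnDr -addnA addnCA leq_addr.
apply: (@leq_trans (#|A| * (#|A| * count n A (project W) +
   \sum_(v in A) count n (A :\ v)%SET (project W) +
   \sum_i count n A (merge i W)))%N).
  by rewrite leq_mul2l chamber_count_recur_le ?orbT.
rewrite mulnDr; apply: leq_add.
  rewrite leq_mul2l; apply/orP; right; apply: leq_add => //.
  by apply: IH => //; case: (d) dn => // d' /ltnW.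
rewrite big_distrr /= -[X in (X * _)%N](card_ord n.+1) -sum_nat_const.
apply: leq_sum => i _; apply: IH => //; first exact: lin_closed_merge.
exact: generic_merge.
Qed.

(** With the coordinates [ord0] and [lift ord0 i] in one class and each of the
others alone, there are more than [d] classes. *)
Lemma generic_separating n d (W : set ('I_n.+2 -> R)) i :
  generic d W -> (d <= n)%N -> exists2 u, W u & u ord0 != u (lift ord0 i).
Proof.
move=> Wd dn; pose g (j : 'I_n.+2) := if j == ord0 then lift ord0 i else j.
have cg : (d < #|codom g|)%N.
  have c : #|predC1 (ord0 : 'I_n.+2)| = n.+1 by rewrite cardC1 card_ord.
  apply: (@leq_trans #|predC1 (ord0 : 'I_n.+2)|); first by rewrite c.
  apply: subset_leq_card; apply/fintype.subsetP => j; rewrite inE => j0.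
  by apply/codomP; exists j; rewrite /g (negbTE j0).
have [h _] := Wd _ g; have [v Wv] := h cg (fun j => (j == ord0)%:R).
exists (fun j => (j == ord0)%:R - v (g j)) => //=.
rewrite /g !eqxx [lift _ _ == _](_ : _ = false) /=; last first.
  by apply/negbTE; rewrite eq_sym neq_lift.
by rewrite (inj_eq (addIr _)) oner_eq0.
Qed.

(** The same induction with equality in the recursion, following a single [j].
The condition [j = d.+2] is kept by projecting, where [j] and [d] both drop by
one, and by merging, where both stay; once [d = 0] is reached, all [j] are
allowed. *)
Lemma chamber_count_lower n d j (A : {set K}) (W : set ('I_n.+1 -> R)) :
  lin_closed W -> generic d W -> v0 \in A -> d = 0%N \/ j = d.+2 ->
  (stirling1 n.+1 j * surj j #|A| <= #|A| * count n A W)%N.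
Proof.
elim: n d j A W => [|n IH] d j A W Wlin Wd v0A dj.
  case: j dj => [|[|j]] dj //=.
  rewrite !addn0 !mul1n; case E: #|A| => [|[|k]] //=; rewrite ?muln0 //.
  have -> : A = [set v0]%SET.
    by apply/eqP; rewrite eq_sym eqEcard finset.sub1set v0A cards1 E.
  rewrite !muln1 mul1n /chamber_count (bigD1 [ffun=> v0]) /=; last first.
    rewrite inE ffunE eqxx andbT; apply/eqP/setP => v; rewrite inE.
    apply/imsetP/eqP => [[i _ ->]|->]; first by rewrite ffunE.
    by exists ord0; rewrite ?inE ?ffunE.
  rewrite addn_gt0; apply/orP; left; apply/card_gt0P; exists finset.set0.
  apply/chambersP; exists (fun=> 0); split; first exact: Wlin.1.
    by move=> e; rewrite monochrome_ord1 inE.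
  by apply/setP => e; rewrite monochrome_ord1 !inE.
case: j dj => [|j] dj; first by rewrite stirling1S0.
have cA : #|A| = #|(A :\ v0)%SET|.+1 by rewrite (cardsD1 v0 A) v0A.
have [dn|nd] := leqP d n; last first.
  case: dj => [d0|[->]]; first by rewrite d0 in nd.
  by rewrite stirling1_gt // !ltnS.
have W'lin := lin_closed_project _ Wlin.
have W'd := generic_project _ _ Wd.
have dj' : d.-1 = 0%N \/ j = d.-1.+2.
  by case: dj => [->|[->]]; [left|case: (d); [left|right]].
rewrite chamber_count_recur //; last by move=> i; exact: generic_separating Wd dn.
have -> : (stirling1 n.+2 j.+1 * surj j.+1 #|A| =
  #|A| * (stirling1 n.+1 j * surj j #|A| +
          stirling1 n.+1 j * surj j #|(A :\ v0)%SET|) +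
  n.+1 * (stirling1 n.+1 j.+1 * surj j.+1 #|A|))%N.
  rewrite cA.
  set k := #|_|.
  rewrite [stirling1 n.+2 _](_ : _ = stirling1 n.+1 j + n.+1 * stirling1 n.+1 j.+1)%N //.
  rewrite [surj j.+1 k.+1](_ : _ = k.+1 * (surj j k.+1 + surj j k))%N //.
  ring.
rewrite [leqRHS]mulnDr; apply: leq_add.
  rewrite leq_mul2l; apply/orP; right; apply: leq_add; first exact: IH dj'.
  have [k0|k0] := posnP #|(A :\ v0)%SET|.
    by rewrite k0; case: (j) => [|j']; [rewrite stirling1S0|rewrite [surj _ 0]/= muln0].
  apply: le_sum_removal => // v vA; rewrite -(card_removal _ _ v0A vA).
  apply: (IH _ _ _ _ W'lin W'd _ dj').
  by move: vA; rewrite !inE v0A andbT eq_sym => /andP[].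
rewrite big_distrr -[X in (X * _ <= _)%N](card_ord n.+1) -sum_nat_const.
apply: leq_sum => i _; apply: (IH d) => //; first exact: lin_closed_merge.
exact: generic_merge.
Qed.

End Chamber_bounds.

(** * Orders of the steps and sets of block starts *)

Section Cyclic_blocks.
Context {m : nat}.
Implicit Types (I : {set 'I_m.+1}) (p q : 'I_m.+1).

Lemma val_ord_pred p : ord_pred p = (if p == ord0 then m else p.-1) :> nat.
Proof.
case: (altP (p =P ord0)) => [->|p0].
  by rewrite /= modn_small.
have p0' : (0 < p)%N by rewrite lt0n; apply: contra p0 => /eqP e; apply/eqP/val_inj.
rewrite /= -{1}(prednK p0') addSn /= modnDr modn_small // (leq_ltn_trans (leq_pred _)) //.
Qed.

(** When [I] cuts the cycle 0, ..., m into blocks that begin at its elements,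
this is the number of the block of [p]. *)
Definition rank_in I p : nat := #|[set i in I | (i <= p)%N]%SET|.

(** The indices before the first element of [I] continue the last block, and
are placed behind [m] to make every block an interval. *)
Definition unrolled I p : nat := p + m.+1 * (rank_in I p == 0).

Lemma rank_in_pred I p :
  rank_in I p = (if p == ord0 then 0 else rank_in I (ord_pred p)) + (p \in I).
Proof.
rewrite /rank_in (cardsD1 p) inE leqnn andbT addnC; congr addn.
case: ifPn => [/eqP->|p0].
  apply/eqP; rewrite cards_eq0; apply/eqP/setP => i; rewrite !inE leqn0.
  by apply/negbTE; apply/negP => /and3P[/eqP i0 _ /eqP i0']; apply/i0/val_inj.
congr #|pred_of_set _|; apply/setP => i; rewrite !inE val_ord_pred (negbTE p0).
have p0' : (0 < p)%N by rewrite lt0n; apply: contra p0 => /eqP e; apply/eqP/val_inj.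
rewrite andbCA; congr andb; rewrite -[in RHS]ltnS (prednK p0') ltn_neqAle.
by congr andb; rewrite -(inj_eq val_inj).
Qed.

Lemma rank_in_pred_notin I p : p \notin I ->
  rank_in I p = if p == ord0 then 0 else rank_in I (ord_pred p).
Proof. by move=> pI; rewrite {1}rank_in_pred (negbTE pI); exact: addn0. Qed.

Lemma rank_in_max I : rank_in I ord_max = #|I|.
Proof.
by congr #|pred_of_set _|; apply/setP => i; rewrite inE -ltnS ltn_ord andbT.
Qed.

Lemma leq_rank_in I p q : (p <= q)%N -> (rank_in I p <= rank_in I q)%N.
Proof.
move=> pq; apply: subset_leq_card; apply/fintype.subsetP => i.
by rewrite !inE => /andP[-> /leq_trans->].
Qed.

Lemma ltn_rank_in I p q : (p < q)%N -> q \in I -> (rank_in I p < rank_in I q)%N.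
Proof.
move=> pq qI; apply: proper_card; apply/fintype.properP; split.
  by apply/fintype.subsetP => i; rewrite !inE => /andP[-> /leq_trans->] //; apply: ltnW.
by exists q; rewrite !inE qI ?leqnn // -ltnNge.
Qed.

Lemma rank_in_leq I p : (rank_in I p <= #|I|)%N.
Proof. by rewrite -rank_in_max leq_rank_in // -ltnS ltn_ord. Qed.

Lemma rank_in_inj I I' : (forall p, rank_in I p = rank_in I' p) -> I = I'.
Proof.
move=> E; apply/setP => p; have := E p; rewrite (rank_in_pred I) (rank_in_pred I') E => /addnI.
by case: (_ \in I); case: (_ \in I').
Qed.

Lemma unrolled_inj I : injective (unrolled I).
Proof.
move=> p q E; apply: val_inj; move: (congr1 (fun x => (x %% m.+1)%N) E).
by rewrite /unrolled ![(_ + m.+1 * _)%N]addnC ![(m.+1 * _)%N]mulnC !modnMDl !modn_small.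
Qed.

Section Blocks.
Context (k : nat) (I : {set 'I_m.+1}).
Hypothesis cI : #|I| = k.+1.

(** The last block wraps around, so the ranks [0] and [k.+1] get the same
label. *)
Definition label p : 'I_k.+1 := inord (rank_in I p %% k.+1).

Lemma label_eqP p q : label p = label q <-> rank_in I p = rank_in I q %[mod k.+1].
Proof.
split=> [/(congr1 val)|E]; last by rewrite /label E.
by rewrite /= !inordK // ltn_mod.
Qed.

Lemma label_max : label ord_max = ord0.
Proof. by apply: val_inj; rewrite /= inordK ?ltn_mod // rank_in_max cI modnn. Qed.

Lemma label_pred p : p \notin I -> label (ord_pred p) = label p.
Proof.
move=> pI; have := rank_in_pred_notin I p pI.
case: ifPn => [/eqP-> E|_ E]; last by apply/label_eqP; rewrite E.
have -> : ord_pred ord0 = ord_max :> 'I_m.+1 by apply: ord_inj; rewrite val_ord_pred eqxx.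
by apply/label_eqP; rewrite E rank_in_max cI modnn mod0n.
Qed.

Lemma unrolled_pred p : p \notin I -> unrolled I p = (unrolled I (ord_pred p)).+1.
Proof.
move=> pI; have := rank_in_pred_notin I p pI; rewrite /unrolled.
rewrite val_ord_pred; case: ifPn => [/eqP-> ->|p0 ->].
  have -> : ord_pred ord0 = ord_max :> 'I_m.+1 by apply: ord_inj; rewrite val_ord_pred eqxx.
  by rewrite rank_in_max cI muln1 muln0 addn0.
rewrite -addSn prednK // lt0n; apply: contra p0 => /eqP e; exact/eqP/val_inj.
Qed.

Lemma block_start_first p q :
  label p = label q -> (unrolled I p < unrolled I q)%N -> q \notin I.
Proof.
move=> /label_eqP pq lt_pq; apply/negP => qI; move: lt_pq; rewrite /unrolled.
have q0 : (0 < rank_in I q)%N by rewrite rank_in_pred qI addn_gt0 /= orbT.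
rewrite (gtn_eqF q0) muln0 addn0 => h.
have p0 : (0 < rank_in I p)%N.
  rewrite lt0n; apply: contraTN h => ->; rewrite muln1 -leqNgt.
  by rewrite (leq_trans (ltnW (ltn_ord q))) // leq_addl.
rewrite (gtn_eqF p0) muln0 addn0 in h.
have := ltn_rank_in _ _ _ h qI => lt_r.
have := rank_in_leq I q; rewrite cI.
move: pq p0 q0 lt_r; set a := rank_in I p; set b := rank_in I q.
case: a => // a; case: b => // b.
move=> /eqP; rewrite -[a.+1]addn1 -[b.+1]addn1 eqn_modDr !addn1 !ltnS => + _ _ ab bk.
by rewrite !modn_small ?ltnS // ?(leq_trans (ltnW ab)) // (ltn_eqF ab).
Qed.

(** Walking back from [q] to [p] inside their common block. *)
Lemma block_chain {T : Type} (r : T -> T -> Prop) (x : 'I_m.+1 -> T) :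
  (forall a b c, r a b -> r b c -> r a c) ->
  (forall i, i \notin I -> r (x i) (x (ord_pred i))) ->
  forall p q, label p = label q -> (unrolled I p < unrolled I q)%N -> r (x q) (x p).
Proof.
move=> tr xI p q pq lt_pq; move: (leqnn (unrolled I q - unrolled I p)).
move: {2}(unrolled I q - unrolled I p)%N => l.
elim: l => [|l IH] in q pq lt_pq *.
  by rewrite leqn0 subn_eq0 leqNgt lt_pq.
have qI := block_start_first _ _ pq lt_pq.
rewrite (unrolled_pred _ qI) ltnS leq_eqVlt in lt_pq *.
case/predU1P: lt_pq => [/unrolled_inj E _|lt_pq le_l]; first by rewrite E; exact: xI.
apply: tr (xI _ qI) (IH _ _ lt_pq _); first by rewrite label_pred.
by rewrite -ltnS; apply: leq_trans le_l; rewrite subSn // ltnW.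
Qed.

Lemma decreasing_on_blocks {R : numDomainType} (x : 'I_m.+1 -> R) :
  (forall i, i \notin I -> x i < x (ord_pred i)) ->
  forall p q, label p = label q -> (unrolled I p < unrolled I q)%N -> x q < x p.
Proof. by apply: (block_chain (fun a b : R => a < b)) => a b c; exact: lt_trans. Qed.

Lemma constant_on_blocks {T : Type} (x : 'I_m.+1 -> T) :
  (forall i, i \notin I -> x i = x (ord_pred i)) ->
  forall p q, label p = label q -> x p = x q.
Proof.
move=> xI p q pq; have ch := block_chain eq x (@eq_trans T) xI.
case: (ltngtP (unrolled I p) (unrolled I q)) => [h|h|/unrolled_inj->] //.
  by rewrite (ch p q).
by rewrite (ch q p).
Qed.

Lemma label_surj : (label @: [set: 'I_m.+1] = [set: 'I_k.+1])%SET.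
Proof.
have inj : {in I &, injective label}.
  move=> p q pI qI pq; apply: (unrolled_inj I).
  case: (ltngtP (unrolled I p) (unrolled I q)) => // /block_start_first.
    by move=> /(_ pq); rewrite qI.
  by move=> /(_ (esym pq)); rewrite pI.
apply/eqP; rewrite eqEcard finset.subsetT /= cardsT card_ord.
apply: (@leq_trans #|label @: I|); first by rewrite (card_in_imset inj) cI.
exact/subset_leq_card/imsetS/finset.subsetT.
Qed.

End Blocks.

Context {R : realFieldType}.

(** A permutation of the increments, as a permutation of the closed steps that
fixes the closing one. *)
Definition extend (s : {perm 'I_m}) : {perm 'I_m.+1} :=
  lift_perm ord_max ord_max s.

Lemma extend_max s : extend s ord_max = ord_max.
Proof. exact: lift_perm_id. Qed.

Lemma extend_inj : injective extend.
Proof.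
move=> s t E; apply/permP => i; apply: (@lift_inj _ (ord_max : 'I_m.+1)).
by rewrite -!(lift_perm_lift ord_max ord_max) -/(extend s) E.
Qed.

Lemma extendV_max s : (extend s)^-1%g ord_max = ord_max.
Proof. by apply: (@perm_inj _ (extend s)); rewrite permKV extend_max. Qed.

Section Encoding.
Context (k : nat).

Definition labels (s : {perm 'I_m}) I : {ffun 'I_m.+1 -> 'I_k.+1} :=
  [ffun e => label k I ((extend s)^-1 e)%g].

(** A point of the chamber that orders every block backwards along the path. *)
Definition depth (s : {perm 'I_m}) I (e : 'I_m.+1) : R :=
  - (unrolled I ((extend s)^-1 e)%g)%:R.

Definition encode (sI : {perm 'I_m} * {set 'I_m.+1}) :=
  (labels sI.1 sI.2, ascents (monochrome (labels sI.1 sI.2)) (depth sI.1 sI.2)).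

Lemma depth_lt s I e e' : (depth s I e < depth s I e') =
  (unrolled I ((extend s)^-1 e')%g < unrolled I ((extend s)^-1 e)%g)%N.
Proof. by rewrite /depth ltrN2 ltr_nat. Qed.

Lemma separates_depth s I (G : {set 'I_m.+1 * 'I_m.+1}) :
  (forall e, e \in G -> e.1 != e.2) -> separates G (depth s I).
Proof.
move=> G0 e /G0; apply: contra => /eqP /oppr_inj /eqP.
by rewrite eqr_nat => /eqP/unrolled_inj/perm_inj->.
Qed.

Lemma monochrome_neq {K : eqType} (f : 'I_m.+1 -> K) e :
  e \in monochrome f -> e.1 != e.2.
Proof. by rewrite inE => /andP[+ _]; apply: contraTneq => ->; rewrite ltnn. Qed.

Definition descends (W : set ('I_m.+1 -> R)) (s : {perm 'I_m}) I : Prop :=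
  exists2 y, W y & forall i, i \notin I -> y (extend s i) < y (extend s (ord_pred i)).

(** A chamber of the arrangement is an order on each block, and the one in
question is the order against the path. *)
Lemma encode_chamberP (W : set ('I_m.+1 -> R)) s I : #|I| = k.+1 ->
  (encode (s, I)).2 \in chambers (monochrome (labels s I)) W <-> descends W s I.
Proof.
move=> cI; have sd := separates_depth s I _ (monochrome_neq (labels s I)).
split=> [/chambersP[y [Wy sy]]|[y Wy yI]].
  move/(monochrome_chamberP _ _ _ sy sd) => E; exists y => // i iI.
  rewrite E; last by rewrite !ffunE !permK label_pred.
  by rewrite depth_lt !permK (unrolled_pred _ _ cI _ iI).
have key e e' : labels s I e = labels s I e' ->
    (unrolled I ((extend s)^-1 e)%g < unrolled I ((extend s)^-1 e')%g)%N ->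
    y e' < y e.
  rewrite !ffunE => le lt_e.
  have := decreasing_on_blocks k I cI (fun i => y (extend s i)) yI _ _ le lt_e.
  by rewrite !permKV.
have keyE e e' : labels s I e = labels s I e' -> (y e < y e') = (depth s I e < depth s I e').
  move=> le; rewrite depth_lt.
  case: (ltngtP (unrolled I ((extend s)^-1 e')%g) (unrolled I ((extend s)^-1 e)%g)).
  - by move/key; apply.
  - by move/(key _ _ le)/ltW; rewrite leNgt => /negbTE.
  - by move/unrolled_inj/perm_inj->; rewrite ltxx.
have sy : separates (monochrome (labels s I)) y.
  apply/separates_monochromeP => e e' le ne.
  have := (separates_monochromeP _ _).1 sd e e' le ne.
  by rewrite !neq_lt (keyE _ _ le) (keyE _ _ (esym le)).
by apply/chambersP; exists y; split=> //; apply/(monochrome_chamberP _ _ _ sy sd).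
Qed.

Lemma ltn_card_below p q : (#|[set i : 'I_m.+1 | (i < p)%N]%SET| =
   #|[set i : 'I_m.+1 | (i < q)%N]%SET|) -> p = q.
Proof.
wlog pq : p q / (p <= q)%N.
  by move=> h E; case: (leqP p q) => [|/ltnW] /h; [apply|move/(_ (esym E))].
move=> E; apply/val_inj/eqP; rewrite eqn_leq pq leqNgt; apply/negP => lt_pq.
suff : (#|[set i : 'I_m.+1 | (i < p)%N]%SET| <
   #|[set i : 'I_m.+1 | (i < q)%N]%SET|)%N by rewrite E ltnn.
apply: proper_card; apply/fintype.properP; split.
  by apply/fintype.subsetP => i; rewrite !inE => /ltn_trans->.
by exists p; rewrite !inE ?lt_pq ?ltnn.
Qed.

(** The labels and the orders inside the blocks determine the rank of every
step, hence the linear order of all steps, hence [s]; then the ranks determine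
[I]. The label [0] stands for two ranks, which are told apart by the comparison
with the last index. *)
Lemma encode_inj : {in [set sI : {perm 'I_m} * {set 'I_m.+1} | #|sI.2| == k.+1]%SET &, injective encode}.
Proof.
move=> [s I] [t J]; rewrite !inE /= => /eqP cI /eqP cJ [El Ea].
have sI := separates_depth s I _ (monochrome_neq (labels s I)).
have sJ := separates_depth t J _ (monochrome_neq (labels t J)).
rewrite -El in sJ Ea.
move/(monochrome_chamberP _ _ _ sI sJ): Ea => Ed.
pose p e := ((extend s)^-1 e)%g; pose q e := ((extend t)^-1 e)%g.
have lab e : label k I (p e) = label k J (q e).
  by have /ffunP/(_ e) := El; rewrite !ffunE.
have du e e' : label k I (p e) = label k I (p e') ->
  (unrolled I (p e) < unrolled I (p e'))%N = (unrolled J (q e) < unrolled J (q e'))%N.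
  by move=> le; rewrite -!depth_lt; apply: Ed; rewrite !ffunE.
have rank0 s' I' (r := fun e => ((extend s')^-1 e)%g) e : #|I'| = k.+1 ->
   (rank_in I' (r e) == 0)%N = (unrolled I' (r ord_max) < unrolled I' (r e))%N.
  move=> cI'; rewrite /r extendV_max {1}/unrolled rank_in_max cI' muln0 addn0.
  rewrite /unrolled; case: eqP => _; first by rewrite muln1 (leq_trans _ (leq_addl _ _)).
  by rewrite muln0 addn0 ltnNge -ltnS ltn_ord.
have rk e : rank_in I (p e) = rank_in J (q e).
  have := lab e => /(congr1 val); rewrite /= !inordK ?ltn_mod // => Em.
  have z : (rank_in I (p e) == 0)%N = (rank_in J (q e) == 0)%N.
    have lm : label k I (p ord_max) = ord0 by rewrite /p extendV_max label_max.
    have lm' : label k J (q ord_max) = ord0 by rewrite /q extendV_max label_max.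
    have [l0|l0] := eqVneq (label k I (p e)) ord0.
      by rewrite rank0 // rank0 // du // l0.
    have nz I' r : label k I' r != ord0 -> (rank_in I' r == 0)%N = false.
      move=> h; apply/negbTE; apply: contra h => /eqP h.
      by rewrite /label h mod0n; apply/eqP/val_inj; rewrite /= inordK.
    by rewrite !nz // -lab.
  have := rank_in_leq I (p e); have := rank_in_leq J (q e); rewrite cI cJ.
  move: z Em; case: (rank_in I (p e)) (rank_in J (q e)) => [|a] [|b] //= _.
  move/eqP; rewrite -[a.+1]addn1 -[b.+1]addn1 eqn_modDr !addn1 !ltnS => + lb la.
  by rewrite !modn_small ?ltnS // => /eqP->.
have order I' (a b : 'I_m.+1) :
    (a < b)%N = (rank_in I' a < rank_in I' b)%N ||
      ((rank_in I' a == rank_in I' b) && (unrolled I' a < unrolled I' b)%N).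
  case: (ltngtP (rank_in I' a) (rank_in I' b)) => h /=.
  - rewrite ltnNge; apply/negP => /(leq_rank_in I'); by rewrite leqNgt h.
  - apply/negbTE; rewrite -leqNgt leqNgt; apply/negP => /ltnW /(leq_rank_in I').
    by rewrite leqNgt h.
  - by rewrite /unrolled h ltn_add2r.
have ord_eq e e' : (p e < p e')%N = (q e < q e')%N.
  rewrite (order I) (order J) !rk; congr orb.
  case: eqP => //= E; apply: du; apply/label_eqP; by rewrite !rk E.
have pq e : p e = q e.
  apply: ltn_card_below.
  have -> : ([set i : 'I_m.+1 | (i < p e)%N] = p @: [set e' | (p e' < p e)%N])%SET.
    apply/setP => i; rewrite inE; apply/idP/imsetP => [h|[e' + ->]]; last by rewrite inE.
    by exists (extend s i); rewrite ?inE /p permK.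
  have -> : ([set i : 'I_m.+1 | (i < q e)%N] = q @: [set e' | (p e' < p e)%N])%SET.
    apply/setP => i; rewrite inE; apply/idP/imsetP => [h|[e' + ->]]; last by rewrite inE ord_eq.
    by exists (extend t i); rewrite ?inE ?ord_eq /q permK.
  by rewrite !card_imset //; exact: perm_inj.
have st : s = t.
  apply/extend_inj/invg_inj/permP => e; exact: pq.
congr pair => //; apply: rank_in_inj => i.
by have := rk (extend s i); rewrite /p /q -st permK.
Qed.

End Encoding.

Lemma chamber_count_card {K : finType} (v0 : K) n (A : {set K})
    (W : set ('I_n.+1 -> R)) :
  chamber_count v0 n A W = #|[set c : {ffun 'I_n.+1 -> K} * {set 'I_n.+1 * 'I_n.+1}
     | (c.1 \in labelings v0 n A) && (c.2 \in chambers (monochrome c.1) W)]%SET|.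
Proof.
rewrite /chamber_count -sum1_card (eq_bigr (fun f : {ffun 'I_n.+1 -> K} =>
  \sum_(s in chambers (monochrome f) W) 1)%N); last by move=> f _; rewrite sum1_card.
by rewrite pair_big_dep /=; apply: eq_bigl => c; rewrite [in RHS]finset.in_set.
Qed.

(** By [encode_inj] the pairs inject into the labelled chambers of the whole
space, and by [chamber_count_le] there are at least as many pairs as such
chambers; hence [encode] is a bijection, and it matches the chambers that meet
[W] with the descending pairs. *)
Theorem descending_pairs_count k (W : set ('I_m.+1 -> R)) :
  #|[set sI : {perm 'I_m} * {set 'I_m.+1} |
      (#|sI.2| == k.+1) && `[< descends W sI.1 sI.2 >]]%SET| =
  chamber_count (ord0 : 'I_k.+1) m [set: 'I_k.+1]%SET W.
Proof.
pose D := [set sI : {perm 'I_m} * {set 'I_m.+1} | #|sI.2| == k.+1]%SET.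
pose codes (W' : set ('I_m.+1 -> R)) := [set c : {ffun 'I_m.+1 -> 'I_k.+1} * {set 'I_m.+1 * 'I_m.+1}
     | (c.1 \in labelings ord0 m [set: 'I_k.+1]) &&
       (c.2 \in chambers (monochrome c.1) W')]%SET.
have cD : #|D| = (m`! * 'C(m.+1, k.+1))%N.
  have -> : D = finset.setX [set: {perm 'I_m}] [set I : {set 'I_m.+1} | #|I| == k.+1]%SET.
    by apply/setP => -[s I]; rewrite !inE.
  by rewrite cardsX cardsT card_Sn card_draws card_ord.
have labD sI : sI \in D -> labels k sI.1 sI.2 \in labelings ord0 m [set: 'I_k.+1].
  case: sI => s I; rewrite !inE /= => /eqP cI; apply/andP; split; last first.
    by rewrite ffunE extendV_max label_max.
  rewrite -(label_surj k I cI); apply/eqP/setP => l; apply/imsetP/imsetP.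
    move=> [e _ ->]; by exists ((extend s)^-1 e)%g; rewrite ?inE ?ffunE.
  by move=> [p _ ->]; exists (extend s p); rewrite ?inE ?ffunE ?permK.
have allD : encode k @: D = codes setT.
  apply/eqP; rewrite eqEcard; apply/andP; split.
    apply/fintype.subsetP => c /imsetP[sI sID ->]; rewrite inE labD //=.
    by apply: mem_chambers => //; apply: separates_depth => e /monochrome_neq.
  (* The image of an injection is everything as soon as the codomain is not
     larger. *)
  rewrite card_in_imset; last exact: encode_inj.
  rewrite cD -chamber_count_card -[k.+1 in leqRHS](card_ord k.+1) -cardsT.
  by apply: chamber_count_le; split.
rewrite chamber_count_card -/(codes W).
have -> : codes W = (encode k @: [set sI in D | `[< descends W sI.1 sI.2 >]])%SET.
  apply/setP => c; apply/idP/imsetP => [|[[s I]]].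
    rewrite inE => /andP[c1 c2].
    have : c \in codes setT.
      rewrite inE c1; move: c2 => /chambersP[x [_ sx <-]]; exact: mem_chambers.
    rewrite -allD => /imsetP[[s I] sID E]; exists (s, I) => //.
    rewrite inE sID /=; apply/asboolP/(encode_chamberP k).
      by move: sID; rewrite inE => /eqP.
    by move: c2; rewrite E.
  move=> sID ->; move: sID; rewrite finset.in_set => /andP[sID /asboolP h].
  rewrite finset.in_set (labD (s, I)) //=; apply/encode_chamberP => //.
  by move: sID; rewrite inE => /eqP.
rewrite card_in_imset; first by congr #|pred_of_set _|; apply/setP => sI; rewrite !inE.
by move=> a b; rewrite !inE => /andP[a1 _] /andP[b1 _]; apply: (encode_inj k); rewrite inE.
Qed.

End Cyclic_blocks.

(** * Log-concavity and rising factorials *)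

Section Log_concave.
Local Open Scope nat_scope.

Definition log_concave (a : nat -> nat) : Prop :=
  forall i j, i <= j -> a i * a j.+1 <= a i.+1 * a j.

(** The generating polynomial is multiplied by t + r. *)
Lemma log_concave_shift_add (r : nat) (a c : nat -> nat) :
  log_concave a -> c 0 = r * a 0 -> (forall j, c j.+1 = a j + r * a j.+1) ->
  log_concave c.
Proof.
move=> aL c0 cS [|i] [|j] // ij; first by rewrite mulnC.
  rewrite c0 !cS; have := aL 0 j.+1 isT; have := aL 0 j isT.
  move: (a 0) (a 1) (a j) (a j.+1) (a j.+2) => x y z u v h1 h2; nia.
rewrite !cS; rewrite ltnS in ij.
have h1 := aL _ _ ij; have h2 : a i.+1 * a j.+2 <= a i.+2 * a j.+1 by apply: aL.
have h3 : a i * a j.+2 <= a i.+2 * a j.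
  move: ij; rewrite leq_eqVlt => /predU1P[->|ij]; first by rewrite mulnC.
  by apply: leq_trans (aL i j.+1 (leqW (ltnW ij))) (aL _ _ ij).
move: h1 h2 h3.
move: (a i) (a i.+1) (a i.+2) (a j) (a j.+1) (a j.+2) => x y z u v w h1 h2 h3.
nia.
Qed.

Lemma stirling1_log_concave n : log_concave (stirling1 n).
Proof.
elim: n => [|n IH]; first by move=> i [|j] _; rewrite ?muln0 //; case: i.
exact: (log_concave_shift_add n _ _ IH).
Qed.

(** The generating series is multiplied by r t / (1 - r t), that is, convolved
with a geometric sequence. The second hypothesis excludes internal zeros. *)
Lemma log_concave_geometric (r : nat) (a c : nat -> nat) :
  log_concave a -> (forall i j, i <= j -> a i = 0 -> c i = 0 \/ a j.+1 = 0) ->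
  c 0 = 0 -> (forall j, c j.+1 = r * (c j + a j)) -> log_concave c.
Proof.
move=> aL az c0 cS.
have key i j : i <= j -> c i * a j <= a i * c j.
  elim: i j => [|i IH] [|j] // ij; rewrite ?c0 // !cS.
  rewrite ltnS in ij; have h := aL _ _ ij.
  suff h' : c i * a j.+1 <= a i.+1 * c j by nia.
  have [a0|a0] := posnP (a i).
    by case: (az _ _ ij a0) => ->; rewrite ?muln0.
  rewrite -(leq_pmul2l a0).
  have := IH _ ij; move: h; move: (a i) (a i.+1) (a j) (a j.+1) (c i) (c j) => *.
  nia.
move=> i j ij; rewrite !cS; have := key _ _ ij.
move: (a i) (a j) (c i) (c j) => *; nia.
Qed.

Lemma surjS m k : surj m.+1 k.+1 = k.+1 * (surj m k.+1 + surj m k).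
Proof. by []. Qed.

Lemma surj_lt m k : m < k -> surj m k = 0.
Proof.
elim: m k => [|m IH] [|k] //; rewrite ltnS => mk.
by rewrite surjS !IH ?muln0 // ltnS ltnW.
Qed.

Lemma surj_gt0 m k : 0 < k <= m -> 0 < surj m k.
Proof.
elim: m k => [|m IH] [|k] // /andP[_]; rewrite ltnS => km.
rewrite surjS muln_gt0 addn_gt0 /=.
case: k km => [|k] km; last by rewrite [X in _ || X]IH ?orbT.
by case: m {km} IH => // m IH; rewrite IH.
Qed.

Lemma surj_log_concave k : log_concave (fun m => surj m k).
Proof.
elim: k => [|k IH]; first by move=> [|i] [|j] //=.
apply: (log_concave_geometric k.+1 _ _ IH) => // i j ij.
case: k {IH} => [|k] a0; first by right.
left; apply: surj_lt; rewrite ltnNge; apply/negP => ki.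
by have := surj_gt0 i k.+1; rewrite a0 /= => /(_ (ltnW ki)).
Qed.

Lemma stirling1_gt0 n j : 0 < j <= n -> 0 < stirling1 n j.
Proof.
elim: n j => [|n IH] [|j] /andP[j0 jn]; rewrite ?ltnn // in j0 jn.
rewrite /= addn_gt0; move: jn {j0}; rewrite ltnS => jn.
case: j jn => [|j] jn; last by rewrite IH.
by case: n IH {jn} => // n IH; rewrite muln_gt0 [X in _ && X]IH //= orbT.
Qed.

End Log_concave.

Section Mode.
Context {R : realFieldType}.

(** Tilting by the ratio of two consecutive terms moves the mode to [j.+1]. *)
Lemma log_concave_mode (a : nat -> R) j :
  (forall i, 0 <= a i) -> (forall i j, (i <= j)%N -> a i * a j.+1 <= a i.+1 * a j) ->
  0 < a j -> 0 < a j.+1 ->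
  exists2 t, 0 < t & forall i, a i * t ^+ i <= a j.+1 * t ^+ j.+1.
Proof.
move=> a0 aL aj ajS; pose t := a j / a j.+1.
have t0 : 0 < t by rewrite divr_gt0.
exists t => // i.
have up l : (j < l)%N -> a l.+1 * t <= a l.
  move=> jl; rewrite /t mulrA ler_pdivrMr // mulrC [leRHS]mulrC.
  by apply: aL; apply: ltnW.
have down l : (l <= j)%N -> a l <= a l.+1 * t.
  by move=> lj; rewrite /t mulrA ler_pdivlMr //; apply: aL.
have [ij|ji] := leqP i j.+1.
  rewrite -(subKn ij); elim: (j.+1 - i)%N => [|l IH]; first by rewrite subn0.
  have [lj|jl] := leqP j.+1 l.
    have -> : (j.+1 - l.+1 = j.+1 - l)%N by lia.
    exact: IH.
  apply: le_trans IH; rewrite (_ : j.+1 - l = (j.+1 - l.+1).+1)%N; last lia.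
  rewrite exprS mulrA ler_wpM2r ?exprn_ge0 ?(ltW t0) //; apply: down; lia.
rewrite -(subnKC ji); elim: (i - j.+2)%N => [|l IH].
  by rewrite addn0 exprS mulrA ler_wpM2r ?exprn_ge0 ?(ltW t0) // up.
apply: le_trans IH; rewrite addnS exprS mulrA ler_wpM2r ?exprn_ge0 ?(ltW t0) //.
by apply: up; lia.
Qed.

End Mode.

Section Rising.
Context {R : realType}.

Definition rising (t : R) n : R := \prod_(i < n) (t + i%:R).

Lemma rising_gt0 t n : 0 < t -> 0 < rising t n.
Proof. by move=> t0; apply: prodr_gt0 => i _; rewrite ltr_wpDr. Qed.

Lemma sum_stirling1 t n : \sum_(j < n.+1) (stirling1 n j)%:R * t ^+ j = rising t n.
Proof.
elim: n => [|n IH]; first by rewrite big_ord1 /rising big_ord0 mulr1.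
rewrite [RHS]big_ord_recr /= -/(rising t n) -IH mulrDr.
rewrite mulr_suml mulr_suml.
rewrite big_ord_recl /= natrM expr0 mulr1.
under eq_bigr do rewrite /bump /= add1n natrD natrM mulrDl.
rewrite big_split /= addrCA; congr (_ + _).
  by apply: eq_bigr => i _; rewrite exprSr mulrA.
rewrite [RHS]big_ord_recl /= expr0 mulr1 [n%:R * _]mulrC; congr (_ + _).
rewrite big_ord_recr /= stirling1_gt // mulr0 mul0r addr0.
by apply: eq_bigr => i _; rewrite /bump /= add1n -mulrA mulrC -!mulrA; congr (_ * _); rewrite mulrC.
Qed.

(** A primitive of the logarithm, with whose increments the sums of logarithms
are compared. *)
Definition primln (s : R) : R := s * ln s - s.

Lemma ln_le_sub1 (x : R) : 0 < x -> ln x <= x - 1.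
Proof. by move=> x0; have := @le_ln1Dx R (x - 1); rewrite [1 + _]addrC subrK; apply; lra. Qed.

Lemma primln_diff_ge s : 0 < s -> ln s <= primln (s + 1) - primln s.
Proof.
move=> s0; have s1 : 0 < s + 1 by lra.
have := @ln_le_sub1 (s / (s + 1)) (divr_gt0 s0 s1).
rewrite ln_div ?posrE // /primln.
have -> : s / (s + 1) - 1 = - (s + 1)^-1 by field; lra.
rewrite -(ler_pM2l s1) mulrN divff ?gt_eqF // => h; lra.
Qed.

Lemma primln0 : primln 0 = 0. Proof. by rewrite /primln mul0r subr0. Qed.
Lemma primln1 : primln 1 = -1. Proof. by rewrite /primln ln1; lra. Qed.

Lemma primln_diff_le s : 0 <= s -> primln (s + 1) - primln s <= ln (s + 1).
Proof.
rewrite le_eqVlt => /predU1P[<-|s0]; first by rewrite add0r primln0 primln1 ln1; lra.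
 have s1 : 0 < s + 1 by lra.
have := @ln_le_sub1 ((s + 1) / s) (divr_gt0 s1 s0).
rewrite ln_div ?posrE // /primln.
have -> : (s + 1) / s - 1 = s^-1 by field; lra.
rewrite -(ler_pM2l s0) divff ?gt_eqF // => h; lra.
Qed.

Lemma ln_rising_le t n : 0 < t -> ln (rising t n) <= primln (t + n%:R) - primln t.
Proof.
move=> t0; elim: n => [|n IH]; first by rewrite /rising big_ord0 ln1 addr0 subrr.
rewrite /rising big_ord_recr /= -/(rising t n) /= lnM ?posrE ?rising_gt0 //; last first.
  by rewrite ltr_wpDr.
have := primln_diff_ge (t + n%:R); rewrite ltr_wpDr // => /(_ isT).
by rewrite -[t + n%:R + 1]addrA natr1 => h; lra.
Qed.

Lemma ln_rising_ge t n : 0 <= t -> primln (t + n%:R) - primln t <= ln (rising (t + 1) n).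
Proof.
move=> t0; have t1 : 0 < t + 1 by lra.
elim: n => [|n IH]; first by rewrite /rising big_ord0 ln1 addr0 subrr.
rewrite /rising big_ord_recr /= -/(rising (t + 1) n) /= lnM ?posrE ?rising_gt0 //; last first.
  by rewrite ltr_wpDr.
rewrite -natr1 addrA addrAC [t + 1 + _]addrAC.
have := primln_diff_le (t + n%:R); rewrite addr_ge0 // => /(_ isT); lra.
Qed.

Lemma rising1 n : rising 1 n = n`!%:R.
Proof.
elim: n => [|n IH]; first by rewrite /rising big_ord0.
by rewrite /rising big_ord_recr /= -/(rising 1 n) IH /= factS mulnC natrM nat1r.
Qed.

Lemma ln_fact_ge n : primln n%:R <= ln (n`!%:R : R).
Proof. by have := ln_rising_ge 0 n (lexx 0); rewrite !add0r primln0 subr0 rising1. Qed.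

Lemma ln_fact_le n : ln (n`!%:R : R) <= primln n%:R + ln n.+1%:R + 1.
Proof.
have := ln_rising_le 1 n ltr01; rewrite rising1 primln1.
case: n => [|n]; first by rewrite primln0 addr0 primln1 ln1; lra.
have := primln_diff_le n.+1%:R (ler0n _ _).
rewrite [1 + _]addrC natr1; lra.
Qed.

End Rising.

(** * Saddle-point bounds for the two number triangles *)

Section Coefficients.
Context {R : realType}.

(** The coefficient of x^n in (- ln (1 - x))^j. *)
Definition cycle_coef n j : R := j`!%:R * (stirling1 n j)%:R / n`!%:R.
(** The coefficient of u^j in (exp u - 1)^k. *)
Definition surj_coef k j : R := (surj j k)%:R / j`!%:R.

Lemma fact_gt0R n : 0 < n`!%:R :> R. Proof. by rewrite ltr0n fact_gt0. Qed.

Lemma cycle_coef_gt0 n j : (0 < j <= n)%N -> 0 < cycle_coef n j.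
Proof.
move=> jn; rewrite divr_gt0 ?mulr_gt0 ?fact_gt0R //.
by rewrite ltr0n stirling1_gt0.
Qed.

Lemma ln_cycle_coef n j : (0 < j <= n)%N ->
  ln (cycle_coef n j) = ln (j`!%:R : R) + ln ((stirling1 n j)%:R : R) - ln (n`!%:R : R).
Proof.
move=> jn; have s0 : 0 < (stirling1 n j)%:R :> R by rewrite ltr0n stirling1_gt0.
by rewrite ln_div ?lnM ?posrE ?mulr_gt0 ?fact_gt0R.
Qed.

Lemma one_sub_expN_gt0 (L : R) : 0 < L -> 0 < 1 - expR (- L).
Proof. by move=> L0; rewrite subr_gt0 expR_lt1 oppr_lt0. Qed.

(** The tangent inequality for the logarithm, at the two parts of t + s; the
right-hand side is minimal when 1 - exp(- L) = s / (t + s). *)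
Lemma entropy_le (t s L : R) : 0 < t -> 0 < s -> 0 < L ->
  primln (t + s) - primln t - primln s <= t * L - s * ln (1 - expR (- L)).
Proof.
move=> t0 s0 L0; have x0 := one_sub_expN_gt0 _ L0.
have ts0 : 0 < t + s by lra.
have := @ln_le_sub1 R ((1 - expR (- L)) * (t + s) / s).
have := @ln_le_sub1 R (expR (- L) * (t + s) / t).
rewrite !divr_gt0 ?mulr_gt0 ?expR_gt0 // => /(_ isT) h1 /(_ isT) h2.
rewrite !ln_div ?posrE ?mulr_gt0 ?expR_gt0 // !lnM ?posrE ?expR_gt0 // expRK in h1 h2.
move: h1; rewrite -(ler_pM2l t0) => h1.
move: h2; rewrite -(ler_pM2l s0) => h2.
have e1 : t * (expR (- L) * (t + s) / t - 1) = expR (- L) * (t + s) - t.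
  by field; lra.
have e2 : s * ((1 - expR (- L)) * (t + s) / s - 1) = (1 - expR (- L)) * (t + s) - s.
  by field; lra.
rewrite e1 in h1; rewrite e2 in h2; rewrite /primln.
move: h1 h2; set a := ln (t + s); set b := ln t; set c := ln s.
set e := ln (1 - _); lra.
Qed.

Lemma entropy_ge (t s : R) : 0 < t -> 0 < s -> exists2 L, 0 < L &
  t * L - s * ln (1 - expR (- L)) = primln (t + s) - primln t - primln s.
Proof.
move=> t0 s0; have ts0 : 0 < t + s by lra.
exists (ln (t + s) - ln t); first by rewrite subr_gt0 ltr_ln ?posrE //; lra.
rewrite opprB expRB !lnK ?posrE //.
have -> : 1 - t / (t + s) = s / (t + s) by field; lra.
rewrite ln_div ?posrE // /primln; lra.
Qed.

Lemma ln_stirling1_le n j t : (0 < j <= n)%N -> 0 < t ->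
  ln ((stirling1 n j)%:R : R) <= ln (rising t n) - j%:R * ln t.
Proof.
move=> jn t0; have s0 : 0 < (stirling1 n j)%:R :> R by rewrite ltr0n stirling1_gt0.
rewrite lerBrDr mulr_natl -lnXn // -lnM ?posrE ?exprn_gt0 //.
rewrite ler_ln ?posrE ?rising_gt0 ?mulr_gt0 ?exprn_gt0 // -sum_stirling1.
case/andP: jn => _; rewrite -ltnS => jn.
rewrite (bigD1 (Ordinal jn)) //= lerDl sumr_ge0 // => i _.
by rewrite mulr_ge0 ?ler0n ?exprn_ge0 ?ltW.
Qed.

(** The bound by the rising factorial at t = j / L. Its entropy is estimated
with the same [L], which brings out the value of - ln (1 - x) at x = 1 - exp(-
L). *)
Lemma ln_cycle_coef_le n j (L : R) : (0 < j <= n)%N -> 0 < L ->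
  ln (cycle_coef n j) <=
    j%:R * ln L - n%:R * ln (1 - expR (- L)) + ln (j.+1%:R : R) + 1.
Proof.
move=> jn L0; have j0 : 0 < j%:R :> R by rewrite ltr0n; case/andP: jn.
have n0 : 0 < n%:R :> R by rewrite ltr0n; case/andP: jn => a /(leq_trans a).
have t0 : 0 < j%:R / L by rewrite divr_gt0.
have := ln_stirling1_le n j _ jn t0; have := ln_rising_le _ n t0.
have := entropy_le _ _ _ t0 n0 L0; have := @ln_fact_ge R n; have := @ln_fact_le R j.
rewrite ln_cycle_coef // ln_div ?posrE // divfK ?gt_eqF //.
rewrite [primln j%:R]/primln; lra.
Qed.

(** At its mode, a coefficient is at least the fraction 1 / (n + 1) of the
rising factorial. A tilt below one is replaced by one, at the cost of a
polynomial factor, to keep ln t away from minus infinity. *)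
Lemma ln_stirling1_ge n j : (1 < j <= n)%N -> exists2 t : R, 1 <= t &
  primln (t + n%:R) - primln t - j%:R * ln t - 3 * ln (n.+1%:R)
    <= ln ((stirling1 n j)%:R : R).
Proof.
case: j => [|j] // jn; have j1n : (0 < j.+1 <= n)%N by case/andP: jn => _ ->.
have n0 : (0 < n)%N by case/andP: jn => [_]; case: (n).
have s0 : 0 < (stirling1 n j.+1)%:R :> R by rewrite ltr0n stirling1_gt0.
have [t t0 tP] := @log_concave_mode R (fun i => (stirling1 n i)%:R) j
  (fun=> ler0n _ _) (fun a b ab => ltac:(by rewrite -!natrM ler_nat; apply: stirling1_log_concave))
  ltac:(by rewrite ltr0n stirling1_gt0 //; case/andP: jn => [+ /ltnW ->]; rewrite ltnS => ->) s0.
have sumle : rising t n <= n.+1%:R * ((stirling1 n j.+1)%:R * t ^+ j.+1).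
  rewrite -sum_stirling1.
  apply: (@le_trans _ _ (\sum_(i < n.+1) (stirling1 n j.+1)%:R * t ^+ j.+1)).
    by apply: ler_sum => i _; exact: tP.
  by rewrite sumr_const card_ord -[leLHS]mulr_natl.
have n1 : 0 < n.+1%:R :> R by [].
have lnn0 : 0 <= ln (n.+1%:R : R) by apply: ln_ge0; rewrite ler1n.
have lnS : ln (rising t n) <= ln (n.+1%:R : R) + ln ((stirling1 n j.+1)%:R : R) + j.+1%:R * ln t.
  rewrite mulr_natl -lnXn // -!lnM ?posrE ?mulr_gt0 ?exprn_gt0 //.
  by rewrite ler_ln ?posrE ?rising_gt0 ?mulr_gt0 ?exprn_gt0 // -mulrA.
have rS (s : R) : 0 < s -> rising s n * (s + n%:R) = s * rising (s + 1) n.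
  move=> _; transitivity (rising s n.+1); first by rewrite [RHS]big_ord_recr.
  rewrite /rising big_ord_recl /= addr0; congr (_ * _); apply: eq_bigr => i _.
  by rewrite /bump /= natrD addrA.
have lnr (s : R) : 0 < s -> primln (s + n%:R) - primln s + ln s - ln (s + n%:R) <= ln (rising s n).
  move=> s0'; have sn : 0 < s + n%:R by rewrite ltr_wpDr.
  have := congr1 (@ln R) (rS s s0'); rewrite !lnM ?posrE ?rising_gt0 //; last lra.
  by have := ln_rising_ge _ n (ltW s0') => h1 h2; lra.
have [t1|t1] := leP 1 t.
  exists t => //; have := lnr _ t0.
  have h : ln (t + n%:R) <= ln t + ln (n.+1%:R : R).
    rewrite -lnM ?posrE // ler_ln ?posrE ?mulr_gt0 // ?ltr_wpDr //.
    rewrite -natr1 mulrDr mulr1 [leRHS]addrC lerD2l ler_peMl //.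
  lra.
exists 1 => //; rewrite ln1 mulr0.
have := lnr 1 ltr01; rewrite ln1 [1 + n%:R]addrC natr1 => h1.
have h2 : ln t + ln (rising 1 n) - ln (n%:R : R) <= ln (rising t n).
  have n0' : 0 < n%:R :> R by rewrite ltr0n.
  rewrite -lnM ?posrE ?rising_gt0 // -ln_div ?posrE ?mulr_gt0 ?rising_gt0 //.
  rewrite ler_ln ?posrE ?divr_gt0 ?mulr_gt0 ?rising_gt0 // ler_pdivrMr //.
  case: (n) n0 => // n' _.
  rewrite /rising big_ord_recr [leRHS](_ : _ = t * (\prod_(i < n') (t + i.+1%:R)) * n'.+1%:R); last first.
    by rewrite big_ord_recl /= addr0.
  rewrite /= nat1r mulrA ler_wpM2r // ler_wpM2l ?(ltW t0) // ler_prod // => i _.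
  rewrite addr_ge0 //= -natr1 addrC; lra.
have h3 : ln (n%:R : R) <= ln n.+1%:R.
  by rewrite ler_ln ?posrE ?ltr0n // ler_nat.
have : j.+1%:R * ln t <= ln t.
  rewrite -[leRHS]mul1r ler_wnM2r ?ler1n // ln_le0 //; exact: ltW.
lra.
Qed.

(** [L] is chosen such that the entropy bound is an equality. *)
Lemma ln_cycle_coef_ge n j : (1 < j <= n)%N -> exists2 L : R, 0 < L &
  j%:R * ln L - n%:R * ln (1 - expR (- L)) - 4 * ln (n.+1%:R) - 1
    <= ln (cycle_coef n j).
Proof.
move=> jn; have j1n : (0 < j <= n)%N by case/andP: jn => /ltnW-> ->.
have j0 : 0 < j%:R :> R by rewrite ltr0n; case/andP: j1n.
have n0 : 0 < n%:R :> R by rewrite ltr0n; case/andP: j1n => a /(leq_trans a).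
have [t t1 tP] := ln_stirling1_ge n j jn; have t0 : 0 < t by lra.
have [L L0 LP] := entropy_ge _ _ t0 n0; exists L => //.
have := @ln_fact_ge R j; have := @ln_fact_le R n.
have := @ln_le_sub1 R (t * L / j%:R) (divr_gt0 (mulr_gt0 t0 L0) j0).
rewrite ln_div ?posrE ?mulr_gt0 // lnM ?posrE //.
rewrite -(ler_pM2l j0) => h; have e : j%:R * (t * L / j%:R - 1) = t * L - j%:R.
  by field; lra.
rewrite e in h; rewrite ln_cycle_coef //.
rewrite [primln j%:R]/primln; lra.
Qed.

Lemma surj_coef_gt0 k j : (0 < k <= j)%N -> 0 < surj_coef k j.
Proof. by move=> kj; rewrite divr_gt0 ?fact_gt0R // ltr0n surj_gt0. Qed.

Lemma surj_coef_ge0 k j : 0 <= surj_coef k j.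
Proof. by rewrite divr_ge0 ?ler0n. Qed.

Lemma surj_incl_excl m k :
  (surj m k)%:R = \sum_(i < k.+1) (-1) ^+ (k - i) * 'C(k, i)%:R * (i%:R ^+ m) :> R.
Proof.
elim: m k => [|m IH] [|k].
- by rewrite big_ord1 /= ?subn0 ?expr0 ?bin0 !mulr1.
- have := exprDn (-1 : R) 1 k.+1; rewrite addNr expr0n /= => E.
  rewrite [LHS]E; apply: eq_bigr => i _.
  by rewrite expr1n !mulr1 mulr_natr.
- by rewrite big_ord1 /= expr0n mulr0.
rewrite surjS natrM natrD !IH big_ord_recl [RHS]big_ord_recl /=.
rewrite [0 ^+ m.+1]expr0n mulr0 add0r.
have -> : \sum_(i < k.+1) (-1) ^+ (k - i) * 'C(k, i)%:R * i%:R ^+ m =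
  \sum_(i < k.+2) (-1) ^+ (k - i) * 'C(k, i)%:R * i%:R ^+ m :> R.
  by rewrite [RHS]big_ord_recr /= bin_small // mulr0 mul0r addr0.
rewrite [\sum_(i < k.+2) _]big_ord_recl /= addrACA.
rewrite !subn0 !bin0 exprS mulN1r !mulNr addNr add0r -big_split /= mulr_sumr.
apply: eq_bigr => i _; rewrite /bump /= !add1n.
have [ik|ik] := leqP i.+1 k; last first.
  have -> : i = k :> nat by apply/eqP; rewrite eqn_leq -ltnS ltn_ord.
  rewrite subnn [X in _ + X](_ : _ = 0); last by rewrite bin_small ?mulr0 ?mul0r.
  by rewrite binn expr0 !mul1r addr0 exprS.
have -> : (k.+1 - i.+1 = (k - i.+1).+1)%N by rewrite subSS -subSn.
have E : k.+1%:R * ('C(k.+1, i.+1)%:R - 'C(k, i.+1)%:R) = i.+1%:R * 'C(k.+1, i.+1)%:R :> R.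
  have /= d := mul_bin_diag k.+1 i.
  by rewrite binS natrD addrAC subrr add0r -!natrM d natrM binS natrD.
rewrite exprS exprS mulN1r.
transitivity (- (-1 : R) ^+ (k - i.+1) *
   (k.+1%:R * ('C(k.+1, i.+1)%:R - 'C(k, i.+1)%:R)) * i.+1%:R ^+ m); first by ring.
by rewrite E; ring.
Qed.

(** By inclusion-exclusion the series is a combination of exponential series,
which the binomial theorem sums up. *)
Lemma surj_coef_series k (u : R) :
  series (fun m => surj_coef k m * u ^+ m) @ \oo --> (expR u - 1) ^+ k.
Proof.
have -> : (expR u - 1) ^+ k =
    \sum_(i < k.+1) (-1) ^+ (k - i) * 'C(k, i)%:R * expR (i%:R * u).
  rewrite addrC exprDn; apply: eq_bigr => i _.
  by rewrite expRM_natl -mulr_natr mulrAC.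
have -> : series (fun m => surj_coef k m * u ^+ m) = fun N =>
    \sum_(i < k.+1) (-1) ^+ (k - i) * 'C(k, i)%:R * series (exp_coeff (i%:R * u)) N.
  apply: funext => N; rewrite /series /=.
  under [RHS]eq_bigr do rewrite mulr_sumr.
  rewrite exchange_big /=; apply: eq_bigr => m _.
  rewrite /surj_coef surj_incl_excl mulr_suml mulr_suml; apply: eq_bigr => i _.
  rewrite /exp_coeff /= exprMn; ring.
apply: cvg_big => [|i _]; first exact: add_continuous.
apply: cvgMl_tmp; exact: is_cvg_series_exp_coeff.
Qed.

Lemma surj_coef_le k j (u : R) : 0 < u -> surj_coef k j * u ^+ j <= (expR u - 1) ^+ k.
Proof.
move=> u0; have c := surj_coef_series k u.
have nd : nondecreasing_seq (series (fun m => surj_coef k m * u ^+ m)).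
  by apply: nondecreasing_series => i _ _; rewrite mulr_ge0 ?surj_coef_ge0 ?exprn_ge0 ?ltW.
rewrite -(cvg_lim _ c) //; apply: le_trans (nondecreasing_cvgn_le nd (cvgP _ c) j.+1).
rewrite /series /= big_nat_recr //= lerDr sumr_ge0 // => i _.
by rewrite mulr_ge0 ?surj_coef_ge0 ?exprn_ge0 ?ltW.
Qed.

Lemma ln_surj_coef_le k j (u : R) : (0 < k <= j)%N -> 0 < u ->
  ln (surj_coef k j) <= k%:R * ln (expR u - 1) - j%:R * ln u.
Proof.
move=> kj u0; have e0 : 0 < expR u - 1 by rewrite subr_gt0 expR_gt1.
rewrite lerBrDr !mulr_natl -!lnXn // -lnM ?posrE ?exprn_gt0 ?surj_coef_gt0 //.
rewrite ler_ln ?posrE; last by rewrite exprn_gt0.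
  exact: surj_coef_le.
by rewrite mulr_gt0 ?surj_coef_gt0 ?exprn_gt0.
Qed.

Lemma bernoulli_ge (r : R) j : 0 <= r <= 1 -> 1 - j%:R * (1 - r) <= r ^+ j.
Proof.
move=> r01; elim: j => [|j IH]; first by rewrite mul0r subr0.
rewrite exprS -natr1; have : 0 <= r ^+ j <= 1.
  by rewrite exprn_ge0 ?exprn_ile1 //; lra.
by have : 0 <= j%:R :> R by []; nra.
Qed.

Lemma sum_geometric_le (r : R) M : 0 <= r < 1 ->
  \sum_(0 <= i < M) r ^+ i <= (1 - r)^-1.
Proof.
move=> r01; rewrite -[(1 - r)^-1]mul1r ler_pdivlMr; last lra.
rewrite mulrC big_mkord -opprB mulNr -subrX1 opprB lerBlDr lerDl exprn_ge0 //; lra.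
Qed.

(** The series has infinitely many terms, so maximality at the tilt [t] is
exploited at the slightly smaller argument [t * r] with r = 1 - 1 / (2 j):
there the terms are dominated by a geometric series with sum 2 j, while r^j is
still at least 1 / 2. *)
Lemma ln_surj_coef_ge k j : (0 < k < j)%N -> exists2 u : R, 0 < u &
  k%:R * ln (expR u - 1) - j%:R * ln u - ln (4 * j%:R) <= ln (surj_coef k j).
Proof.
case: j => [|j] kj; first by rewrite ltn0 andbF in kj.
have k1j : (0 < k <= j.+1)%N by case/andP: kj => -> /ltnW ->.
have b0 : 0 < surj_coef k j.+1 by apply: surj_coef_gt0.
have [t t0 tP] : exists2 t, 0 < t & forall i, surj_coef k i * t ^+ i <=
    surj_coef k j.+1 * t ^+ j.+1.
  apply: log_concave_mode => //; [exact: surj_coef_ge0| |exact: surj_coef_gt0].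
  move=> a b ab; rewrite /surj_coef !mulf_div ler_pdivrMr ?mulr_gt0 ?fact_gt0R //.
  rewrite mulrAC ler_pdivlMr ?mulr_gt0 ?fact_gt0R // -!natrM ler_nat.
  rewrite !factS; have := surj_log_concave k _ _ ab => /= h.
  have -> : (surj a k * surj b.+1 k * (a.+1 * a`! * b`!) =
             (surj a k * surj b.+1 k) * a.+1 * (a`! * b`!))%N by ring.
  have -> : (surj a.+1 k * surj b k * (a`! * (b.+1 * b`!)) =
             (surj a.+1 k * surj b k) * b.+1 * (a`! * b`!))%N by ring.
  by rewrite leq_mul2r leq_mul ?orbT.
pose r : R := 1 - (2 * j.+1%:R)^-1.
have j0 : 0 < j.+1%:R :> R by [].
have i0 : 0 < (2 * j.+1%:R)^-1 :> R by rewrite invr_gt0 mulr_gt0.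
have i1 : (2 * j.+1%:R)^-1 <= 2^-1 :> R.
  rewrite lef_pV2 ?posrE ?mulr_gt0 // ler_peMr // ler1n //.
have r01 : 0 < r < 1.
  move: i0 i1; rewrite /r; set q := (2 * _)^-1 => q0 q1.
  by apply/andP; split; lra.
exists (t * r); first by rewrite mulr_gt0 //; lra.
have tr0 : 0 < t * r by rewrite mulr_gt0 //; lra.
have e0 : 0 < expR (t * r) - 1 by rewrite subr_gt0 expR_gt1.
have main : (expR (t * r) - 1) ^+ k <= surj_coef k j.+1 * t ^+ j.+1 * (2 * j.+1%:R).
  have c := surj_coef_series k (t * r).
  rewrite -(cvg_lim _ c) //; apply: limr_le; first exact: cvgP c.
  apply: nearW => M; rewrite /series /=.
  apply: (@le_trans _ _ (\sum_(0 <= i < M) surj_coef k j.+1 * t ^+ j.+1 * r ^+ i)).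
    apply: ler_sum => i _; rewrite exprMn mulrA ler_wpM2r ?exprn_ge0 //; lra.
  rewrite -mulr_sumr ler_wpM2l ?mulr_ge0 ?exprn_ge0 ?(ltW t0) ?surj_coef_ge0 //.
  apply: le_trans (sum_geometric_le _ _ _) _; first by lra.
  by rewrite /r subKr invrK.
have rj : 2^-1 <= r ^+ j.+1.
  apply: le_trans (bernoulli_ge _ _ _); last lra.
  rewrite /r subKr invfM mulrCA divff ?mulr1 ?gt_eqF //; lra.
have fin : (expR (t * r) - 1) ^+ k / (t * r) ^+ j.+1 / (4 * j.+1%:R) <= surj_coef k j.+1.
  rewrite ler_pdivrMr ?mulr_gt0 // ler_pdivrMr ?exprn_gt0 //.
  apply: le_trans main _; rewrite exprMn.
  have -> : surj_coef k j.+1 * (4 * j.+1%:R) * (t ^+ j.+1 * r ^+ j.+1) =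
    surj_coef k j.+1 * t ^+ j.+1 * (4 * r ^+ j.+1 * j.+1%:R) by ring.
  rewrite ler_wpM2l ?mulr_ge0 ?surj_coef_ge0 ?exprn_ge0 ?(ltW t0) //.
  rewrite ler_wpM2r ?(ltW j0) //; lra.
move: fin b0 {main tP}; move: (surj_coef k j.+1) => b fin b0.
have e1 : 0 < (expR (t * r) - 1) ^+ k by rewrite exprn_gt0.
have e2 : 0 < (t * r) ^+ j.+1 by rewrite exprn_gt0.
rewrite -ler_ln ?posrE ?divr_gt0 ?mulr_gt0 // in fin.
rewrite ln_div ?posrE ?divr_gt0 ?mulr_gt0 // in fin.
by rewrite ln_div ?posrE // !lnXn // in fin; rewrite ![_ * ln _]mulr_natl.
Qed.

End Coefficients.

(** * The rate function at its saddle points *)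

Section Rate.
Context {R : realType}.
Implicit Types t u b g : R.

(** It parametrises both branches of [h], see [h_expN] and [h_exp]. *)
Definition bose t : R := t / (expR t - 1).
Definition lnphi t : R := ln (1 - expR (- t)).
(** The exponent of the bound for the cycle numbers, divided by [n], when [b]
is the ratio of [j] and [n]. *)
Definition psi b t : R := b * ln t - lnphi t.
(** The exponent of the bound for the surjection numbers, divided by [k], when
[g] is the ratio of [j] and [k]. *)
Definition chi g u : R := ln (expR u - 1) - g * ln u.

Lemma expR_sub1_gt0 t : 0 < t -> 0 < expR t - 1.
Proof. by move=> t0; rewrite subr_gt0 expR_gt1. Qed.

Lemma ln_expR_sub1 u : 0 < u -> ln (expR u - 1) = u + lnphi u.
Proof.
move=> u0; rewrite -{2}[u]expRK -lnM ?posrE ?expR_gt0 ?one_sub_expN_gt0 //.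
by rewrite mulrBr mulr1 -expRD subrr expR0.
Qed.

Lemma lnphi_le0 t : 0 < t -> lnphi t <= 0.
Proof. by move=> t0; rewrite ln_le0 // gerBl expR_ge0. Qed.

Lemma lnphi_le t : 0 < t -> lnphi t <= ln t.
Proof.
move=> t0; rewrite ler_ln ?posrE ?one_sub_expN_gt0 //.
have := expR_ge1Dx (- t); lra.
Qed.

Lemma is_derive_lnphi t : 0 < t -> is_derive t 1 lnphi ((expR t - 1)^-1).
Proof.
move=> t0; have x0 := one_sub_expN_gt0 _ t0; have e0 := expR_sub1_gt0 _ t0.
have d1 : is_derive t 1 (fun t => 1 - expR (- t)) (expR (- t)).
  have d2 : is_derive t 1 (expR \o -%R) (expR (- t) * -1).
    exact: (is_derive1_comp (is_derive_expR (- t)) (is_deriveNid t 1)).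
  have d3 : is_derive t 1 (cst 1 - (expR \o -%R)) (0 - expR (- t) * -1).
    exact: is_deriveB.
  apply: (is_derive_eq d3).
  by rewrite mulrN1 opprK add0r.
have d3 : is_derive (1 - expR (- t)) 1 (@ln R) (1 - expR (- t))^-1.
  exact: is_derive1_ln.
have d4 := @is_derive1_comp R (@ln R) (fun t => 1 - expR (- t)) t _ _ d3 d1.
apply: (is_derive_eq d4).
rewrite expRN; field.
rewrite !gt_eqF ?expR_gt0 //=.
Qed.

Lemma bose_decreasing s t : 0 < s -> s <= t -> bose t <= bose s.
Proof.
move=> s0; rewrite le_eqVlt => /predU1P[->//|st]; have t0 : 0 < t by lra.
have es := expR_sub1_gt0 _ s0; have et := expR_sub1_gt0 _ t0.
rewrite /bose ler_pdivrMr // mulrAC ler_pdivlMr //.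
have h1 := expR_ge1Dx (t - s); have h2 := expR_ge1Dx (- s).
have h3 := expRxMexpNx_1 s.
have h4 : expR t = expR s * expR (t - s) by rewrite -expRD addrC subrK.
have h5 : expR s * (1 - s) <= 1 by rewrite -[leRHS]h3 ler_pM2l ?expR_gt0.
have h6 : expR s * (1 + (t - s)) <= expR t by rewrite h4 ler_pM2l ?expR_gt0.
have ts : 0 < t - s by lra.
nra.
Qed.

Lemma boseD_increasing s t : 0 < s -> s <= t -> bose s + s <= bose t + t.
Proof.
move=> s0; rewrite le_eqVlt => /predU1P[->//|st]; have t0 : 0 < t by lra.
have p u : 0 < u -> bose u + u = u / (1 - expR (- u)).
  move=> u0; have := expR_sub1_gt0 _ u0; have := one_sub_expN_gt0 _ u0.
  have := expRxMexpNx_1 u; rewrite /bose.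
  move: (expR u) (expR (- u)) => x y xy y0 x0.
  have -> : y = x^-1 by apply: (@mulfI _ x); rewrite ?gt_eqF // ?divff ?gt_eqF //; lra.
  field; rewrite !gt_eqF //; lra.
rewrite !p // ler_pdivrMr ?one_sub_expN_gt0 // mulrAC ler_pdivlMr ?one_sub_expN_gt0 //.
have h1 := expR_ge1Dx (- (t - s)); have h2 := expR_ge1Dx s.
have h3 := expRxMexpNx_1 s.
have h4 : expR (- t) = expR (- s) * expR (- (t - s)).
  by rewrite -expRD; congr expR; ring.
have h5 : expR (- s) * (1 + s) <= 1 by rewrite -[leRHS]h3 mulrC ler_pM2r ?expR_gt0.
have h6 : expR (- s) * (1 - (t - s)) <= expR (- t) by rewrite h4 ler_pM2l ?expR_gt0.
have ts : 0 < t - s by lra.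
nra.
Qed.

Lemma min_of_derivative (f df : R -> R) t0 : 0 < t0 ->
  (forall t, 0 < t -> is_derive t 1 f (df t)) ->
  (forall t, 0 < t -> t <= t0 -> df t <= 0) ->
  (forall t, t0 <= t -> 0 <= df t) ->
  forall t, 0 < t -> f t0 <= f t.
Proof.
move=> t00 fD df1 df2 t tgt0.
have cont a b : 0 < a -> {within `[a, b], continuous f}.
  move=> a0; apply: derivable_within_continuous => x; rewrite in_itv /= => /andP[ax _].
  by have [] := fD x (lt_le_trans a0 ax).
have [tt0|t0t] := leP t t0.
  have [|c] := MVT_segment tt0 _ (cont t t0 tgt0) (df := df).
    by move=> x; rewrite in_itv /= => /andP[xt _]; apply: fD; lra.
  rewrite in_itv /= => /andP[c1 c2] E.
  have := df1 c (lt_le_trans tgt0 c1) c2; nra.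
have [|c] := MVT_segment (ltW t0t) _ (cont t0 t t00) (df := df).
  by move=> x; rewrite in_itv /= => /andP[xt _]; apply: fD; lra.
rewrite in_itv /= => /andP[c1 c2] E.
have := df2 c c1; nra.
Qed.

(** The derivative of [psi b] at [t] has the sign of [b - bose t], and [bose]
is decreasing. *)
Lemma psi_min t0 t : 0 < t0 -> 0 < t -> psi (bose t0) t0 <= psi (bose t0) t.
Proof.
move=> t00 tgt0.
apply: (min_of_derivative _ (fun t => (bose t0 - bose t) / t)) => //.
- move=> {tgt0}t tgt0.
  have d1 := is_derive_lnphi _ tgt0.
  have d2 : is_derive t 1 (@ln R) t^-1 by apply: is_derive1_ln.
  have d3 : is_derive t 1 (bose t0 *: (@ln R) - lnphi) (bose t0 *: t^-1 - (expR t - 1)^-1).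
    exact: is_deriveB.
  apply: (is_derive_eq d3); rewrite /GRing.scale /= /bose.
  have := expR_sub1_gt0 _ tgt0; have := expR_sub1_gt0 _ t00 => h1 h2.
  field; rewrite !gt_eqF //.
- move=> {tgt0}t tgt0 tt0; rewrite mulr_le0_ge0 ?invr_ge0 ?(ltW tgt0) //.
  by rewrite subr_le0 bose_decreasing.
- move=> {tgt0}t tt0; have tgt0 : 0 < t by lra.
  by rewrite divr_ge0 ?(ltW tgt0) // subr_ge0 bose_decreasing.
Qed.

(** The derivative of [chi g] at [u] has the sign of [bose u + u - g]. *)
Lemma chi_min u0 u : 0 < u0 -> 0 < u -> chi (bose u0 + u0) u0 <= chi (bose u0 + u0) u.
Proof.
move=> u00 ugt0; set g := bose u0 + u0.
have E v : 0 < v -> chi g v = v + lnphi v - g * ln v.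
  by move=> v0; rewrite /chi ln_expR_sub1.
rewrite !E //.
apply: (min_of_derivative (fun v => v + lnphi v - g * ln v)
  (fun t => (bose t + t - g) / t)) => //.
- move=> t tgt0.
  have d1 := is_derive_lnphi _ tgt0.
  have d2 : is_derive t 1 (@ln R) t^-1 by apply: is_derive1_ln.
  have d3 : is_derive t 1 ((id : R -> R) + lnphi - g *: (@ln R))
     (1 + (expR t - 1)^-1 - g *: t^-1).
    exact: is_deriveB.
  apply: (is_derive_eq d3); rewrite /GRing.scale /= /bose.
  have := expR_sub1_gt0 _ tgt0 => h2.
  field; rewrite !gt_eqF //.
- move=> t tgt0 tt0; rewrite mulr_le0_ge0 ?invr_ge0 ?(ltW tgt0) //.
  by rewrite subr_le0 boseD_increasing.
- move=> t tt0; have tgt0 : 0 < t by lra.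
  by rewrite divr_ge0 ?(ltW tgt0) // subr_ge0 boseD_increasing.
Qed.

Lemma bose_gt0 t : 0 < t -> 0 < bose t.
Proof. by move=> t0; rewrite divr_gt0 ?expR_sub1_gt0. Qed.

Lemma boseD_ge1 t : 0 < t -> 1 <= bose t + t.
Proof.
move=> t0; have e0 := expR_sub1_gt0 _ t0.
rewrite -lerBlDr ler_pdivlMr //.
have := expR_ge1Dx (- t); have := expRxMexpNx_1 t; have := expR_gt0 t.
move: (expR t) (expR (- t)) => x y; nra.
Qed.

Lemma bose_le1 t : 0 < t -> bose t <= 1.
Proof.
move=> t0; rewrite ler_pdivrMr ?expR_sub1_gt0 //.
have := expR_ge1Dx t; lra.
Qed.

Lemma bose_continuous t : 0 < t -> {for t, continuous bose}.
Proof.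
move=> t0; apply: cvgM; first exact: cvg_id.
apply: cvgV; first by rewrite gt_eqF ?expR_sub1_gt0.
by apply: cvgB; [exact: continuous_expR|exact: cvg_cst].
Qed.

Lemma bose_solution b : 0 < b -> b < 1 -> exists2 t, 0 < t & bose t = b.
Proof.
move=> b0 b1; have lo : 0 < 1 - b by lra.
have hi : 1 - b <= 4 / b by rewrite ler_pdivlMr //; nra.
have [||c + E] := @IVT R bose (1 - b) (4 / b) b hi.
- apply: continuous_in_subspaceT => x; rewrite inE /= in_itv /= => /andP[x1 _].
  by apply: bose_continuous; lra.
- have t0 : 0 < 4 / b by rewrite divr_gt0.
  have h1 : b <= bose (1 - b) by have := boseD_ge1 _ lo; lra.
  have h2 : bose (4 / b) <= b.
    rewrite ler_pdivrMr ?expR_sub1_gt0 // -ler_pdivrMl // mulrC.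
    have -> : 4 / b / b = (4 / b) ^+ 2 / 4 by field; lra.
    have h : (1 + 4 / b / 2) ^+ 2 <= expR (4 / b).
      have -> : 4 / b = 2%:R * (4 / b / 2) by field; lra.
      rewrite expRM_natl lerXn2r ?nnegrE ?expR_ge0 // ?expR_ge1Dx //.
        by rewrite addr_ge0 // ltW // divr_gt0 // mulr_gt0 // divr_gt0 // divr_gt0.
      have -> : 2%:R * (4 / b / 2) / 2 = 4 / b / 2 by field; lra.
      exact: expR_ge1Dx.
    apply: le_trans (lerB h (lexx 1)); move: t0; set x := 4 / b => x0; lra.
  by apply/andP; rewrite ge_min le_max h1 h2 ?orbT; split.
- by rewrite in_itv /= => /andP[c1 _]; exists c => //; lra.
Qed.

Lemma boseD_solution g : 1 < g -> exists2 u, 0 < u & bose u + u = g.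
Proof.
move=> g1; have lo : 0 < g - 1 by lra.
have hi : g - 1 <= g by lra.
have [||c + E] := @IVT R (fun u => bose u + u) (g - 1) g g hi.
- apply: continuous_in_subspaceT => x; rewrite inE /= in_itv /= => /andP[x1 _].
  by apply: cvgD; [apply: bose_continuous; lra|exact: cvg_id].
- have h1 : bose (g - 1) + (g - 1) <= g by have := bose_le1 _ lo; lra.
  have h2 : g <= bose g + g by rewrite lerDr ltW // bose_gt0; lra.
  by apply/andP; rewrite ge_min le_max h1 h2 ?orbT; split.
- by rewrite in_itv /= => /andP[c1 _]; exists c => //; lra.
Qed.

Lemma h_expN t : 0 < t -> h (expR (- t)) = bose t.
Proof.
move=> t0; rewrite /h expR_eq0 lt_eqF ?expR_lt1 ?oppr_lt0 // expRK.
have := expR_sub1_gt0 _ t0; have := one_sub_expN_gt0 _ t0.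
have := expRxMexpNx_1 t; rewrite /bose.
move: (expR t) (expR (- t)) => x y xy y0 x0.
have -> : y = x^-1 by apply: (@mulfI _ x); rewrite ?gt_eqF // ?divff ?gt_eqF //; lra.
field; rewrite !gt_eqF //; lra.
Qed.

Lemma h_exp u : 0 < u -> h (expR u) = bose u + u.
Proof.
move=> u0; rewrite /h expR_eq0 gt_eqF ?expR_gt1 // expRK.
have := expR_sub1_gt0 _ u0; rewrite /bose.
move: (expR u) => x x0; have x1 : 1 - x < 0 by lra.
by field; rewrite (lt_eqF x1) (gt_eqF x0).
Qed.

Lemma hinvP b x : 0 <= x -> h x = b -> 0 <= hinv b /\ h (hinv b) = b.
Proof.
move=> x0 hx.
have im : (h @` `[0, +oo[) b by exists x => //; rewrite /= in_itv /= x0.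
split; last by rewrite /hinv pinvK // inE.
have sur : set_surj `[0, +oo[ (h @` `[0, +oo[) (@h R) by [].
have := surjpinv_image_sub (dflt := fun=> 0) sur; move=> /(_ (hinv b)).
by rewrite /= in_itv /= andbT; apply; exists b.
Qed.

Lemma hinv_lt1 b : 0 < b -> b < 1 ->
  exists t, [/\ 0 < t, bose t = b & hinv b = expR (- t)].
Proof.
move=> b0 b1; have [t0 t00 t0b] := bose_solution _ b0 b1.
have [x0 hx] := hinvP b _ (expR_ge0 _) (etrans (h_expN _ t00) t0b).
have x0' : 0 < hinv b.
  rewrite lt_neqAle x0 andbT; apply/eqP => E; move: hx; rewrite -E /h eqxx => E'; lra.
have [xlt|xgt|xeq] := ltgtP (hinv b) 1.
- exists (- ln (hinv b)); have l0 : 0 < - ln (hinv b) by rewrite oppr_gt0 ln_lt0 // x0'.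
  split=> //; last by rewrite opprK lnK.
  by rewrite -h_expN // opprK lnK.
- have l0 : 0 < ln (hinv b) by rewrite ln_gt0.
  have := boseD_ge1 _ l0; rewrite -h_exp // lnK // hx; lra.
- by move: hx; rewrite xeq /h oner_eq0 eqxx => E; lra.
Qed.

Lemma hinv_gt1 g : 1 < g ->
  exists u, [/\ 0 < u, bose u + u = g & hinv g = expR u].
Proof.
move=> g1; have [u0 u00 u0g] := boseD_solution _ g1.
have [x0 hx] := hinvP g _ (expR_ge0 _) (etrans (h_exp _ u00) u0g).
have x0' : 0 < hinv g.
  rewrite lt_neqAle x0 andbT; apply/eqP => E; move: hx; rewrite -E /h eqxx => E'; lra.
have [xlt|xgt|xeq] := ltgtP (hinv g) 1.
- have l0 : 0 < - ln (hinv g) by rewrite oppr_gt0 ln_lt0 // x0'.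
  have := bose_le1 _ l0; rewrite -h_expN // opprK lnK // hx; lra.
- have l0 : 0 < ln (hinv g) by rewrite ln_gt0.
  by exists (ln (hinv g)); rewrite -h_exp // !lnK.
- by move: hx; rewrite xeq /h oner_eq0 eqxx => E; lra.
Qed.

(** The parameters are t = - ln (h^-1(beta)) and u = ln (h^-1(beta / alpha));
after this substitution both sides agree term by term. *)
Lemma rate_saddle (alpha beta : R) : 0 < alpha -> alpha < beta -> beta < 1 ->
  exists t u, [/\ 0 < t, 0 < u, bose t = beta, bose u + u = beta / alpha &
    rate alpha beta + alpha * ln alpha + (1 - alpha) * ln (1 - alpha) =
    - (psi beta t + alpha * chi (beta / alpha) u)].
Proof.
move=> a0 ab b1; have b0 : 0 < beta by lra.
have g1 : 1 < beta / alpha by rewrite ltr_pdivlMr // mul1r.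
have [t [t0 tb hb]] := hinv_lt1 _ b0 b1; have [u [u0 ug hg]] := hinv_gt1 _ g1.
exists t, u; split=> //; rewrite /rate hb hg !expRK /psi /chi /lnphi.
rewrite invrN mulrN opprK ln_div ?posrE //.
have -> : alpha * (ln (expR u - 1) - beta / alpha * ln u) =
  alpha * ln (expR u - 1) - beta * ln u by field; lra.
lra.
Qed.

End Rate.

(** * Asymptotics of the terms *)

Section Perturbation.
Context {R : realType}.
Implicit Types t u b g : R.

Lemma psi_growth b t : 0 < b -> b < 1 -> 0 < t ->
  Num.min b (1 - b) * `|ln t| <= psi b t.
Proof.
move=> b0 b1 t0; rewrite /psi; have := lnphi_le0 _ t0; have := lnphi_le _ t0.
have h1 : Num.min b (1 - b) <= b by rewrite ge_min lexx.
have h2 : Num.min b (1 - b) <= 1 - b by rewrite ge_min lexx orbT.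
move: h1 h2; move: (Num.min _ _) (ln t) (lnphi t) => c x y.
by case: (ger0P x) => x0; nra.
Qed.

(** The perturbation is linear in [x], whereas the function grows at least like
[c * `|x|]. A fraction of this growth absorbs the perturbation, and the
remaining fraction keeps the lower bound. *)
Lemma perturbed_min (b b' c C x f0 fb : R) : 0 < c -> 0 <= C ->
  `|b' - b| <= c -> c * `|x| - C <= fb -> f0 <= fb ->
  (1 - `|b' - b| / c) * f0 - (`|b' - b| / c) * C <= fb + (b' - b) * x.
Proof.
move=> c0 C0 bc gr mn; set e := `|b' - b| in bc *.
have e0 : 0 <= e by rewrite normr_ge0.
pose th := e / c; have eE : e = th * c by rewrite divfK ?gt_eqF.
have th0 : 0 <= th by rewrite divr_ge0 ?(ltW c0).
have th1 : th <= 1 by rewrite ler_pdivrMr // mul1r.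
have : - (e * `|x|) <= (b' - b) * x.
  by rewrite /e -normrM; have := lerNnormlW (lexx `|(b' - b) * x|).
rewrite -/th {1}eE; nra.
Qed.

Lemma psi_perturbed t0 b' t : 0 < t0 -> 0 < t -> bose t0 < 1 ->
  let c := Num.min (bose t0) (1 - bose t0) in `|b' - bose t0| <= c ->
  (1 - `|b' - bose t0| / c) * psi (bose t0) t0 <= psi b' t.
Proof.
move=> t00 tgt0 b1 c bc; have b0 := bose_gt0 _ t00.
have c0 : 0 < c by rewrite lt_min b0 subr_gt0.
have gr := psi_growth _ _ b0 b1 tgt0; have mn := psi_min _ _ t00 tgt0.
have := perturbed_min (bose t0) b' c 0 (ln t) _ _ c0 (lexx 0) bc _ mn.
rewrite subr0 mulr0 subr0 => /(_ gr) h; apply: (le_trans h).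
rewrite /psi; lra.
Qed.

Lemma chi_growth g : 1 < g -> exists c C : R,
  [/\ 0 < c, 0 <= C & forall u, 0 < u -> c * `|ln u| - C <= chi g u].
Proof.
move=> g1; have [u1 u10 u1g] := @boseD_solution R (g + 1) (ltac:(lra)).
exists (Num.min 1 (g - 1)), (Num.max 0 (- chi (g + 1) u1)); split.
- by rewrite lt_min ltr01 subr_gt0.
- by rewrite le_max lexx.
move=> u u0; have h1 : Num.min 1 (g - 1) <= 1 by rewrite ge_min lexx.
have h2 : Num.min 1 (g - 1) <= g - 1 by rewrite ge_min lexx orbT.
have h3 : 0 <= Num.max 0 (- chi (g + 1) u1) by rewrite le_max lexx.
have h4 : - chi (g + 1) u1 <= Num.max 0 (- chi (g + 1) u1) by rewrite le_max lexx orbT.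
have h5 := chi_min _ _ u10 u0; rewrite u1g in h5.
have h6 : ln u <= ln (expR u - 1).
  rewrite ler_ln ?posrE ?expR_sub1_gt0 //; have := expR_ge1Dx u; lra.
move: h1 h2 h3 h4 h5 h6; rewrite {2}/chi /chi.
move: (Num.min _ _) (Num.max _ _) => c C.
by move: (ln u) (ln (expR u - 1)) => x y; case: (ger0P x) => x0; nra.
Qed.

Lemma chi_perturbed u0 : 0 < u0 -> 1 < bose u0 + u0 -> exists c C : R,
  [/\ 0 < c, 0 <= C & forall g' u, 0 < u -> `|g' - (bose u0 + u0)| <= c ->
   (1 - `|g' - (bose u0 + u0)| / c) * chi (bose u0 + u0) u0
     - (`|g' - (bose u0 + u0)| / c) * C <= chi g' u].
Proof.
move=> u00 g1; have [c [C [c0 C0 gr]]] := chi_growth _ g1.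
exists c, C; split=> // g' u ugt0 gc.
have gr' : c * `|- ln u| - C <= chi (bose u0 + u0) u by rewrite normrN; apply: gr.
have := perturbed_min (bose u0 + u0) g' c C (- ln u) _ _ c0 C0 gc gr'
  (chi_min _ _ u00 ugt0).
by move=> /le_trans; apply; rewrite /chi; lra.
Qed.

End Perturbation.

Section Asymptotics.
Context {R : realType} (alpha beta : R) (k n : nat -> nat).
Hypotheses (alpha_gt0 : 0 < alpha) (alpha_lt : alpha < beta) (beta_lt1 : beta < 1).
Hypotheses (k_gt0 : forall d, (0 < k d)%N) (n_gt0 : forall d, (0 < n d)%N).
Hypothesis k_sim : (fun d => (k d)%:R / (alpha * (n d)%:R) : R) @ \oo --> (1 : R).
Hypothesis d_sim : (fun d => d%:R / (beta * (n d)%:R) : R) @ \oo --> (1 : R).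
Hypothesis d_lt : \forall d \near \oo, (d <= (n d).-1)%N.

Let J := rate alpha beta + alpha * ln alpha + (1 - alpha) * ln (1 - alpha).

Let n_gt0R d : 0 < (n d)%:R :> R. Proof. by rewrite ltr0n. Qed.
Let k_gt0R d : 0 < (k d)%:R :> R. Proof. by rewrite ltr0n. Qed.
Let beta_gt0 : 0 < beta. Proof. exact: lt_trans alpha_lt. Qed.

Lemma ratio_k : (fun d => (k d)%:R / (n d)%:R : R) @ \oo --> alpha.
Proof.
have -> : (fun d => (k d)%:R / (n d)%:R : R) =
    (fun d => alpha * ((k d)%:R / (alpha * (n d)%:R))).
  by apply: funext => d; field; rewrite !gt_eqF.
by rewrite -[X in _ --> X]mulr1; exact: cvgMl_tmp.
Qed.

Lemma ratio_d : (fun d => d%:R / (n d)%:R : R) @ \oo --> beta.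
Proof.
have -> : (fun d => d%:R / (n d)%:R : R) = (fun d => beta * (d%:R / (beta * (n d)%:R))).
  by apply: funext => d; field; rewrite !gt_eqF.
by rewrite -[X in _ --> X]mulr1; exact: cvgMl_tmp.
Qed.

Lemma n_cvgy : (fun d => (n d)%:R : R) @ \oo --> +oo.
Proof.
apply/cvgryPge => A; near=> d.
apply: (@le_trans _ _ d%:R); first by near: d; exact: nbhs_infty_ger.
rewrite ler_nat; apply: leq_trans (leq_pred _); near: d; exact: d_lt.
Unshelve. all: by end_near. Qed.

Lemma inv_n_cvg0 : (fun d => (n d)%:R^-1 : R) @ \oo --> 0.
Proof. by apply/gtr0_cvgV0; [exact: nearW|exact: n_cvgy]. Qed.

Lemma ratio_d2 : (fun d => d.+2%:R / (n d)%:R : R) @ \oo --> beta.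
Proof.
have -> : (fun d => d.+2%:R / (n d)%:R : R) = (fun d => d%:R / (n d)%:R + 2 * (n d)%:R^-1).
  by apply: funext => d; rewrite -[d.+2]addn2 natrD mulrDl.
rewrite -[X in _ --> X]addr0 -[X in _ --> _ + X](mulr0 2).
by apply: cvgD; [exact: ratio_d|apply: cvgMl_tmp; exact: inv_n_cvg0].
Qed.

Lemma ratio_dk : (fun d => d.+2%:R / (k d)%:R : R) @ \oo --> beta / alpha.
Proof.
have -> : (fun d => d.+2%:R / (k d)%:R : R) =
    (fun d => d.+2%:R / (n d)%:R * ((k d)%:R / (n d)%:R)^-1).
  by apply: funext => d; rewrite invf_div mulrA divfK ?gt_eqF.
by apply: cvgM; [exact: ratio_d2|apply: cvgV; [exact: lt0r_neq0|exact: ratio_k]].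
Qed.

(** The summands of the bounds for the expected number of missing faces, see
[expected_missing_le] and [expected_missing_ge]. *)
Definition term d j : R :=
  (stirling1 (n d) j * surj j (k d))%:R / ((k d)%:R * (n d).-1`!%:R).

Lemma termE d j : term d j =
  (n d)%:R / (k d)%:R * (cycle_coef (n d) j * surj_coef (k d) j).
Proof.
rewrite /term /cycle_coef /surj_coef natrM; case: (n d) (n_gt0 d) => // m _ /=.
rewrite factS natrM; have := fact_gt0R (R := R) m; have := fact_gt0R (R := R) j.
have := k_gt0R d; have : 0 < m.+1%:R :> R by [].
by move=> *; field; rewrite !gt_eqF.
Qed.

Lemma ln_le_linear (x e : R) : 0 < x -> 0 < e -> ln x <= e * x - 1 - ln e.
Proof.
move=> x0 e0; have := @ln_le_sub1 R (e * x) (mulr_gt0 e0 x0).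
by rewrite lnM ?posrE //; lra.
Qed.

Lemma k_le_d : \forall d \near \oo, (k d <= d)%N.
Proof.
near=> d; rewrite -(ler_nat R) -(ler_pM2r (x := (n d)%:R^-1)) ?invr_gt0 //.
apply: (@le_trans _ _ ((alpha + beta) / 2)); apply: ltW; near: d.
  by apply: (cvgr_lt alpha ratio_k); move: alpha_lt; lra.
by apply: (cvgr_gt beta ratio_d); move: alpha_lt; lra.
Unshelve. all: by end_near. Qed.

Lemma d2_le_n : \forall d \near \oo, (d.+2 <= n d)%N.
Proof.
near=> d; rewrite -(ler_nat R) -(ler_pM2r (x := (n d)%:R^-1)) ?invr_gt0 //.
rewrite divff ?gt_eqF //; apply: ltW; near: d.
by apply: (cvgr_lt beta ratio_d2).
Unshelve. all: by end_near. Qed.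

(** The lower bounds for both factors hold with exponents at the ratios d / n
and d / k, at parameters that depend on [d]. Perturbing the minima bounds these
exponents from below by their value at the saddle point of the limiting ratios.
*)
Lemma single_term_diverges : J < 0 -> (fun d => term d d.+2) @ \oo --> +oo.
Proof.
have [t [u [t0 u0 tb ug JE]]] := rate_saddle _ _ alpha_gt0 alpha_lt beta_lt1.
rewrite /J JE oppr_lt0 => J0.
have g1 : 1 < bose u + u by rewrite ug ltr_pdivlMr // mul1r.
have [c2 [C2 [c20 C20 chiP]]] := chi_perturbed _ u0 g1.
have psiP := fun b' s s0 => psi_perturbed t b' s t0 s0 (ltac:(by rewrite tb)).
rewrite tb /= in psiP; rewrite ug in chiP g1.
set c1 := Num.min beta (1 - beta) in psiP.
have c10 : 0 < c1 by rewrite lt_min beta_gt0 subr_gt0.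
pose th1 d := `|d.+2%:R / (n d)%:R - beta| / c1.
pose th2 d := `|d.+2%:R / (k d)%:R - beta / alpha| / c2.
pose low d := (1 - th1 d) * psi beta t + (k d)%:R / (n d)%:R *
   ((1 - th2 d) * chi (beta / alpha) u - th2 d * C2).
have th1c : th1 @ \oo --> 0.
  rewrite -[X in _ --> X](mul0r c1^-1); apply: cvgMr_tmp; rewrite -(normr0 R).
  apply: cvg_norm; rewrite -(subrr beta); apply: cvgB; [exact: ratio_d2|exact: cvg_cst].
have th2c : th2 @ \oo --> 0.
  rewrite -[X in _ --> X](mul0r c2^-1); apply: cvgMr_tmp; rewrite -(normr0 R).
  apply: cvg_norm; rewrite -(subrr (beta / alpha)).
  apply: cvgB; [exact: ratio_dk|exact: cvg_cst].
have lowc : low @ \oo --> psi beta t + alpha * chi (beta / alpha) u.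
  have -> : psi beta t + alpha * chi (beta / alpha) u =
    (1 - 0) * psi beta t + alpha * ((1 - 0) * chi (beta / alpha) u - 0 * C2) by ring.
  apply: cvgD; first by apply: cvgMr_tmp; apply: cvgB => //; exact: cvg_cst.
  apply: cvgM; first exact: ratio_k.
  apply: cvgB; last exact: cvgMr_tmp.
  by apply: cvgMr_tmp; apply: cvgB => //; exact: cvg_cst.
set r := psi beta t + alpha * chi (beta / alpha) u in J0 lowc.
(* Logarithms are bounded by small multiples of n; with this slope, five of
   them cost at most an eighth of the exponent r n. *)
pose e := r / 40.
have e0 : 0 < e by rewrite divr_gt0.
have near1 : \forall d \near \oo, `|d.+2%:R / (n d)%:R - beta| <= c1.
  apply: cvgr0_norm_le => //; rewrite -(subrr beta).
  by apply: cvgB; [exact: ratio_d2|exact: cvg_cst].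
have near2 : \forall d \near \oo, `|d.+2%:R / (k d)%:R - beta / alpha| <= c2.
  apply: cvgr0_norm_le => //; rewrite -(subrr (beta / alpha)).
  by apply: cvgB; [exact: ratio_dk|exact: cvg_cst].
have near3 : \forall d \near \oo, r / 2 < low d.
  by apply: (cvgr_gt r lowc); lra.
apply/cvgryPge => A; near=> d.
have nd := n_gt0R d; have kd := k_gt0R d.
have d2n : (d.+2 <= n d)%N by near: d; exact: d2_le_n.
have kled : (k d <= d)%N by near: d; exact: k_le_d.
have kn : (k d <= n d)%N := leq_trans kled (leq_trans (leqW (leqnSn d)) d2n).
have kd2 : (0 < k d < d.+2)%N by rewrite k_gt0 ltnS leqW.
have [L L0 LP] := @ln_cycle_coef_ge R (n d) d.+2 (ltac:(by rewrite d2n)).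
have [v v0 vP] := @ln_surj_coef_ge R (k d) d.+2 kd2.
have hpsi : (1 - th1 d) * psi beta t <= psi (d.+2%:R / (n d)%:R) L.
  by apply: psiP => //; near: d.
have hchi : (1 - th2 d) * chi (beta / alpha) u - th2 d * C2 <=
    chi (d.+2%:R / (k d)%:R) v.
  by apply: chiP => //; near: d.
have hlow : r / 2 <= low d by apply: ltW; near: d.
have hmain : (n d)%:R * low d <= (d.+2%:R * ln L - (n d)%:R * ln (1 - expR (- L)))
    + ((k d)%:R * ln (expR v - 1) - d.+2%:R * ln v).
  have -> : d.+2%:R * ln L - (n d)%:R * ln (1 - expR (- L)) =
    (n d)%:R * psi (d.+2%:R / (n d)%:R) L.
    by rewrite /psi mulrBr mulrA mulrCA divff ?mulr1 ?gt_eqF.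
  have -> : (k d)%:R * ln (expR v - 1) - d.+2%:R * ln v =
     (n d)%:R * ((k d)%:R / (n d)%:R * chi (d.+2%:R / (k d)%:R) v).
    by rewrite /chi; field; rewrite !gt_eqF.
  rewrite -mulrDr ler_pM2l //; apply: lerD => //.
  by rewrite ler_wpM2l // divr_ge0.
have cpos : 0 < cycle_coef (n d) d.+2 :> R by apply: cycle_coef_gt0; rewrite d2n.
have bpos : 0 < surj_coef (k d) d.+2 :> R.
  by apply: surj_coef_gt0; rewrite k_gt0 (leq_trans kled) // leqW.
have prodpos : 0 < cycle_coef (n d) d.+2 * surj_coef (k d) d.+2 :> R by rewrite mulr_gt0.
have ln1' : ln ((n d).+1%:R : R) <= e * (n d).+1%:R - 1 - ln e by apply: ln_le_linear.
have ln2 : ln (d.+2%:R : R) <= e * d.+2%:R - 1 - ln e by apply: ln_le_linear.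
have d2R : d.+2%:R <= (n d)%:R :> R by rewrite ler_nat.
have lnprod : ln (cycle_coef (n d) d.+2 * surj_coef (k d) d.+2 : R) =
   ln (cycle_coef (n d) d.+2 : R) + ln (surj_coef (k d) d.+2 : R) by rewrite lnM.
have lower : (n d)%:R * (r / 4) - 4 * e + 4 + 4 * ln e - 1 - ln 4 + 1 + ln e
   <= ln (cycle_coef (n d) d.+2 * surj_coef (k d) d.+2 : R).
  rewrite lnprod.
  have hn : (n d)%:R * (r / 2) <= (n d)%:R * low d by rewrite ler_pM2l.
  have h4 : ln (4 * d.+2%:R : R) = ln 4 + ln d.+2%:R by rewrite lnM ?posrE.
  rewrite h4 in vP.
  have ed : e * d.+2%:R <= e * (n d)%:R by rewrite ler_pM2l.
  have ee : (n d)%:R * r = 40 * (e * (n d)%:R) by rewrite /e; field.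
  have ln3 : ln ((n d).+1%:R : R) <= e * (n d)%:R + e - 1 - ln e.
    by move: ln1'; rewrite -[X in e * X]natr1 mulrDr mulr1.
  have en : 0 <= e * (n d)%:R by rewrite mulr_ge0 // ltW.
  lra.
have tge : cycle_coef (n d) d.+2 * surj_coef (k d) d.+2 <= term d d.+2.
  rewrite termE -[leLHS]mul1r ler_pM2r // ler_pdivlMr // mul1r ler_nat //.
apply: le_trans tge; apply: le_trans (ltW (ln_sublinear prodpos)).
apply: le_trans lower; rewrite -!addrA -lerBlDr -ler_pdivrMr ?divr_gt0 //.
near: d; move/cvgryPge: n_cvgy; apply.
Unshelve. all: by end_near. Qed.

(** The upper bounds at the saddle point of the limiting ratios apply to all
[j] at once, and depend on [j] only through the factor (t / u)^j, which is
largest for the smallest [j] because t <= u. *)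
Lemma tail_negligible : 0 < J -> exists2 eta : R, 0 < eta & exists C : R,
  \forall d \near \oo,
    \sum_(d.+1 <= j < (n d).+1) term d j <= C * expR (- eta * (n d)%:R).
Proof.
have [t [u [t0 u0 tb ug JE]]] := rate_saddle _ _ alpha_gt0 alpha_lt beta_lt1.
rewrite /J JE oppr_gt0 => J0.
have lnu : ln u <= ln (expR u - 1).
  rewrite ler_ln ?posrE ?expR_sub1_gt0 //; have := expR_ge1Dx u; lra.
(* Otherwise the total exponent would be nonnegative, against J > 0. *)
have tu : ln t <= ln u.
  rewrite leNgt; apply/negP => ut; move: J0; rewrite /psi /chi.
  have -> : alpha * (ln (expR u - 1) - beta / alpha * ln u) =
    alpha * ln (expR u - 1) - beta * ln u by field; rewrite gt_eqF.
  have h1 := lnphi_le0 _ t0; have h2 := lnphi_le _ t0.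
  have h3 : alpha * ln u <= alpha * ln (expR u - 1) by rewrite ler_pM2l.
  have h4 : alpha * (ln t - ln u) <= beta * (ln t - ln u).
    by rewrite ler_pM2r ?ltW // subr_gt0.
  have h5 : lnphi t <= alpha * ln t.
    have [t1|t1] := leP 0 (ln t); first by apply: le_trans h1 _; rewrite mulr_ge0 // ltW.
    apply: le_trans h2 _; rewrite -[leLHS]mul1r ler_nM2r //.
    by move: alpha_lt beta_lt1; lra.
  lra.
set r := psi beta t + alpha * chi (beta / alpha) u in J0.
pose s d := d%:R / (n d)%:R * (ln t - ln u) - lnphi t +
   (k d)%:R / (n d)%:R * ln (expR u - 1).
have sc : s @ \oo --> r.
  have -> : r = beta * (ln t - ln u) - lnphi t + alpha * ln (expR u - 1).
    by rewrite /r /psi /chi; field; rewrite gt_eqF.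
  apply: cvgD; last by apply: cvgMr_tmp; exact: ratio_k.
  apply: cvgB; last exact: cvg_cst.
  by apply: cvgMr_tmp; exact: ratio_d.
(* The three logarithms that remain then cost at most a quarter of the
   exponent. *)
pose e := - r / 12.
have e0 : 0 < e by rewrite divr_gt0 // oppr_gt0.
have near1 : \forall d \near \oo, s d < r / 2.
  by apply: (cvgr_lt r sc); lra.
exists (- r / 4); first by rewrite divr_gt0 // oppr_gt0.
exists (expR (3 * (e - 1 - ln e) + 1)); near=> d.
have nd := n_gt0R d; have kd := k_gt0R d.
have kled : (k d <= d)%N by near: d; exact: k_le_d.
have hs : s d <= r / 2 by apply: ltW; near: d.
have ln1' : ln ((n d).+1%:R : R) <= e * (n d).+1%:R - 1 - ln e by apply: ln_le_linear.
have bound j : (d < j)%N -> (j < (n d).+1)%N ->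
   term d j <= (n d)%:R * expR ((n d)%:R * s d + ln (n d).+1%:R + 1).
  move=> dj jn.
  have jn' : (0 < j <= n d)%N by rewrite -(ltnS j) jn andbT (leq_trans _ dj).
  have kj : (0 < k d <= j)%N by rewrite k_gt0 (leq_trans kled (ltnW dj)).
  have cpos : 0 < cycle_coef (n d) j :> R by apply: cycle_coef_gt0.
  have bpos : 0 < surj_coef (k d) j :> R by apply: surj_coef_gt0.
  have prodpos : 0 < cycle_coef (n d) j * surj_coef (k d) j :> R by rewrite mulr_gt0.
  rewrite termE ler_pM ?(ltW prodpos) ?divr_ge0 //.
    by rewrite ler_pdivrMr // ler_peMr // ler1n.
  rewrite -[leLHS]lnK ?posrE // ler_expR lnM ?posrE //.
  have h1 := @ln_cycle_coef_le R (n d) j t jn' t0.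
  have h2 := @ln_surj_coef_le R (k d) j u kj u0.
  have h3 : ln (j.+1%:R : R) <= ln (n d).+1%:R by rewrite ler_ln ?posrE // ler_nat.
  have h4 : j%:R * (ln t - ln u) <= d%:R * (ln t - ln u).
    by rewrite ler_wnM2r ?subr_le0 // ler_nat ltnW.
  have -> : (n d)%:R * s d = d%:R * (ln t - ln u) - (n d)%:R * lnphi t +
    (k d)%:R * ln (expR u - 1) by rewrite /s; field; rewrite gt_eqF.
  rewrite /lnphi; lra.
apply: (@le_trans _ _ (\sum_(d.+1 <= j < (n d).+1)
    ((n d)%:R * expR ((n d)%:R * s d + ln (n d).+1%:R + 1)))).
  by rewrite big_nat [leRHS]big_nat; apply: ler_sum => j /andP[]; exact: bound.
rewrite sumr_const_nat.
have -> : expR (3 * (e - 1 - ln e) + 1) * expR (- (- r / 4) * (n d)%:R) =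
   expR (3 * (e - 1 - ln e) + 1 + r / 4 * (n d)%:R) :> R.
  by rewrite -expRD; congr expR; lra.
apply: (@le_trans _ _ ((n d).+1%:R * ((n d).+1%:R *
   expR ((n d)%:R * s d + ln (n d).+1%:R + 1)))).
  rewrite -[leLHS]mulr_natl ler_pM ?mulr_ge0 ?expR_ge0 // ?ler_nat ?leq_subr //.
  by rewrite ler_wpM2r ?expR_ge0 // ler_nat.
have nS : (n d).+1%:R = expR (ln (n d).+1%:R) :> R by rewrite lnK ?posrE.
rewrite {1 2}nS -!expRD ler_expR.
have hn : (n d)%:R * s d <= (n d)%:R * (r / 2) by rewrite ler_pM2l.
have er : e * (n d).+1%:R = - r / 12 * (n d)%:R + e.
  by rewrite -natr1 mulrDr mulr1 /e.
lra.
Unshelve. all: by end_near. Qed.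

End Asymptotics.

(** * Faces and linear dependences *)

Section Theorems_of_alternatives.
Context {R : realFieldType} {d : nat}.
Implicit Types (v : 'rV[R]_d) (c : 'cV[R]_d).

Definition dot v c : R := (v *m c) 0 0.

Lemma dotDl v w c : dot (v + w) c = dot v c + dot w c.
Proof. by rewrite /dot mulmxDl mxE. Qed.
Lemma dotBl v w c : dot (v - w) c = dot v c - dot w c.
Proof. by rewrite /dot mulmxBl !mxE. Qed.
Lemma dotZl a v c : dot (a *: v) c = a * dot v c.
Proof. by rewrite /dot -scalemxAl mxE. Qed.
Lemma dotDr v c e : dot v (c + e) = dot v c + dot v e.
Proof. by rewrite /dot mulmxDr mxE. Qed.
Lemma dotZr a v c : dot v (a *: c) = a * dot v c.
Proof. by rewrite /dot -scalemxAr mxE. Qed.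
Lemma dot0l c : dot 0 c = 0. Proof. by rewrite /dot mul0mx mxE. Qed.
Lemma dot_suml {I : Type} (r : seq I) (P : pred I) (F : I -> 'rV[R]_d) c :
  dot (\sum_(i <- r | P i) F i) c = \sum_(i <- r | P i) dot (F i) c.
Proof. by rewrite /dot mulmx_suml summxE. Qed.

Lemma dot_tr_gt0 v : v != 0 -> 0 < dot v v^T.
Proof.
move=> v0; have [j vj] : exists j, v 0 j != 0.
  apply/existsP; rewrite -negb_forall; apply: contra v0 => /forallP h.
  by apply/eqP/rowP => j; rewrite mxE; apply/eqP/h.
rewrite /dot mxE (bigD1 j) //= mxE; apply: ltr_pwDl.
  by rewrite -expr2 lt_neqAle eq_sym expf_eq0 /= vj sqr_ge0.
by apply: sumr_ge0 => i _; rewrite mxE -expr2 sqr_ge0.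
Qed.

(** Gordan's theorem of the alternative, by induction on the number of vectors.
If the direction found for the other vectors is negative on the first one, the
others are projected along the first vector onto the hyperplane orthogonal to
this direction. *)
Lemma gordan r (v : 'I_r -> 'rV[R]_d) :
  (exists c, forall i, 0 < dot (v i) c) \/
  (exists l : 'I_r -> R, [/\ forall i, 0 <= l i, exists i, 0 < l i &
     \sum_i l i *: v i = 0]).
Proof.
elim: r v => [|r IH] v; first by left; exists 0 => -[].
have push w (c : 'cV[R]_d) : w != 0 -> dot w c = 0 ->
    (forall i, 0 < dot (v (lift ord0 i)) c) -> v ord0 = w ->
    exists c, forall i, 0 < dot (v i) c.
  move=> w0 wc vc vw; pose K := 1 + \sum_i `|dot (v (lift ord0 i)) w^T| / dot (v (lift ord0 i)) c.
  exists (K *: c + w^T) => i; rewrite dotDr dotZr.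
  case: (unliftP ord0 i) => [j|] ->; last by rewrite vw wc mulr0 add0r dot_tr_gt0.
  have Kj : 1 + `|dot (v (lift ord0 j)) w^T| / dot (v (lift ord0 j)) c <= K.
    rewrite lerD2l (bigD1 j) //= lerDl sumr_ge0 // => i' _.
    by rewrite divr_ge0 // ltW.
  have := vc j; set a := dot _ c in Kj * => a0; set b := dot _ _ in Kj *.
  have : a + `|b| <= K * a.
    by rewrite -ler_pdivrMr // mulrDl divff ?gt_eqF.
  have := lerNnormlW (lexx `|b|); lra.
have [[c cP]|[l [l0 [i li] lv]]] := IH (fun i => v (lift ord0 i)); last first.
  right; exists (fun i => if unlift ord0 i is Some j then l j else 0); split.
  - by move=> j; case: unlift => //=.
  - by exists (lift ord0 i); rewrite liftK.
  - rewrite big_ord_recl unlift_none scale0r add0r -[RHS]lv.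
    by apply: eq_bigr => j _; rewrite liftK.
have [v0|v0] := eqVneq (v ord0) 0.
  right; exists (fun i => (i == ord0)%:R); split.
  - by move=> i; rewrite ler0n.
  - by exists ord0; rewrite eqxx.
  - rewrite big_ord_recl v0 scaler0 add0r big1 // => i _.
    by rewrite eq_sym (negbTE (neq_lift _ _)) scale0r.
set a := dot (v ord0) c; have [a0|a0|a0] := ltgtP a 0; first last.
- by left; exact: push v0 a0 cP erefl.
- left; exists c => i; case: (unliftP ord0 i) => [j|] -> //.
pose b i := - dot (v (lift ord0 i)) c / a.
have b0 i : 0 < b i by rewrite /b mulNr -mulrN -invrN divr_gt0 // oppr_gt0.
pose w i := v (lift ord0 i) + b i *: v ord0.
have wc i : dot (w i) c = 0 by rewrite dotDl dotZl /b divfK ?lt_eqF // subrr.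
have [[e eP]|[l [l0 [i li] lw]]] := IH w.
  left; pose f := e - (dot (v ord0) e / a) *: c.
  have f0 : dot (v ord0) f = 0.
    by rewrite /f -scaleNr dotDr dotZr mulNr divfK ?lt_eqF // subrr.
  apply: (push (v ord0) f) => // i.
  have -> : v (lift ord0 i) = w i - b i *: v ord0 by rewrite addrK.
  rewrite dotBl dotZl f0 mulr0 subr0 /f -scaleNr dotDr dotZr wc mulr0 addr0.
  exact: eP.
right; exists (fun i => if unlift ord0 i is Some j then l j else \sum_j l j * b j); split.
- move=> j; case: unlift => //.
  by apply: sumr_ge0 => j' _; rewrite mulr_ge0 // ltW.
- by exists (lift ord0 i); rewrite liftK.
- rewrite big_ord_recl unlift_none -[RHS]lw.
  under [in RHS]eq_bigr do rewrite /w scalerDr scalerA.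
  rewrite big_split /= addrC scaler_suml; congr (_ + _).
  by apply: eq_bigr => j _; rewrite liftK.
Qed.

(** The trivial functional is allowed: it exposes the empty set and the set of
all points. *)
Definition exposed {N} (p : 'I_N -> 'rV[R]_d) (I : {set 'I_N}) : Prop :=
  exists c (c0 : R), (forall i, i \in I -> dot (p i) c = c0) /\
    (forall i, i \notin I -> dot (p i) c < c0).

(** Gordan's theorem for the points outside [I], modulo the directions of the
affine hull of the points of [I]. *)
Lemma not_exposed_dependence {N} (p : 'I_N -> 'rV[R]_d) (I : {set 'I_N}) :
  I != finset.set0 -> ~ exposed p I -> exists mu : 'I_N -> R,
   [/\ \sum_i mu i = 0, \sum_i mu i *: p i = 0,
       forall i, i \notin I -> 0 <= mu i & exists2 i, i \notin I & 0 < mu i].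
Proof.
move=> /set0Pn[i0 i0I] nexp.
pose A := \matrix_(i < N) (if i \in I then p i - p i0 else 0).
(* Multiplication by K divides by the directions spanned by the points of I. *)
pose K := cokermx A.
have rowA i : i \in I -> (p i - p i0) *m K = 0.
  move=> iI; apply/eqP; rewrite -sub_kermx.
  have -> : p i - p i0 = row i A by rewrite rowK iI.
  by rewrite sub_kermx -row_mul mulmx_coker row0.
have [[c cP]|[l [l0 [j lj] lv]]] :=
    gordan _ (fun j : 'I_#|(~: I)%SET| => (p i0 - p (enum_val j)) *m K).
  case: nexp; exists (K *m c), (dot (p i0) (K *m c)).
  split=> i iI.
    apply/eqP; rewrite -subr_eq0 -dotBl /dot mulmxA rowA // mul0mx mxE //.
  have iC : i \in (~: I)%SET by rewrite inE.
  rewrite -subr_gt0 -dotBl /dot mulmxA.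
  by have := cP (enum_rank_in iC i); rewrite enum_rankK_in.
pose lam i := \sum_(j | enum_val j == i) l j.
have lamP i : i \notin I -> exists j, enum_val j = i /\ lam i = l j.
  move=> iI; have iC : i \in (~: I)%SET by rewrite inE.
  exists (enum_rank_in iC i); rewrite enum_rankK_in //; split=> //.
  rewrite /lam (big_pred1 (enum_rank_in iC i)) // => j' /=.
  apply/eqP/eqP => [E|->].
    by apply: enum_val_inj; rewrite enum_rankK_in.
  by rewrite enum_rankK_in.
have lamI i : i \in I -> lam i = 0.
  move=> iI; rewrite /lam big_pred0 // => j'; apply/negbTE/eqP => E.
  by have := enum_valP j'; rewrite E inE iI.
have sumlam (F : 'I_N -> 'rV[R]_d) :
    \sum_i lam i *: F i = \sum_j l j *: F (enum_val j).
  rewrite [RHS](partition_big (fun j => enum_val j) xpredT) //=.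
  apply: eq_bigr => i _; rewrite /lam scaler_suml.
  by apply: eq_bigr => j' /eqP ->.
have : ((\sum_i lam i *: (p i0 - p i))%R <= A)%MS.
  rewrite submxE sumlam mulmx_suml -[X in _ == X]lv; apply/eqP.
  by apply: eq_bigr => j' _; rewrite scalemxAl.
move=> /submxP[D DE].
pose nu i := lam i + (if i \in I then D 0 i else 0).
have nuE : \sum_i nu i *: (p i - p i0) = 0.
  transitivity (- (\sum_i lam i *: (p i0 - p i)) + \sum_i D 0 i *: row i A).
    rewrite -sumrN -big_split /=; apply: eq_bigr => i _.
    rewrite rowK /nu scalerDl -scalerN opprB; congr (_ + _).
    by case: ifP; rewrite ?scaler0 ?scale0r.
  by rewrite DE mulmx_sum_row addNr.
(* The weight of i0 is adjusted to make the coefficients sum to zero. *)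
pose mu i := nu i - (i == i0)%:R * \sum_j nu j.
exists mu; split.
- rewrite /mu sumrB -mulr_suml [X in _ - X * _](bigD1 i0) //= eqxx.
  rewrite [X in (_ + X) * _]big1 ?addr0 ?mul1r ?subrr //.
  by move=> i /negbTE->.
- rewrite /mu; under eq_bigr do rewrite scalerBl.
  rewrite sumrB [X in _ - X](bigD1 i0) //= eqxx mul1r [X in _ - (_ + X)]big1 ?addr0; last first.
    by move=> i /negbTE->; rewrite mul0r scale0r.
  rewrite scaler_suml -sumrB -[RHS]nuE; apply: eq_bigr => i _.
  by rewrite scalerBr.
- move=> i iI; have [j' [_ lE]] := lamP i iI.
  rewrite /mu /nu (negbTE iI) addr0 lE (_ : i == i0 = false) ?mul0r ?subr0 //.
  by apply/negbTE; apply: contra iI => /eqP->.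
- have jI : enum_val j \notin I by have := enum_valP j; rewrite inE.
  exists (enum_val j) => //; have [j' [/enum_val_inj E lE]] := lamP _ jI.
  rewrite /mu /nu (negbTE jI) addr0 lE E (_ : enum_val j == i0 = false) ?mul0r ?subr0 //.
  by apply/negbTE; apply: contra jI => /eqP->.
Qed.

End Theorems_of_alternatives.

Section Closed_path.
Context {R : realFieldType} {m d : nat}.
Implicit Types (X : 'M[R]_(m, d)) (x : 'I_m.+1 -> R) (I : {set 'I_m.+1}).

Definition position X (i : nat) : 'rV[R]_d := \sum_(j < m | (j < i)%N) row j X.

(** The last step leads back to the origin. *)
Definition closed_step X (p : 'I_m.+1) : 'rV[R]_d :=
  if unlift ord_max p is Some j then row j X else - \sum_j row j X.

Definition relations X : set ('I_m.+1 -> R) :=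
  fun x => \sum_p x p *: closed_step X p = 0.

Lemma lin_closed_relations X : lin_closed (relations X).
Proof.
split=> [|a x y]; rewrite /relations; first by rewrite big1 // => p _; rewrite scale0r.
move=> xX yX; under eq_bigr do rewrite scalerDl -scalerA.
by rewrite big_split /= -scaler_sumr xX yX scaler0 addr0.
Qed.

Lemma closed_stepE X (p : 'I_m.+1) :
  closed_step X p = position X (ordS p) - position X p.
Proof.
rewrite /closed_step; case: (unliftP ord_max p) => [j|] ->; last first.
  rewrite /= modnn /position [X in X - _]big_pred0 // sub0r; congr (- _).
  by apply: eq_bigl => j; rewrite ltn_ord.
have -> : lift ord_max j = j :> nat by rewrite /= /bump leqNgt ltn_ord.
have -> : ordS (lift ord_max j) = j.+1 :> nat.
  rewrite /= /bump leqNgt ltn_ord /= add0n modn_small // ltnS.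
  exact: ltn_ord.
rewrite /position [X in X - _](bigD1 j) //= -addrA [X in _ + X](_ : _ = 0) ?addr0 //.
apply/eqP; rewrite subr_eq0; apply/eqP; apply: eq_bigl => i.
by rewrite ltnS ltn_neqAle andbC.
Qed.

(** Summation by parts around the cycle. *)
Lemma relationsE X x :
  relations X x <-> \sum_i (x (ord_pred i) - x i) *: position X i = 0.
Proof.
rewrite /relations; suff -> : \sum_p x p *: closed_step X p =
  \sum_i (x (ord_pred i) - x i) *: position X i by [].
under eq_bigr do rewrite closed_stepE scalerBr.
under [RHS]eq_bigr do rewrite scalerBl.
rewrite !sumrB; congr (_ - _).
rewrite [RHS](reindex_inj (@ordS_inj _)) /=.
by apply: eq_bigr => i _; rewrite ordSK.
Qed.

Lemma sum_pred_diff x : \sum_i (x (ord_pred i) - x i) = 0.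
Proof.
rewrite sumrB; apply/eqP; rewrite subr_eq0; apply/eqP.
rewrite (reindex_inj (@ordS_inj _)) /=.
by apply: eq_bigr => i _; rewrite ordSK.
Qed.

Lemma discrete_primitive (mu : 'I_m.+1 -> R) : \sum_i mu i = 0 ->
  exists x, forall i, x (ord_pred i) - x i = mu i.
Proof.
move=> mu0; pose x (i : 'I_m.+1) := - \sum_(j < m.+1 | (j <= i)%N) mu j.
exists x => i; rewrite /x opprK addrC.
have [->|i0] := eqVneq i ord0.
  have -> : ord_pred ord0 = ord_max :> 'I_m.+1.
    by apply: ord_inj; rewrite val_ord_pred eqxx.
  rewrite [X in _ - X](_ : _ = 0) ?subr0; last first.
    by rewrite -[RHS]mu0; apply: eq_bigl => j; rewrite -ltnS ltn_ord.
  rewrite (big_pred1 ord0) // => j /=; rewrite leqn0.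
  by apply/eqP/eqP => [E|->//]; apply: ord_inj.
rewrite (bigD1 i) // -addrA.
rewrite [X in _ + X](_ : _ = 0) ?addr0 //.
apply/eqP; rewrite subr_eq0; apply/eqP; apply: eq_bigl => j.
have i0' : (0 < i)%N by rewrite lt0n; apply: contra i0 => /eqP e; exact/eqP/ord_inj.
rewrite val_ord_pred (negbTE i0) -[in RHS]ltnS (prednK i0') ltn_neqAle andbC.
by congr andb.
Qed.

(** Such relations are the dual certificates: summed by parts, they are the
affine dependences with nonnegative coefficients outside [I]. *)
Lemma not_exposedP X I : I != finset.set0 ->
  ~ exposed (fun i : 'I_m.+1 => position X i) I <->
  exists2 x, relations X x &
    (forall i, i \notin I -> x i <= x (ord_pred i)) /\
    (exists2 i, i \notin I & x i < x (ord_pred i)).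
Proof.
move=> I0; split=> [/(not_exposed_dependence _ _ I0)[mu [mu0 mup mu_ge [j jI muj]]]|].
  have [x xE] := discrete_primitive mu mu0; exists x.
    by apply/relationsE; rewrite -[RHS]mup; apply: eq_bigr => i _; rewrite xE.
  split=> [i iI|]; first by rewrite -subr_ge0 xE mu_ge.
  by exists j => //; rewrite -subr_gt0 xE.
move=> [x /relationsE xX [xI [j jI xj]]] [c [c0 [cI cIC]]].
have /set0Pn[i0 i0I] := I0.
have E : \sum_i (x (ord_pred i) - x i) * (dot (position X i) c - c0) = 0.
  under eq_bigr do rewrite mulrBr -dotZl.
  by rewrite sumrB -dot_suml xX dot0l -mulr_suml sum_pred_diff mul0r subrr.
have le0 i : (x (ord_pred i) - x i) * (dot (position X i) c - c0) <= 0.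
  have [iI|iI] := boolP (i \in I); first by rewrite cI // subrr mulr0.
  by rewrite mulr_ge0_le0 ?subr_ge0 ?xI // subr_le0 ltW ?cIC.
have : (x (ord_pred j) - x j) * (dot (position X j) c - c0) < 0.
  by rewrite pmulr_rlt0 ?subr_gt0 // subr_lt0 cIC.
have : \sum_(i < m.+1 | i != j) (x (ord_pred i) - x i) * (dot (position X i) c - c0) <= 0.
  by apply: sumr_le0 => i _; apply: le0.
by move: E; rewrite (bigD1 j) //= => E; lra.
Qed.

End Closed_path.

(** * Walks in general position *)

Lemma set_extension {T : finType} (A : {set T}) d : (#|A| <= d)%N -> (d <= #|T|)%N ->
  exists2 D : {set T}, A \subset D & #|D| = d.
Proof.
move=> Ad dT; have [l E] : exists l, (d - #|A| = l)%N by eexists.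
elim: l A Ad E => [|l IH] A Ad E.
  by exists A => //; apply/eqP; rewrite eqn_leq Ad -subn_eq0 E.
have : (~: A != finset.set0)%SET.
  by rewrite -card_gt0 cardsCs finset.setCK subn_gt0; lia.
move=> /set0Pn[x]; rewrite inE => xA.
have cA : #|(x |: A)%SET| = #|A|.+1 by rewrite cardsU1 xA.
have [||D AD cD] := IH (x |: A)%SET; rewrite ?cA; try lia.
by exists D => //; apply: fintype.subset_trans AD; exact: finset.subsetUr.
Qed.

Definition edges_from {F : fieldType} {d N : nat} (p : 'I_N -> 'rV[F]_d)
    (I : {set 'I_N}) (i0 : 'I_N) : 'M[F]_(#|(I :\ i0)%SET|, d) :=
  \matrix_(j < #|(I :\ i0)%SET|) (p (enum_val j : 'I_N) - p i0).

Section Descent.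
Context {R : realFieldType} {m : nat}.
Implicit Types (W : set ('I_m.+1 -> R)) (I : {set 'I_m.+1}) (s : {perm 'I_m}).

(** Group the steps into the level sets of [y] inside the blocks. If there are
at most [d] groups, genericity makes [y] constant, against the strict descent.
Otherwise [W] contains a vector that differs from [depth] by a function of the
group, hence decreases wherever [y] stays constant along a block, and adding a
small multiple of it makes all descents strict. *)
Lemma weak_descent_strict d k W s I : lin_closed W -> generic d W -> #|I| = k.+1 ->
  (exists2 y, W y & (forall i, i \notin I -> y (extend s i) <= y (extend s (ord_pred i))) /\
     exists2 i, i \notin I & y (extend s i) < y (extend s (ord_pred i))) ->
  descends W s I.
Proof.
move=> Wlin Wd cI [y Wy [yI [i0 i0I yi0]]].
pose g e := [set e' | (labels k s I e' == labels k s I e) && (y e' == y e)]%SET.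
have ge e : e \in g e by rewrite inE !eqxx.
have gy e e' : g e = g e' -> y e = y e'.
  by move=> E; have := ge e; rewrite E inE => /andP[_ /eqP].
pose v (A : {set 'I_m.+1}) := if [pick e in A] is Some e then y e else 0.
have vg e : v (g e) = y e.
  rewrite /v; case: pickP => [e'|/(_ e)]; last by rewrite ge.
  by rewrite inE => /andP[_ /eqP].
have [h1 h2] := Wd _ g.
have [c|c] := leqP #|codom g| d.
  have := h2 (leqW c) v; have -> : (fun i => v (g i)) = y by apply: funext => e.
  by move=> /(_ Wy) h; move: yi0; rewrite -!vg (h (extend s i0) (extend s (ord_pred i0))) ltxx.
have [u Wu] := h1 c (depth s I); set z := fun i => _ in Wu.
pose G := [set e : 'I_m.+1 * 'I_m.+1 | y e.1 < y e.2]%SET.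
have Gy : separates G y by move=> e; rewrite inE => /lt_eqF->.
have [t0 t00 /(_ t0)] := chamber_open G y z Gy.
rewrite ger0_norm ?(ltW t00) // => /(_ (lexx _))[_ /ascents_eqP E].
exists (fun i => t0 * z i + y i); first exact: Wlin.2.
move=> i iI; have := yI i iI; rewrite le_eqVlt => /predU1P[yE|ylt]; last first.
  have iG : (extend s i, extend s (ord_pred i)) \in G by rewrite inE.
  by have := E _ iG; rewrite /= ylt.
have gE : g (extend s i) = g (extend s (ord_pred i)).
  by apply/setP => e; rewrite !inE yE !ffunE !permK (label_pred _ _ cI _ iI).
rewrite yE ltrD2r ltr_pM2l // /z gE ltrD2r depth_lt !permK.
by rewrite (unrolled_pred _ _ cI _ iI).
Qed.

Context {d : nat}.
Implicit Types X : 'M[R]_(m, d).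

Lemma sum_split_max {V : nmodType} (F : 'I_m.+1 -> V) :
  \sum_p F p = \sum_j F (lift ord_max j) + F ord_max.
Proof.
rewrite big_ord_recr /=; congr (_ + _); apply: eq_bigr => j _; congr F.
by apply: val_inj; rewrite /= /bump leqNgt ltn_ord.
Qed.

Lemma closed_step_lift X j : closed_step X (lift ord_max j) = row j X.
Proof. by rewrite /closed_step liftK. Qed.

Lemma closed_step_max X : closed_step X ord_max = - \sum_j row j X.
Proof. by rewrite /closed_step unlift_none. Qed.

Lemma row_row_perm X s j : row j (row_perm s X) = row (s j) X.
Proof. by apply/rowP => i; rewrite !mxE. Qed.

Lemma closed_step_perm X s p :
  closed_step (row_perm s X) p = closed_step X (extend s p).
Proof.
case: (unliftP ord_max p) => [j|] ->.
  by rewrite closed_step_lift lift_perm_lift closed_step_lift row_row_perm.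
rewrite extend_max !closed_step_max; congr (- _).
rewrite [RHS](reindex_inj (@perm_inj _ s)); apply: eq_bigr => j _.
by rewrite row_row_perm.
Qed.

(** The closing step is a symmetric function of the increments. *)
Lemma relations_perm X s y :
  relations (row_perm s X) (fun p => y (extend s p)) <-> relations X y.
Proof.
rewrite /relations [X in _ <-> X = 0](reindex_inj (@perm_inj _ (extend s))) /=.
by under eq_bigr do rewrite closed_step_perm.
Qed.

Lemma not_exposed_descends X s I k : generic d (relations X) -> #|I| = k.+1 ->
  (k < m)%N ->
  ~ exposed (fun i : 'I_m.+1 => position (row_perm s X) i) I <->
  descends (relations X) s I.
Proof.
move=> Xd cI km; have I0 : I != finset.set0 by rewrite -card_gt0 cI.
rewrite (not_exposedP _ _ I0); split.
  move=> [x Xx h]; apply: (weak_descent_strict d k) => //.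
    exact: lin_closed_relations.
  exists (fun e => x ((extend s)^-1 e)%g).
    apply/(relations_perm _ s).
    by rewrite (_ : (fun p => _) = x) //; apply: funext => p; rewrite permK.
  by split=> [i iI|]; [|case: h => _ [i iI xi]; exists i => //]; rewrite !permK //; apply h.1.
move=> [y Wy yI]; exists (fun p => y (extend s p)); first exact/relations_perm.
split=> [i iI|]; first by rewrite ltW ?yI.
have : (~: I != finset.set0)%SET.
  by rewrite -card_gt0 cardsCs finset.setCK card_ord cI subn_gt0 ltnS.
by move=> /set0Pn[i]; rewrite inE => iI; exists i => //; apply: yI.
Qed.

(** General position for sums over any [d] disjoint blocks, where partial sums
only give consecutive ones. The increments labelled [None] are left out. *)
Definition blocks_free X : Prop := forall g : 'I_m -> option 'I_d,
  (forall a, exists p, g p = Some a) ->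
  row_free (\matrix_(a < d) \sum_(p | g p == Some a) row p X).

Lemma block_sum_comb X (g : 'I_m -> option 'I_d) (y : 'rV[R]_d) (x : 'I_m -> R) :
  (forall p, x p = if g p is Some a then y 0 a else 0) ->
  y *m (\matrix_(a < d) \sum_(p | g p == Some a) row p X) = \sum_p x p *: row p X.
Proof.
move=> xE; rewrite mulmx_sum_row.
under eq_bigr do rewrite rowK scaler_sumr big_mkcond /=.
rewrite exchange_big /=; apply: eq_bigr => p _; rewrite xE.
case gp: (g p) => [a|]; last by rewrite big1 ?scale0r.
rewrite (bigD1 a) //= eqxx big1 ?addr0 // => b ba.
by rewrite (_ : _ == _ = false) //; apply/negbTE; rewrite eq_sym.
Qed.

(** With more than [d] classes, [d] of them avoid the closing step; their block
sums form a basis, by which any combination of steps can be corrected. With at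
most [d.+1] classes, a relation constant on the classes is, after subtracting
the value on the class of the closing step, a vanishing combination of at most
[d] block sums; the classes are split further to obtain exactly [d] blocks. *)
Lemma generic_relations X : (d <= m)%N -> blocks_free X -> generic d (relations X).
Proof.
move=> dm free L g; split=> cg.
  move=> w.
  have cD : (d <= #|[set l in codom g | l != g ord_max]%SET|)%N.
    move: cg; rewrite (cardD1 (g ord_max) (mem (codom g))) codom_f add1n ltnS.
    by move=> /leq_trans; apply; apply/subset_leq_card/fintype.subsetP => l; rewrite !inE andbC.
  pose c (a : 'I_d) := enum_val (widen_ord cD a).
  have c_inj : injective c by move=> a b /enum_val_inj /(congr1 val) /= /val_inj.
  have cP a : c a \in codom g /\ c a != g ord_max.
    by have := enum_valP (widen_ord cD a); rewrite -/(c a) inE => /andP.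
  pose gg p := [pick a | c a == g (lift ord_max p)].
  have ggP p a : c a = g (lift ord_max p) -> gg p = Some a.
    rewrite /gg; case: pickP => [b /eqP <- /c_inj->//|/(_ a)].
    by move=> /eqP h1 /esym h2; case: h1.
  have /free/row_freeP[Y BY] : forall a, exists p, gg p = Some a.
    move=> a; have [/codomP[e ce] cm] := cP a.
    case: (unliftP ord_max e) => [p|] E; last by rewrite ce E eqxx in cm.
    by exists p; apply: ggP; rewrite -E.
  set B := \matrix_a _ in BY.
  have YB : Y *m B = 1%:M by apply: mulmx1C.
  pose t := \sum_p w p *: closed_step X p; pose y := t *m Y.
  pose v l := \sum_(a | c a == l) y 0 a; exists v; rewrite /relations.
  under eq_bigr do rewrite scalerBl.
  rewrite sumrB -/t [X in _ - X]sum_split_max.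
  have -> : v (g ord_max) = 0.
    by rewrite /v big_pred0 // => a; apply/negbTE; have [] := cP a.
  rewrite scale0r addr0; under [X in _ - X]eq_bigr do rewrite closed_step_lift.
  rewrite -(block_sum_comb X gg y) -/B /y -?mulmxA ?YB ?mulmx1 ?subrr //.
  move=> p; rewrite /v /gg; case: pickP => [a /eqP ca|h]; last by rewrite big_pred0.
  by rewrite (big_pred1 a) // => b; rewrite -ca (inj_eq c_inj).
move=> v Wv.
pose x (p : 'I_m) := v (g (lift ord_max p)) - v (g ord_max).
have x0 : \sum_p x p *: row p X = 0.
  rewrite -[RHS]Wv sum_split_max closed_step_max scalerN scaler_sumr -sumrB.
  by apply: eq_bigr => p _; rewrite closed_step_lift scalerBl.
suff xz p : x p = 0.
  have E e : v (g e) = v (g ord_max).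
    case: (unliftP ord_max e) => [p|] -> //; apply/eqP; rewrite -subr_eq0.
    by rewrite -/(x p) xz.
  by move=> i j; rewrite !E.
pose r l := [pick p : 'I_m | g (lift ord_max p) == l].
have rP l q : r l = Some q -> g (lift ord_max q) = l.
  by rewrite /r; case: pickP => // q' /eqP <- [<-].
pose A := [set q : 'I_m | (g (lift ord_max q) != g ord_max) &&
             (r (g (lift ord_max q)) == Some q)]%SET.
have cA : (#|A| <= d)%N.
  have inj : {in A &, injective (fun q => g (lift ord_max q))}.
    move=> a b; rewrite !inE => /andP[_ /eqP ra] /andP[_ /eqP rb] E.
    by move: ra; rewrite E rb => -[].
  rewrite -(card_in_imset inj) -ltnS; apply: leq_trans cg.
  rewrite (cardD1 (g ord_max) (mem (codom g))) codom_f add1n ltnS.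
  apply/subset_leq_card/fintype.subsetP => l /imsetP[q]; rewrite !inE.
  by move=> /andP[h _] ->; rewrite h codom_f.
have [D AD cD] := set_extension A d cA (ltac:(by rewrite card_ord)).
pose e (a : 'I_d) : 'I_m := enum_val (cast_ord (esym cD) a).
have e_inj : injective e by move=> a b /enum_val_inj /cast_ord_inj.
have eD q : q \in D -> exists a, e a = q.
  move=> qD; exists (cast_ord cD (enum_rank_in qD q)).
  by rewrite /e cast_ordK enum_rankK_in.
(* Each index is sent to the representative of its class; the indices added to
   reach d form blocks of their own. *)
pose tgt q := if q \in D then Some q else
   if g (lift ord_max q) == g ord_max then None else r (g (lift ord_max q)).
pose gg q := if tgt q is Some q' then [pick a | e a == q'] else None.
have pickE a q : e a = q -> [pick a | e a == q] = Some a.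
  move=> ea; case: pickP => [b /eqP|/(_ a)]; last by rewrite ea eqxx.
  by rewrite -ea => /e_inj->.
have ggP a : exists q, gg q = Some a.
  exists (e a); rewrite /gg /tgt (enum_valP (cast_ord (esym cD) a) : e a \in D).
  exact: pickE.
have tgtP q : if tgt q is Some q' then q' \in D /\ x q' = x q else x q = 0.
  rewrite /tgt; case: ifP => // qD; case: eqP => [E|nE]; first by rewrite /x E subrr.
  case rq: (r _) => [q'|]; last first.
    by move: rq; rewrite /r; case: pickP => // /(_ q); rewrite eqxx.
  have gq' := rP _ _ rq; split; last by rewrite /x gq'.
  apply: (fintype.subsetP AD); rewrite inE gq' rq eqxx andbT; exact/eqP.
have xE q : x q = if gg q is Some a then (\row_a x (e a)) 0 a else 0.
  have := tgtP q; rewrite /gg; case: (tgt q) => // q' [q'D xq].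
  by have [a ea] := eD _ q'D; rewrite (pickE a) // mxE ea.
have := free gg ggP; rewrite -kermx_eq0 => /eqP kB.
have /sub_kermxP : (\row_a x (e a)) *m
    (\matrix_(a < d) \sum_(p | gg p == Some a) row p X) = 0.
  by rewrite (block_sum_comb _ _ _ x xE).
rewrite kB submx0 => /eqP y0.
by rewrite xE y0; case: (gg p) => // a; rewrite mxE.
Qed.

(** Summed by parts, an affine dependence of the points of [I] becomes a
relation that is constant on the blocks of [I]. *)
Lemma affine_independence X I (nu : 'I_m.+1 -> R) : generic d (relations X) ->
  (#|I| <= d.+1)%N -> (forall i, i \notin I -> nu i = 0) ->
  \sum_i nu i = 0 -> \sum_i nu i *: position X i = 0 -> forall i, nu i = 0.
Proof.
move=> Xd cI nuI nu0 nup i.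
case cIE: #|I| => [|k].
  apply: nuI; move/eqP: cIE; rewrite cards_eq0 => /eqP->; by rewrite inE.
have [x xE] := discrete_primitive nu nu0.
have Xx : relations X x.
  by apply/relationsE; rewrite -[RHS]nup; apply: eq_bigr => j _; rewrite xE.
have xc := @constant_on_blocks m k I cIE R x _.
have {xc} xc : forall p q, label k I p = label k I q -> x p = x q.
  by apply: xc => j jI; apply/eqP; rewrite eq_sym -subr_eq0 xE nuI.
pose v (l : 'I_k.+1) := if [pick p | label k I p == l] is Some p then x p else 0.
have vE p : v (label k I p) = x p.
  by rewrite /v; case: pickP => [q /eqP/xc//|/(_ p)]; rewrite eqxx.
have [_ h] := Xd _ (label k I).
have := h _ v; rewrite (_ : (fun i => v (label k I i)) = x); last by apply: funext.
move=> /(_ _ Xx)-/(_ _ (ord_pred i) i); rewrite !vE -xE => ->; first by rewrite subrr.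
by apply: (leq_trans (max_card _)); rewrite card_ord -cIE.
Qed.

Local Notation edge_matrix X I i0 :=
  (edges_from (fun i : 'I_m.+1 => position X i) I i0).

Lemma rank_edge_matrix_small X I i0 : generic d (relations X) -> i0 \in I ->
  (#|I| <= d.+1)%N -> \rank (edge_matrix X I i0) = #|I|.-1.
Proof.
move=> Xd i0I cI; have cE : #|I| = #|(I :\ i0)%SET|.+1 by rewrite (cardsD1 i0) i0I.
rewrite cE /=; apply/eqP; rewrite -/(row_free _) -kermx_eq0.
apply/eqP/row_matrixP => r; rewrite row0.
set u := row r _; have /sub_kermxP uB : (u <= kermx (edge_matrix X I i0))%MS by apply: row_sub.
pose lam i := \sum_(j | enum_val j == i) u 0 j.
have sumlam (V : lmodType R) (F : 'I_m.+1 -> V) :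
    \sum_i lam i *: F i = \sum_j u 0 j *: F (enum_val j).
  rewrite [RHS](partition_big (fun j => enum_val j) xpredT) //=.
  apply: eq_bigr => i _; rewrite /lam scaler_suml.
  by apply: eq_bigr => j' /eqP ->.
have lamI i : i \notin (I :\ i0)%SET -> lam i = 0.
  move=> iI; rewrite /lam big_pred0 // => j'; apply/negbTE/eqP => E.
  by have := enum_valP j'; rewrite E (negbTE iI).
pose nu i := lam i - (i == i0)%:R * \sum_j lam j.
have nu0 := affine_independence X I nu Xd cI.
have nuz i : nu i = 0.
  apply: nu0.
  - move=> j jI; rewrite /nu lamI; last by rewrite !inE (negbTE jI) andbF.
    by rewrite (_ : j == i0 = false) ?mul0r ?subrr //; apply: contraNF jI => /eqP->.
  - rewrite /nu sumrB -mulr_suml [X in _ - X * _](bigD1 i0) //= eqxx.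
    rewrite [X in (_ + X) * _]big1 ?addr0 ?mul1r ?subrr //.
    by move=> j /negbTE->.
  - rewrite /nu; under eq_bigr do rewrite scalerBl.
    rewrite sumrB [X in _ - X](bigD1 i0) //= eqxx mul1r.
    rewrite [X in _ - (_ + X)]big1 ?addr0; last first.
      by move=> j /negbTE->; rewrite mul0r scale0r.
    rewrite scaler_suml -sumrB -[RHS]uB mulmx_sum_row.
    under eq_bigr do rewrite -scalerBr.
    by rewrite sumlam; apply: eq_bigr => j _; rewrite rowK.
apply/rowP => j; rewrite [RHS]mxE.
have := enum_valP j; rewrite !inE => /andP[ji0 _].
have := nuz (enum_val j); rewrite /nu (negbTE ji0) mul0r subr0 => <-.
by rewrite /lam (big_pred1 j) // => j' /=; rewrite (inj_eq enum_val_inj).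
Qed.

Lemma edge_matrix_sub X I I' i0 : I' \subset I ->
  (edge_matrix X I' i0 <= edge_matrix X I i0)%MS.
Proof.
move=> II; apply/row_subP => j; rewrite rowK.
have jI : enum_val j \in (I :\ i0)%SET.
  by have := enum_valP j; rewrite !inE => /andP[-> /(fintype.subsetP II)->].
have -> : position X (enum_val j) - position X i0 =
    row (enum_rank_in jI (enum_val j)) (edge_matrix X I i0).
  by rewrite rowK enum_rankK_in.
exact: row_sub.
Qed.

(** With more than [d.+1] points, the rank is already [d]. *)
Lemma rank_edge_matrix X I i0 k : generic d (relations X) -> i0 \in I ->
  (k < d)%N -> (\rank (edge_matrix X I i0) == k) = (#|I| == k.+1).
Proof.
move=> Xd i0I kd; have I0 : (0 < #|I|)%N by rewrite (cardsD1 i0) i0I.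
have [cI|cI] := leqP #|I| d.+1.
  by rewrite rank_edge_matrix_small //; case: #|I| I0 => // n _ /=; rewrite eqSS.
rewrite [RHS](_ : _ = false); last by apply/negbTE; rewrite neq_ltn orbC (leq_trans _ cI) // ltnS ltnS ltnW.
have [J JI cJ] : exists2 J : {set 'I_m.+1}, (i0 \in J) && (J \subset I) & #|J| = d.+1.
  have : (d <= #|(I :\ i0)%SET|)%N by move: cI; rewrite (cardsD1 i0) i0I add1n ltnS => /ltnW.
  move=> /fintype.card_geqP[l [ul sl lI]]; exists (i0 |: [set x in l])%SET.
    rewrite setU11 /= finset.subUset finset.sub1set i0I /=.
    by apply/fintype.subsetP => x; rewrite inE => /lI; rewrite !inE => /andP[].
  rewrite cardsU1 inE (_ : i0 \in l = false); last first.
    by apply/negbTE/negP => /lI; rewrite !inE eqxx.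
  by rewrite cardsE (card_uniqP ul) sl.
have /andP[i0J JsI] := JI.
have rJ : \rank (edge_matrix X J i0) = d by rewrite rank_edge_matrix_small // cJ.
have := mxrankS (edge_matrix_sub X I J i0 JsI); rewrite rJ => dr.
by apply/negbTE; rewrite neq_ltn (leq_trans kd dr) orbT.
Qed.

End Descent.

(** * Faces of a convex hull as sets of points *)

Section Affine_dimension.
Context {R : realType} {d : nat}.
Notation V := 'rV[R]_d.

Lemma dim_vspace_rank {r} (W : {vspace V}) (E : 'M[R]_(r, d)) :
  (forall v, (v \in W) = (v <= E)%MS) -> \dim W = \rank E.
Proof.
move=> WE; pose B := \matrix_(i < \dim W) (vbasis W)`_i.
have fB : row_free B.
  rewrite -kermx_eq0; apply/eqP/row_matrixP => i; rewrite row0.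
  set u := row i _; have /sub_kermxP : (u <= kermx B)%MS by apply: row_sub.
  rewrite mulmx_sum_row => uB.
  have /freeP free := basis_free (vbasisP W).
  apply/rowP => j; rewrite [RHS]mxE; apply: (free (fun j => u 0 j)).
  by rewrite -[RHS]uB; apply: eq_bigr => j' _; rewrite rowK.
have {fB} <- : \rank B = \dim W by apply/eqP.
apply/eqmx_rank/andP; split; apply/row_subP => i.
  by rewrite rowK -WE; apply: vbasis_mem; rewrite mem_nth // size_tuple.
have : row i E \in W by rewrite WE row_sub.
move=> /coord_vbasis->; apply: summx_sub => j _; apply: scalemx_sub.
have -> : (vbasis W)`_j = row j B by rewrite rowK.
exact: row_sub.
Qed.

Lemma row_space_vspace {r} (E : 'M[R]_(r, d)) :
  exists W : {vspace V}, forall v, (v \in W) = (v <= E)%MS.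
Proof.
pose X := [tuple row j E | j < r]; exists <<X>>%VS => v; apply/idP/idP.
  move=> /coord_span->; apply: summx_sub => j _; apply: scalemx_sub.
  by rewrite (nth_map j) ?size_enum_ord // nth_ord_enum row_sub.
move=> /submxP[D ->]; rewrite mulmx_sum_row; apply: memv_suml => j _.
apply/memvZ/memv_span; apply/mapP; exists j => //; exact: mem_enum.
Qed.

(** A combination with sum one is moved to [p i0] by subtracting it from every
point. *)
Lemma aff_hull_points {N} (p : 'I_N -> V) (I : {set 'I_N}) i0 : i0 \in I ->
  aff_hull [set p i | i in [set` I]] = [set x | (x - p i0 <= edges_from p I i0)%MS].
Proof.
move=> i0I; apply/seteqP; split=> [x [r [a [q [qI a1 ->]]]]|x] /=.
  rewrite -[p i0]scale1r -a1 scaler_suml -sumrB.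
  apply: summx_sub => j _; rewrite -scalerBr; apply: scalemx_sub.
  have [i /= iI <-] := qI j.
  have [->|ii0] := eqVneq i i0; first by rewrite subrr sub0mx.
  have iI' : i \in (I :\ i0)%SET by rewrite !inE ii0.
  have -> : p i - p i0 = row (enum_rank_in iI' i) (edges_from p I i0).
    by rewrite rowK enum_rankK_in.
  exact: row_sub.
move=> /submxP[D DE]; exists #|(I :\ i0)%SET|.+1.
exists (vcons (1 - \sum_j D 0 j) (fun j => D 0 j)).
exists (vcons (p i0) (fun j => p (enum_val j : 'I_N))); split.
- move=> i; rewrite /vcons; case: unlift => [j|]; last by exists i0.
  by exists (enum_val j) => //; have := enum_valP j; rewrite !inE => /andP[].
- rewrite big_ord_recl vcons0 -[RHS](subrK (\sum_j D 0 j)); congr (_ + _).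
  by apply: eq_bigr => j _; rewrite vconsS.
- rewrite big_ord_recl !vcons0 -[LHS](subrK (p i0)) DE mulmx_sum_row.
  rewrite scalerBl scale1r scaler_suml addrC -addrA; congr (_ + _).
  rewrite addrC -sumrB; apply: eq_bigr => j _.
  by rewrite rowK !vconsS scalerBr.
Qed.

Lemma has_affdim_points {N} (p : 'I_N -> V) (I : {set 'I_N}) i0 l : i0 \in I ->
  has_affdim [set p i | i in [set` I]] l <-> \rank (edges_from p I i0) = l.
Proof.
move=> i0I; rewrite /has_affdim (aff_hull_points _ _ _ i0I); split.
  move=> [x0 [W [E <-]]]; apply/esym/dim_vspace_rank => v.
  have mem x : (x - p i0 <= edges_from p I i0)%MS <-> x - x0 \in W.
    by have := congr1 (fun S => S x) E => /= ->.
  have p0 : p i0 - x0 \in W by apply/mem; rewrite subrr sub0mx.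
  have := mem (v + p i0); rewrite addrK -addrA => h.
  apply/idP/idP => [vW|/h vE]; first by apply/h; rewrite memvD.
  by rewrite -(addrK (p i0 - x0) v) memvB.
move=> <-; have [W WE] := row_space_vspace (edges_from p I i0).
exists (p i0), W; split; last exact: dim_vspace_rank.
by apply/seteqP; split=> x /=; rewrite WE.
Qed.

Lemma has_affdim_nonempty (A : set V) l : has_affdim A l -> A !=set0.
Proof.
move=> [x0 [W [E _]]].
have : aff_hull A x0 by rewrite E /= subrr mem0v.
move=> [r [a [q [qA a1 _]]]]; case: r a q qA a1 => [|r] a q qA a1.
  by move: a1; rewrite big_ord0 => /eqP; rewrite eq_sym oner_eq0.
by exists (q ord0).
Qed.

Section Faces.
Context {N : nat} (p : 'I_N -> V).
Notation Q := (conv_hull [set p i | i in [set: 'I_N]]).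

Lemma conv_hull_weights x : Q x -> exists l : 'I_N -> R,
  [/\ forall i, 0 <= l i, \sum_i l i = 1 & x = \sum_i l i *: p i].
Proof.
pose H := [set x : V | exists l : 'I_N -> R,
  [/\ forall i, 0 <= l i, \sum_i l i = 1 & x = \sum_i l i *: p i]].
suff : Q `<=` H by apply.
apply: smallest_sub => [y z t|_ [i _ <-]].
  rewrite !inE => -[l [l0 l1 ->]] [l' [l0' l1' ->]].
  exists (fun i => t%:num * l i + (1 - t%:num) * l' i); split.
  - have t1 : 0 <= 1 - t%:num :> R by rewrite subr_ge0.
    by move=> i; rewrite addr_ge0 // mulr_ge0.
  - by rewrite big_split /= -!mulr_sumr l1 l1' !mulr1 addrC subrK.
  - under [RHS]eq_bigr do rewrite scalerDl -!scalerA.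
    by rewrite big_split /= -!scaler_sumr.
exists (fun j => (j == i)%:R); split.
- by move=> j; rewrite ler0n.
- by rewrite (bigD1 i) //= eqxx big1 ?addr0 // => j /negbTE->.
- rewrite (bigD1 i) //= eqxx big1 ?addr0 ?scale1r // => j /negbTE->.
  by rewrite scale0r.
Qed.

Lemma conv_hull_point i : Q (p i).
Proof. by apply: sub_gen_smallest; exists i. Qed.

Definition cut (c : 'cV[R]_d) (c0 : R) : set V := [set x | Q x /\ (x *m c) 0 0 = c0].

(** A face is represented by the indices of the points that it contains. *)
Definition support (F : set V) : {set 'I_N} := [set i | `[< F (p i) >]]%SET.

Lemma supportP F i : reflect (F (p i)) (i \in support F).
Proof. by rewrite inE; apply: asboolP. Qed.

Lemma valid_on_hull c c0 : (forall i, dot (p i) c <= c0) ->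
  forall x, Q x -> (x *m c) 0 0 <= c0.
Proof.
move=> pc x /conv_hull_weights[l [l0 l1 ->]].
rewrite -/(dot _ _) dot_suml -[c0]mul1r -l1 mulr_suml; apply: ler_sum => i _.
by rewrite dotZl ler_wpM2l.
Qed.

(** Complementary slackness: points below the supporting hyperplane get weight
zero. *)
Lemma face_weights c c0 x : (forall y, Q y -> (y *m c) 0 0 <= c0) -> cut c c0 x ->
  exists l : 'I_N -> R, [/\ forall i, i \notin support (cut c c0) -> l i = 0,
     \sum_i l i = 1 & x = \sum_i l i *: p i].
Proof.
move=> Qc [Qx xc]; have [l [l0 l1 xE]] := conv_hull_weights x Qx.
exists l; split=> // i iS.
have pc j : dot (p j) c <= c0 by apply: Qc; apply: conv_hull_point.
have pi : dot (p i) c < c0.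
  rewrite lt_neqAle pc andbT; apply: contra iS => /eqP E.
  by apply/supportP; split=> //; exact: conv_hull_point.
have : \sum_j l j * (c0 - dot (p j) c) = 0.
  under eq_bigr do rewrite mulrBr -dotZl.
  by rewrite sumrB -mulr_suml l1 mul1r -dot_suml -xE /dot xc subrr.
move/eqP; rewrite psumr_eq0; last by move=> j _; rewrite mulr_ge0 // subr_ge0.
move=> /allP/(_ i); rewrite mem_index_enum => /(_ isT) /=.
by rewrite mulf_eq0 subr_eq0 (gt_eqF pi) orbF => /eqP.
Qed.

Lemma face_exposed F : is_face Q F -> exposed p (support F).
Proof.
move=> [c [c0 [Qc FE]]]; exists c, c0; split=> i.
  by move=> /supportP; rewrite FE => -[].
move=> iS; rewrite lt_neqAle (Qc _ (conv_hull_point i)) andbT.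
apply: contra iS => /eqP E; apply/supportP; rewrite FE; split=> //.
exact: conv_hull_point.
Qed.

Lemma exposed_face I : exposed p I -> exists F, is_face Q F /\ support F = I.
Proof.
move=> [c [c0 [cI cIC]]]; exists (cut c c0).
have pc i : dot (p i) c <= c0.
  by have [/cI->|/cIC/ltW] := boolP (i \in I).
split; first by exists c, c0; split=> //; apply: valid_on_hull.
apply/setP => i; apply/supportP/idP => [[_ E]|/cI E]; last first.
  by split; [exact: conv_hull_point|].
by apply/negPn/negP => /cIC; rewrite /dot E ltxx.
Qed.

Lemma support_inj F F' : is_face Q F -> is_face Q F' -> support F = support F' -> F = F'.
Proof.
suff sub G G' : is_face Q G -> is_face Q G' -> support G = support G' -> G `<=` G'.
  by move=> h h' E; apply/seteqP; split; apply: sub.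
move=> [c [c0 [Qc GE]]] [c' [c0' [Qc' GE']]] E x; rewrite GE => Gx.
have [l [lS l1 xE]] := face_weights c c0 x Qc Gx.
rewrite GE'; split; first by case: Gx.
rewrite -/(dot x c') xE dot_suml -[c0']mul1r -l1 mulr_suml; apply: eq_bigr => i _.
rewrite dotZl; have [iS|iS] := boolP (i \in support (cut c c0)); last by rewrite lS // !mul0r.
move: iS; rewrite -[cut c c0]GE E => /supportP; rewrite GE' => -[_].
by rewrite /dot => ->.
Qed.

(** Every point of a face is a convex combination of the points [p i] in it. *)
Lemma aff_hull_face F : is_face Q F ->
  aff_hull F = aff_hull [set p i | i in [set` support F]].
Proof.
move=> Ff; have [c [c0 [Qc FE]]] := Ff; apply/seteqP; split; last first.
  move=> x [r [a [q [qI a1 ->]]]]; exists r, a, q; split=> // i.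
  by have [j /= /supportP Fj <-] := qI i.
move=> x [r [a [q [qF a1 ->]]]].
have /boolp.choice[l lP] : forall i, exists l : 'I_N -> R,
    [/\ forall i, i \notin support F -> l i = 0, \sum_i l i = 1 & q i = \sum_i l i *: p i].
  by move=> i; rewrite FE; apply: face_weights => //; rewrite -[cut c c0]FE.
have [i0 i0F] : exists i0, i0 \in support F.
  apply/set0Pn/eqP => E.
  case: r a q qF a1 l lP => [|r] a q qF a1 l lP.
    by move: a1; rewrite big_ord0 => /eqP; rewrite eq_sym oner_eq0.
  have [lS l1 _] := lP ord0; move: l1; rewrite big1 => [/eqP|i _].
    by rewrite eq_sym oner_eq0.
  by apply: lS; rewrite E inE.
exists N, (fun j => \sum_i a i * l i j), (fun j => if j \in support F then p j else p i0).
split.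
- by move=> j; case: ifP => jF; [exists j|exists i0].
- rewrite exchange_big /= -[RHS]a1; apply: eq_bigr => i _.
  by rewrite -mulr_sumr; have [_ -> _] := lP i; rewrite mulr1.
- under [RHS]eq_bigr do rewrite scaler_suml.
  rewrite exchange_big /=; apply: eq_bigr => i _.
  have [lS _ qE] := lP i; rewrite {1}qE scaler_sumr; apply: eq_bigr => j _.
  rewrite scalerA; case: ifP => // /negbT jF; by rewrite lS // mulr0 !scale0r.
Qed.

(** A face is determined by the points that it contains, and the sets that
arise in this way are the exposed ones. *)
Lemma num_facesE l : num_faces l Q =
  #|[set I | `[< exposed p I /\ has_affdim [set p i | i in [set` I]] l >]]%SET|.
Proof.
set S := [set I | _]%SET; rewrite /num_faces; apply: card_fset_set.
have /boolp.choice[G GP] : forall I, exists F, exposed p I -> is_face Q F /\ support F = I.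
  move=> I; have [/exposed_face[F FP]|nI] := pselect (exposed p I); first by exists F.
  by exists set0.
(* Listing the sets of S makes the set of faces the image of an initial segment
   of the natural numbers. *)
pose g j := G (nth finset.set0 (enum S) j).
have gS j : (j < #|S|)%N -> nth finset.set0 (enum S) j \in S.
  by move=> jS; rewrite -mem_enum mem_nth // -cardE.
have -> : [set F | is_face Q F /\ has_affdim F l] = g @` `I_#|S|.
  apply/seteqP; split=> [F [Ff Fl]|_ [j /= jS <-]] /=; last first.
    have := gS j jS; rewrite inE => /asboolP[ex dim].
    have [Ff FS] := GP _ ex; split=> //.
    by rewrite /has_affdim (aff_hull_face _ Ff) FS.
  have ex := face_exposed F Ff; have [Gf GS] := GP _ ex.
  have FS : support F \in S.
    rewrite inE; apply/asboolP; split=> //.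
    by rewrite /has_affdim -(aff_hull_face _ Ff).
  exists (index (support F) (enum S)); first by rewrite /= cardE index_mem mem_enum.
  by rewrite /g nth_index ?mem_enum //; exact: support_inj.
have gSup j : (j < #|S|)%N -> support (g j) = nth finset.set0 (enum S) j.
  by move=> /gS; rewrite inE => /asboolP[ex _]; have [] := GP _ ex.
apply: inj_card_eq => i j /set_mem /= iS /set_mem /= jS gij.
apply/eqP; rewrite -(nth_uniq finset.set0 (s := enum S)) -?cardE ?enum_uniq //.
by rewrite -!gSup // gij.
Qed.

End Faces.
End Affine_dimension.

(** * Measurability of random matrices *)

Section Borel_matrices.
Context {R : realType} {m d : nat}.
Local Notation M := 'M[R]_(m, d).
Local Notation borel := (g_sigma_algebraType (@open M)).

Definition rational_box (q : 'M[rat]_(m, d)) (k : nat) : set M :=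
  [set X | forall i j, `|ratr (q i j) - X i j| < k.+1%:R^-1].

(** The Borel sets of matrices are generated by the coordinates because
rational boxes form a countable base. *)
Lemma open_rational_boxes (O : set M) : open O ->
  O = \bigcup_(qk : 'M[rat]_(m, d) * nat)
    [set X | rational_box qk.1 qk.2 `<=` O /\ rational_box qk.1 qk.2 X].
Proof.
move=> oO; apply/seteqP; split=> [X OX|X [qk _ [OqB Xq]]]; last exact: OqB.
have /nbhs_ballP[e /= e0 eO] := open_nbhs_nbhs (conj oO OX).
pose k := Num.truncn (2 / e).
have k0 : 0 < k.+1%:R^-1 :> R by rewrite invr_gt0 ltr0n.
have ke : k.+1%:R^-1 + k.+1%:R^-1 < e :> R.
  have : 2 / e < k.+1%:R by rewrite truncnS_gt.
  rewrite ltr_pdivrMr // => ke.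
  by rewrite -mulr2n -[_ *+ 2]mulr_natl ltr_pdivrMr ?ltr0n // mulrC.
have /choice[q qP] : forall ij : 'I_m * 'I_d, exists q : rat,
    `|ratr q - X ij.1 ij.2| < k.+1%:R^-1.
  move=> [i j] /=; have /rat_in_itvoo[q] : X i j - k.+1%:R^-1 < X i j + k.+1%:R^-1.
    by rewrite ltrD2l gtrN.
  by rewrite in_itv /= -ltr_distl => qX; exists q.
exists (\matrix_(i, j) q (i, j), k) => //; split=> [Y Yq|i j]; last by rewrite mxE qP.
apply: eO; split=> // i j.
rewrite /ball /=; apply: le_lt_trans ke; apply: le_trans (ler_distD (ratr (q (i, j))) _ _) _.
apply: lerD; apply: ltW; first by rewrite distrC; exact: (qP (i, j)).
by have := Yq i j; rewrite mxE.
Qed.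

Lemma measurable_coord (i : 'I_m) (j : 'I_d) : measurable_fun [set: borel] (fun X : borel => (X : M) i j).
Proof.
apply: (measurability _ (RGenOInfty.measurableE R)).
move=> _ [_ [a ->] <-]; rewrite setTI.
apply: sub_sigma_algebra; apply: open_comp; last exact: rray_open.
by move=> X _; apply: coord_continuous.
Qed.

Context {disp : measure_display} {T : measurableType disp}.

Lemma measurable_matrix (F : T -> M) :
  (forall i j, measurable_fun [set: T] (fun w => F w i j)) ->
  measurable_fun [set: T] (F : T -> borel).
Proof.
move=> mF; apply: (@measurability _ _ _ borel _ _ (@open M)) => // _ [U oU <-]; rewrite setTI.
rewrite (open_rational_boxes U oU) preimage_bigcup.
apply: countable_bigcupT_measurable => [|[q k]] /=.
  exact: countableP.
have [qU|qU] := pselect (rational_box q k `<=` U); last first.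
  rewrite (_ : _ @^-1` _ = set0) //; apply/seteqP; split=> // w /= [].
  by move=> /qU.
rewrite (_ : _ @^-1` _ = \bigcap_(i in [set: 'I_m]) \bigcap_(j in [set: 'I_d])
  [set w | `|ratr (q i j) - F w i j| < k.+1%:R^-1]); last first.
  apply/seteqP; split=> w /= => [[_ qw] i _ j _|qw]; first exact: qw.
  by split=> // i j; exact: qw.
apply: fin_bigcap_measurable => // i _; apply: fin_bigcap_measurable => // j _.
rewrite -[X in measurable X]setTI.
have mf : measurable_fun [set: T] (fun w => `|ratr (q i j) - F w i j|).
  by apply: measurableT_comp => //; apply: measurable_funB.
have := mf measurableT _ (measurable_itv `]-oo, k.+1%:R^-1[).
by congr measurable; apply/seteqP; split=> w /=; rewrite in_itv.
Qed.

End Borel_matrices.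

Lemma measurable_increment_matrix {R : realType} {disp} {T : measurableType disp} {m d}
    (xi : 'I_m -> T -> 'rV[R]_d) : random_vectors xi ->
  measurable_fun [set: T] ((fun w => \matrix_(i < m) xi i w) : T -> g_sigma_algebraType (@open 'M[R]_(m, d))).
Proof.
move=> mxi; apply: measurable_matrix => i j.
under eq_fun do rewrite mxE.
exact: (measurableT_comp (measurable_coord ord0 j) (mxi i)).
Qed.

(** * Borel sets of configurations *)

Section Borel_events.
Context {R : realType} {m d : nat}.
Local Notation M := 'M[R]_(m, d).
Local Notation borel := (g_sigma_algebraType (@open M)).

Definition elevation (i0 i : nat) (z : 'rV[R]_d * M) : R :=
  dot (position z.2 i - position z.2 i0) z.1^T.

Lemma elevation_continuous i0 i : continuous (elevation i0 i).
Proof.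
have dot_continuous j : continuous (fun z : 'rV[R]_d * M => dot (position z.2 j) z.1^T).
  rewrite (_ : (fun _ => _) = fun z : 'rV[R]_d * M =>
      \sum_(l < d) (\sum_(p < m | (p < j)%N) z.2 p l) * z.1 ord0 l); last first.
    apply/funext => z; rewrite /dot /position mxE; apply: eq_bigr => l _.
    rewrite mxE; congr (_ * _); rewrite summxE.
    by apply: eq_bigr => p _; rewrite mxE.
  apply: continuous_big => [|l _]; first exact: add_continuous.
  move=> z; apply: cvgM.
    move: z; apply: continuous_big => [|p _ z']; first exact: add_continuous.
    by apply: (@continuous_comp _ _ _ snd (fun X : M => X p l)); [exact: cvg_snd|exact: coord_continuous].
  by apply: (@continuous_comp _ _ _ fst (fun c : 'rV[R]_d => c ord0 l)); [exact: cvg_fst|exact: coord_continuous].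
rewrite (_ : elevation i0 i = fun z => dot (position z.2 i) z.1^T - dot (position z.2 i0) z.1^T).
  by move=> z; apply: cvgB; exact: dot_continuous.
by apply/funext => z; rewrite /elevation dotBl.
Qed.

(** A witness can be scaled to leave a gap of one instead of strict
inequalities; with bounded directions, this makes the condition closed. *)
Definition exposed_within (I : {set 'I_m.+1}) (i0 : 'I_m.+1) (N : nat) : set M :=
  [set X | exists2 c : 'rV[R]_d, (forall j, `[- N%:R, N%:R]%classic (c ord0 j)) &
    (forall i : 'I_m.+1, i \in I -> elevation i0 i (c, X) = 0) /\
    (forall i : 'I_m.+1, i \notin I -> elevation i0 i (c, X) <= -1)].

(** Compactness of the box of directions makes the projection along it closed.
*)
Lemma exposed_within_closed I i0 N : open (~` exposed_within I i0 N).
Proof.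
rewrite openE => X nX; rewrite /interior.
have cK : compact [set c : 'rV[R]_d | forall j, `[- N%:R, N%:R]%classic (c ord0 j)].
  exact: (@rV_compact R d (fun _ => `[- N%:R, N%:R]%classic) (fun j => @segment_compact R _ _)).
have near_cover := (compact_near_coveringP _).1 cK M (nbhs X) (fun X' c =>
  ~ ((forall i : 'I_m.+1, i \in I -> elevation i0 i (c, X') = 0) /\
    (forall i : 'I_m.+1, i \notin I -> elevation i0 i (c, X') <= -1))) (nbhs_filter X).
suff : \forall X' \near X, [set c : 'rV[R]_d | forall j, `[- N%:R, N%:R]%classic (c ord0 j)] `<=`
    [set c | ~ ((forall i : 'I_m.+1, i \in I -> elevation i0 i (c, X') = 0) /\
    (forall i : 'I_m.+1, i \notin I -> elevation i0 i (c, X') <= -1))].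
  by apply: filterS => X' X'K [c cK' cX']; exact: (X'K c).
apply: near_cover => c cK'.
have : ~ ((forall i : 'I_m.+1, i \in I -> elevation i0 i (c, X) = 0) /\
  (forall i : 'I_m.+1, i \notin I -> elevation i0 i (c, X) <= -1)).
  by move=> cX; apply: nX; exists c.
move=> not_good; suff near_z : \forall z \near ((c, X) : 'rV[R]_d * M),
    ~ ((forall i : 'I_m.+1, i \in I -> elevation i0 i z = 0) /\
    (forall i : 'I_m.+1, i \notin I -> elevation i0 i z <= -1)).
  by apply: filterS near_z => -[].
case/not_andP: not_good => [/existsNP[i /not_implyP[iI /eqP ei]]|/existsNP[i /not_implyP[iI /negP ei]]].
- have near_ei := @cvgr_neq0 _ _ _ _ (nbhs_filter ((c, X) : 'rV[R]_d * M)) (elevation i0 i) _ (elevation_continuous i0 i (c, X)) ei.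
  by apply: filterS near_ei => z /eqP zi [/(_ i iI) /zi].
- rewrite -ltNge in ei.
  have near_ei := @cvgr_gt _ _ _ (nbhs_filter ((c, X) : 'rV[R]_d * M)) (elevation i0 i) _ (elevation_continuous i0 i (c, X)) _ ei.
  by apply: filterS near_ei => z zi [_ /(_ i iI)]; rewrite leNgt zi.
Qed.

(** A countable union of closed sets, over the bounds for the direction. *)
Lemma measurable_exposed (I : {set 'I_m.+1}) :
  measurable ([set X : M | exposed (fun i : 'I_m.+1 => position X i) I] : set borel).
Proof.
have [->|/set0Pn[i0 i0I]] := eqVneq I finset.set0.
  rewrite (_ : [set X | _] = [set: M]); first exact: measurableT.
  apply/seteqP; split=> // X _ /=; exists 0, 1; split=> i; first by rewrite finset.in_set0.
  by rewrite /dot mulmx0 mxE ltr01.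
rewrite (_ : [set X | _] = \bigcup_N exposed_within I i0 N); last first.
  apply/seteqP; split=> [X [c [c0 [cI cI']]]|X [N _ [c _ [cI cI']]]] /=; last first.
    exists c^T, (dot (position X i0) c^T); split=> i iI.
      by have := cI i iI; rewrite /elevation /= dotBl => /eqP; rewrite subr_eq0 => /eqP.
    by have := cI' i iI; rewrite /elevation /= dotBl => ?; lra.
  have gap i : i \notin I -> 0 < c0 - dot (position X i) c by move=> /cI'; lra.
  (* The factor t is at least the inverse of every gap. *)
  pose t := \sum_(i < m.+1 | i \notin I) (c0 - dot (position X i) c)^-1.
  have t_ge i : i \notin I -> 1 <= t * (c0 - dot (position X i) c).
    move=> iI; rewrite -ler_pdivrMr ?gap // div1r /t (bigD1 i) //=.
    by rewrite lerDl sumr_ge0 // => j /andP[jI _]; rewrite invr_ge0 ltW // gap.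
  exists (Num.truncn (\sum_j `|t * c j 0|)).+1 => //; exists ((t *: c)^T).
    move=> j; rewrite /= in_itv /= !mxE -ler_norml; apply/ltW/(le_lt_trans _ (truncnS_gt _)).
    by rewrite (bigD1 j) //= lerDl sumr_ge0.
  by split=> i iI; rewrite /elevation /= trmxK dotZr dotBl (cI i0 i0I) ?(cI i iI) ?subrr ?mulr0 //;
    have := t_ge i iI; lra.
apply: bigcupT_measurable => N; rewrite -[exposed_within _ _ _]classical_sets.setCK.
apply: measurableC; apply: sub_sigma_algebra; exact: exposed_within_closed.
Qed.

Lemma measurable_det {r} (F : borel -> 'M[R]_r) :
  (forall i j, measurable_fun [set: borel] (fun X => F X i j)) ->
  measurable_fun [set: borel] (fun X => \det (F X)).
Proof.
move=> mF; apply: measurable_sum => s; apply: measurable_funM => //.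
by apply: measurable_prod => i _; exact: mF.
Qed.

(** Rank is detected by minors, which depend measurably on the matrix. *)
Lemma rank_geP {p} (A : 'M[R]_(p, d)) r : (r <= \rank A)%N <->
  exists (f : {ffun 'I_r -> 'I_p}) (g : {ffun 'I_r -> 'I_d}), \det (mxsub f g A) != 0.
Proof.
split=> [rA|[f [g fgA]]]; last first.
  have : row_free (mxsub f g A) by rewrite row_free_unit unitmxE unitfE.
  rewrite /row_free => /eqP <-; rewrite mxsubrc rowsubE.
  apply: leq_trans (mxrankM_maxr _ _) _.
  by rewrite -[A in colsub g A]mulmx1 -mulmx_colsub mxrankM_maxl.
pose w := widen_ord rA.
pose B := rowsub (maxrankfun A \o w) A.
have Bfree : row_free B.
  have /row_freeP[C AC] := maxrowsub_free A.
  apply/row_freeP; exists (C *m (rowsub w 1%:M)^T).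
  rewrite mulmxA /B rowsub_comp mul_rowsub_mx AC.
  apply/matrixP => i j; rewrite !mxE (bigD1 (w i)) //= !mxE eqxx mul1r big1 ?addr0.
    by rewrite eq_sym -!val_eqE.
  by move=> l lw; rewrite !mxE eq_sym (negbTE lw) mul0r.
have Bfull : row_full B^T by rewrite /row_full mxrank_tr.
exists (finfun (maxrankfun A \o w)), (finfun (fullrankfun Bfull)).
rewrite (_ : mxsub _ _ A = (rowsub (fullrankfun Bfull) B^T)^T); last first.
  by apply/matrixP => i j; rewrite !mxE !ffunE.
by rewrite det_tr -unitfE -unitmxE -row_free_unit fullrowsub_free.
Qed.

Lemma measurable_rank {p} (F : borel -> 'M[R]_(p, d)) (l : nat) :
  (forall i j, measurable_fun [set: borel] (fun X => F X i j)) ->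
  measurable [set X : borel | \rank (F X) = l].
Proof.
move=> mF.
have m_ge r : measurable [set X : borel | (r <= \rank (F X))%N].
  rewrite (_ : [set X | _] = \bigcup_(f : {ffun 'I_r -> 'I_p}) \bigcup_(g : {ffun 'I_r -> 'I_d})
    [set X : borel | \det (mxsub f g (F X)) != 0]); last first.
    apply/seteqP; split=> X /= => [/rank_geP[f [g fg]]|[f _ [g _ fg]]].
      by exists f => //; exists g.
    by apply/rank_geP; exists f, g.
  apply: countable_bigcupT_measurable => [|f]; first exact: countableP.
  apply: countable_bigcupT_measurable => [|g]; first exact: countableP.
  have mdet : measurable_fun [set: borel] (fun X => \det (mxsub f g (F X))).
    by apply: measurable_det => i j; under eq_fun do rewrite mxE; exact: mF.
  have := mdet measurableT _ (measurableC (measurable_set1 0)).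
  by rewrite setTI; congr measurable; apply/seteqP; split=> X /= /eqP.
rewrite (_ : [set X | _] = [set X | (l <= \rank (F X))%N] `&` ~` [set X | (l.+1 <= \rank (F X))%N]).
  by apply: measurableI => //; apply: measurableC.
apply/seteqP; split=> X /= => [->|[lX /negP]]; first by rewrite leqnn ltnn.
by rewrite -leqNgt => Xl; apply/eqP; rewrite eqn_leq lX Xl.
Qed.

Lemma measurable_position (i : nat) (j : 'I_d) :
  measurable_fun [set: borel] (fun X : borel => position (X : M) i ord0 j).
Proof.
rewrite (_ : (fun _ => _) = fun X : borel => \sum_(p < m) (if (p < i)%N then (X : M) p j else 0)).
  by apply: measurable_sum => p; case: (p < i)%N; [exact: measurable_coord|exact: measurable_cst].
apply/funext => X; rewrite -big_mkcond /position summxE /=.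
by apply: eq_bigr => p _; rewrite mxE.
Qed.

End Borel_events.

(** * Sums over disjoint blocks of increments *)

Section Sorted_blocks.
Context {R : realFieldType} {m d : nat}.
Variable g : 'I_m -> option 'I_d.

Let key (p : 'I_m) : nat := if g p is Some a then a else d.

Let below (a : nat) : {set 'I_m} := [set p | (key p <= a)%N]%SET.

(** An order of the increments in which those of block [0] come first, then
those of block [1], and so on, and those outside the blocks come last. *)
Lemma sorting_perm : exists s : {perm 'I_m}, forall i j : 'I_m, (i <= j)%N -> (key (s i) <= key (s j))%N.
Proof.
pose r := relpre key leq.
have /tuple_permP[s sE] : perm_eq (sort r (enum 'I_m)) (ord_tuple m).
  by rewrite perm_sort; exact: perm_refl.
have nthE (i0 i : 'I_m) : nth i0 (sort r (enum 'I_m)) i = s i.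
  by rewrite sE -tnth_nth tnth_mktuple tnth_ord_tuple.
exists s => i j ij; rewrite -(nthE i i) -(nthE i j).
apply: (@sorted_leq_nth _ r) => //.
- by move=> x y z; exact: leq_trans.
- by move=> x; rewrite /r /= leqnn.
- by apply: sort_sorted => x y; exact: leq_total.
- by rewrite inE size_sort size_enum_ord.
- by rewrite inE size_sort size_enum_ord.
Qed.

Lemma downset_card (D : {set 'I_m}) (i : 'I_m) :
  (forall i j : 'I_m, (i <= j)%N -> j \in D -> i \in D) -> (i \in D) = (i < #|D|)%N.
Proof.
move=> Ddown; have cl (a : nat) : (a <= m)%N -> #|[set j : 'I_m | (j < a)%N]%SET| = a.
  move=> am; rewrite cardsE -sum1_card.
  rewrite -(big_ord_widen_cond _ predT (fun=> 1%N)) //.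
  by rewrite sum1_card card_ord.
apply/idP/idP => [iD|].
  rewrite -(cl i.+1 (ltn_ord i)); apply/subset_leq_card/fintype.subsetP => j.
  by rewrite inE ltnS => ji; exact: Ddown iD.
apply: contraTT => iD; rewrite -leqNgt -[X in (_ <= X)%N](cl i (ltnW (ltn_ord i))).
apply/subset_leq_card/fintype.subsetP => j jD; rewrite inE ltnNge.
by apply: contra iD => ij; exact: Ddown jD.
Qed.

(** When the blocks are listed one after the other, the partial sums at their
ends are obtained from the block sums by a unitriangular matrix. *)
Lemma blocks_as_positions : (forall a, exists p, g p = Some a) ->
  exists (s : {perm 'I_m}) (i : 'I_d -> 'I_m), {homo i : a b / (a < b)%N} /\
    forall X : 'M[R]_(m, d),
      row_free (\matrix_(a < d) position (row_perm s X) (i a).+1) =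
      row_free (\matrix_(a < d) \sum_(p | g p == Some a) row p X).
Proof.
move=> gsurj; have [s s_mono] := sorting_perm.
have in_below a (i : 'I_m) : (s i \in below a) = (i < #|below a|)%N.
  rewrite -(card_preimset (below a) (@perm_inj _ s)) -downset_card ?inE //.
  by move=> i' j ij; rewrite !inE; apply: leq_trans; exact: s_mono.
have key_some p a : g p = Some a -> key p = a by rewrite /key => ->.
have card_below_gt0 (a : 'I_d) : (0 < #|below a|)%N.
  by apply/card_gt0P; have [p /key_some ka] := gsurj a; exists p; rewrite inE ka.
have below_lt (a : 'I_d) : (#|below a|.-1 < m)%N.
  by rewrite prednK // -[X in (_ <= X)%N](card_ord m) max_card.
exists s, (fun a => Ordinal (below_lt a)); split=> [a b ab|X] /=.
  rewrite -ltnS !prednK //; apply: proper_card.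
  apply/fintype.properP; split.
    by apply/fintype.subsetP => p; rewrite !inE => /leq_trans; apply; exact: ltnW.
  by have [p /key_some kb] := gsurj b; exists p; rewrite !inE kb // -ltnNge.
pose B := \matrix_(a < d) \sum_(p | g p == Some a) row p X.
pose L : 'M[R]_d := \matrix_(a, b) (b <= a)%N%:R.
have Lunit : L \in unitmx.
  rewrite unitmxE det_trig; last first.
    by apply/is_trig_mxP => a b ab; rewrite mxE leqNgt ab.
  by rewrite big1 ?unitr1 // => a _; rewrite mxE leqnn.
suff -> : \matrix_(a < d) position (row_perm s X) #|below a|.-1.+1 = L *m B.
  by rewrite /row_free (eqmxMfull B) // row_full_unit.
apply/row_matrixP => a; rewrite rowK row_mul mulmx_sum_row prednK // /position.
have -> : \sum_(j < m | (j < #|below a|)%N) row j (row_perm s X) =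
    \sum_(p | p \in below a) row p X.
  rewrite [RHS](reindex_inj (@perm_inj _ s)) /=; apply: eq_big => j; first by rewrite in_below.
  by rewrite row_row_perm.
transitivity (\sum_(b < d | (b <= a)%N) \sum_(p | g p == Some b) row p X); last first.
  rewrite big_mkcond; apply: eq_bigr => b _; rewrite !mxE rowK.
  by case: leqP; rewrite ?scale1r ?scale0r.
rewrite (exchange_big_dep (fun p => p \in below a)) /=; last first.
  by move=> b p ba /eqP /key_some kp; rewrite inE kp.
apply: eq_bigr => p; rewrite inE /key; case gp: (g p) => [b|] => ba; last first.
  by have := leq_ltn_trans ba (ltn_ord a); rewrite ltnn.
rewrite (big_pred1 b) // => b' /=.
by rewrite (inj_eq (@Some_inj _)) eq_sym; case: eqVneq => [->|]; rewrite ?ba ?andbF.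
Qed.

End Sorted_blocks.

Section General_position.
Context {R : realType} {disp : measure_display} {T : measurableType disp}.
Variable P : probability T R.
Context {m d : nat}.
Variable xi : 'I_m -> T -> 'rV[R]_d.
Hypothesis random_xi : random_vectors xi.
Hypothesis exchangeable_xi : exchangeable P xi.
Hypothesis general_xi : general_position P xi.
Local Notation M := 'M[R]_(m, d).

Definition increments (w : T) : M := \matrix_(i < m) xi i w.

Lemma partial_sumE i w : partial_sum xi i w = position (increments w) i.
Proof. by apply: eq_bigr => j _; rewrite rowK. Qed.

Lemma row_perm_increments s w : row_perm s (increments w) = \matrix_(i < m) xi (s i) w.
Proof. by apply/row_matrixP => i; rewrite row_row_perm !rowK. Qed.

Lemma measurable_increments (s : {perm 'I_m}) (B : set M) :
  measurable (B : set (g_sigma_algebraType (@open M))) ->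
  measurable [set w | B (row_perm s (increments w))].
Proof.
move=> mB; have := measurable_increment_matrix (fun i => xi (s i)) (fun i => random_xi (s i)) measurableT _ mB.
by rewrite setTI; congr measurable; apply/funext => w /=; rewrite row_perm_increments.
Qed.

Lemma exchangeable_law (s : {perm 'I_m}) (B : set M) :
  measurable (B : set (g_sigma_algebraType (@open M))) ->
  P [set w | B (row_perm s (increments w))] = P [set w | B (increments w)].
Proof.
move=> mB; rewrite -(exchangeable_xi s B mB); congr (P _).
by apply/funext => w /=; rewrite row_perm_increments.
Qed.

(** By exchangeability, the permuted walk of [blocks_as_positions] is in
general position too, and there are finitely many ways to choose the blocks. *)
Lemma blocks_free_ae : {ae P, forall w, blocks_free (increments w)}.
Proof.
suff : {ae P, forall w, forall g : {ffun 'I_m -> option 'I_d},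
    (forall a, exists p, g p = Some a) ->
    row_free (\matrix_(a < d) \sum_(p | g p == Some a) row p (increments w))}.
  apply: filterS => w gw g gsurj.
  have gE p : [ffun p => g p] p = g p by rewrite ffunE.
  have := gw [ffun p => g p]; rewrite (_ : \matrix_a _ = \matrix_(a < d) \sum_(p | g p == Some a) row p (increments w)).
    by apply=> a; have [p gp] := gsurj a; exists p; rewrite gE.
  by apply/matrixP => a j; rewrite !mxE; congr (fun_of_matrix _ _ _); apply: eq_bigl => p; rewrite gE.
apply: filter_forall => g; have [gsurj|gsurj] := pselect (forall a, exists p, g p = Some a); last first.
  by apply: filterE => w /gsurj.
have [s [i [i_incr sE]]] := blocks_as_positions (R := R) g gsurj.
pose B : set M := [set X | ~~ row_free (\matrix_(a < d) position X (i a).+1)].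
have mB : measurable (B : set (g_sigma_algebraType (@open M))).
  rewrite (_ : B = ~` [set X : M | \rank (\matrix_(a < d) position X (i a).+1) = d]).
    apply: measurableC; apply: measurable_rank => a j.
    by under eq_fun do rewrite !mxE; exact: measurable_position.
  by apply/seteqP; split=> X; rewrite /B /= /row_free => /eqP.
have PB : P [set w | B (row_perm s (increments w))] = 0%E.
  rewrite exchangeable_law // -(general_xi i i_incr); congr (P _).
  by apply/funext => w /=; rewrite /B /=; congr (is_true (~~ row_free _)); apply/matrixP => a j;
    rewrite !mxE partial_sumE.
exists [set w | B (row_perm s (increments w))]; split=> //.
  exact: measurable_increments.
move=> w /= /not_implyP[_ /negP nf]; by rewrite /B /= sE.
Qed.

End General_position.

(** * The expected number of missing faces *)

Section Counting_events.
Context {R : realType} {disp : measure_display} {T : measurableType disp}.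
Variable P : probability T R.
Context {J : finType}.
Variable A : J -> set T.
Hypothesis mA : forall j, measurable (A j).

Definition occurring (w : T) : {set J} := [set j | `[< A j w >]]%SET.

Lemma card_occurring w : #|occurring w|%:R = \sum_j \1_(A j) w :> R.
Proof.
rewrite -sum1_card natr_sum big_mkcond /=; apply: eq_bigr => j _.
have [Aw|Aw] := pselect (A j w); first by rewrite inE indicE mem_set // asboolT.
by rewrite inE indicE memNset // asboolF.
Qed.

Lemma measurable_card_occurring : measurable_fun [set: T] (fun w => #|occurring w|%:R : R).
Proof.
under eq_fun do rewrite card_occurring.
by apply: measurable_sum => j; apply: measurable_indic.
Qed.

Lemma measurable_card_occurring_eq N : measurable [set w | #|occurring w| = N].
Proof.
have := measurable_card_occurring measurableT _ (measurable_set1 N%:R).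
rewrite setTI; congr measurable; apply/seteqP; split=> w /=; last by move=> ->.
by move/eqP; rewrite eqr_nat => /eqP.
Qed.

Lemma expected_count : ('E_P[fun w => #|occurring w|%:R] = \sum_j P (A j))%E.
Proof.
rewrite unlock; under eq_integral do rewrite card_occurring -sumEFin.
rewrite ge0_integral_sum //.
  by apply: eq_bigr => j _; rewrite integral_indic // setIT.
by move=> j; apply/measurable_EFinP; exact: measurable_indic.
Qed.

Lemma sum_probE : (\sum_j P (A j))%E = (\sum_j fine (P (A j)))%:E.
Proof. by rewrite -sumEFin; apply: eq_bigr => j _; rewrite fineK // fin_num_measure. Qed.

(** Together with [expected_count_ge], this turns bounds that hold almost
surely for a number of events into bounds for the sum of their probabilities.
*)
Lemma expected_count_le hi : 0 <= hi -> {ae P, forall w, #|occurring w|%:R <= hi} ->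
  \sum_j fine (P (A j)) <= hi.
Proof.
move=> hi0 le_hi; rewrite -lee_fin -sum_probE -expected_count unlock.
rewrite -[leRHS]mule1 -(probability_setT P) -integral_cst //.
apply: ae_ge0_le_integral => //.
- by apply/measurable_EFinP; exact: measurable_card_occurring.
- by apply: filterS le_hi => w hw _; rewrite /cst lee_fin.
Qed.

Lemma expected_count_ge lo : 0 <= lo -> {ae P, forall w, lo <= #|occurring w|%:R} ->
  lo <= \sum_j fine (P (A j)).
Proof.
move=> lo0 ge_lo; rewrite -lee_fin -sum_probE -expected_count unlock.
rewrite -[leLHS]mule1 -(probability_setT P) -integral_cst //.
apply: ae_ge0_le_integral => //.
- by apply/measurable_EFinP; exact: measurable_card_occurring.
- by apply: filterS ge_lo => w hw _; rewrite /cst lee_fin.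
Qed.

End Counting_events.

Section Walk_hull.
Context {R : realType} {disp : measure_display} {T : measurableType disp}.
Variable P : probability T R.
Context {m d : nat}.
Variable xi : 'I_m -> T -> 'rV[R]_d.
Hypothesis random_xi : random_vectors xi.
Hypothesis exchangeable_xi : exchangeable P xi.
Hypothesis general_xi : general_position P xi.
Variable k : nat.
Hypothesis d_le_m : (d <= m)%N.
Hypothesis k_lt_d : (k < d)%N.
Local Notation M := 'M[R]_(m, d).
Local Notation X := (increments xi).

Definition points (Y : M) (i : 'I_m.+1) : 'rV[R]_d := position Y i.

Definition face (I : {set 'I_m.+1}) : set M :=
  [set Y | exposed (points Y) I /\ has_affdim [set points Y i | i in [set` I]] k].

(** Only sets of the size of the vertex set of a simplex of dimension [k] count
as missing. *)
Definition missing (I : {set 'I_m.+1}) : set M :=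
  [set Y | #|I| = k.+1 /\ ~ exposed (points Y) I].

Lemma measurable_face I : measurable (face I : set (g_sigma_algebraType (@open M))).
Proof.
have [->|/set0Pn[i0 i0I]] := eqVneq I finset.set0.
  rewrite (_ : face _ = set0) //; apply/seteqP; split=> // Y [_ /has_affdim_nonempty[x [i /=]]].
  by rewrite finset.in_set0.
rewrite (_ : face I = [set Y | exposed (points Y) I] `&`
    [set Y | \rank (edges_from (points Y) I i0) = k]); last first.
  by apply/seteqP; split=> Y [eY /(has_affdim_points _ _ _ _ i0I) rY].
apply: measurableI; first exact: measurable_exposed.
apply: measurable_rank => i j.
under eq_fun do rewrite !mxE.
by apply: measurable_funB; exact: measurable_position.
Qed.

Lemma measurable_missing I : measurable (missing I : set (g_sigma_algebraType (@open M))).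
Proof.
have [cI|cI] := eqVneq #|I| k.+1.
  rewrite (_ : missing I = ~` [set Y | exposed (points Y) I]).
    by apply: measurableC; exact: measurable_exposed.
  by apply/seteqP; split=> Y; [case|split].
by rewrite (_ : missing I = set0) //; apply/seteqP; split=> // Y [/eqP]; rewrite (negbTE cI).
Qed.

Lemma measurable_event (B : set M) : measurable (B : set (g_sigma_algebraType (@open M))) ->
  measurable [set w | B (X w)].
Proof. by move=> /(measurable_increments xi random_xi 1%g); under eq_fun do rewrite row_perm1. Qed.

Lemma generic_ae : {ae P, forall w, generic d (relations (X w))}.
Proof.
apply: filterS (blocks_free_ae P xi random_xi exchangeable_xi general_xi) => w.
exact: generic_relations.
Qed.

Lemma num_faces_walk w : num_faces k (walk_hull xi w) =
  #|occurring (fun I => [set w | face I (X w)]) w|.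
Proof.
rewrite /walk_hull (_ : [set _ | _ in _] = range (points (X w))) ?num_facesE //.
apply/seteqP; split=> x [i].
  by move=> /= im <-; exists (Ordinal (im : (i < m.+1)%N)) => //; rewrite /points partial_sumE.
by move=> _ <-; exists i; [rewrite /= -ltnS|rewrite /points partial_sumE].
Qed.

(** In general position, the affine dimension determines the number of points.
*)
Lemma face_generic I Y : generic d (relations Y) ->
  face I Y <-> #|I| = k.+1 /\ exposed (points Y) I.
Proof.
move=> gY; have [->|/set0Pn[i0 i0I]] := eqVneq I finset.set0.
  split=> [[_ /has_affdim_nonempty[x [i /=]]]|[]]; first by rewrite finset.in_set0.
  by rewrite cards0.
have rk := rank_edge_matrix Y I i0 k gY i0I k_lt_d.
split=> [[eY /(has_affdim_points _ _ _ _ i0I) rY]|[/eqP cI eY]].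
  by split=> //; apply/eqP; rewrite -rk; apply/eqP.
by split=> //; apply/(has_affdim_points _ _ _ _ i0I)/eqP; rewrite -rk in cI.
Qed.

Lemma card_face_missing Y : generic d (relations Y) ->
  (#|[set I | `[< face I Y >]]%SET| + #|[set I | `[< missing I Y >]]%SET|)%N = 'C(m.+1, k.+1).
Proof.
move=> gY; have disj : [set I | `[< face I Y >]]%SET :&: [set I | `[< missing I Y >]]%SET = finset.set0.
  apply/setP => I; rewrite !inE; apply/negP => /andP[/asboolP/(face_generic _ _ gY)[_ eY] /asboolP[_]].
  by move/(_ eY).
rewrite -cardsUI disj cards0 addn0 -[m.+1 in RHS]card_ord -card_draws.
apply: eq_card => I; rewrite !inE; apply/orP/eqP => [[|]/asboolP|cI].
- by move=> /(face_generic _ _ gY)[].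
- by case.
- have [eY|eY] := pselect (exposed (points Y) I); [left|right]; apply/asboolP => //.
  by apply/(face_generic _ _ gY).
Qed.

Definition expected_missing : R := \sum_I fine (P [set w | missing I (X w)]).

(** Almost surely, faces and missing sets together are all the sets with [k.+1]
elements, by [card_face_missing]. *)
Lemma expected_num_faces :
  fine 'E_P[fun w => (num_faces k (walk_hull xi w))%:R] = 'C(m.+1, k.+1)%:R - expected_missing.
Proof.
under [fun w => _]eq_fun do rewrite num_faces_walk.
have mF I : measurable [set w | face I (X w)] by apply: measurable_event; exact: measurable_face.
have mN I : measurable [set w | missing I (X w)] by apply: measurable_event; exact: measurable_missing.
rewrite expected_count // sum_probE //=.
(* Faces and missing sets are counted together, since their total number is
   almost surely constant. *)
pose A (J : {set 'I_m.+1} + {set 'I_m.+1}) : set T :=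
  match J with inl B => [set w | face B (X w)] | inr B => [set w | missing B (X w)] end.
have mA J : measurable (A J) by case: J.
have cnt : {ae P, forall w, #|occurring A w|%:R = 'C(m.+1, k.+1)%:R :> R}.
  apply: filterS generic_ae => w gw; rewrite -(card_face_missing _ gw); congr (_%:R).
  rewrite -!sum1_card big_sumType /=.
  by congr (_ + _)%N; apply: eq_bigl => I; rewrite !inE.
have sumA : \sum_J fine (P (A J)) =
    \sum_I fine (P [set w | face I (X w)]) + expected_missing by rewrite big_sumType.
have up := expected_count_le P A mA 'C(m.+1, k.+1)%:R (ler0n _ _) _.
have lo := expected_count_ge P A mA 'C(m.+1, k.+1)%:R (ler0n _ _) _.
apply/eqP; rewrite eq_le -lerBlDr opprK -sumA lerBlDr -sumA.
by rewrite up ?lo //; apply: filterS cnt => w ->.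
Qed.

Lemma measurable_neighborly N : measurable [set w | num_faces k (walk_hull xi w) = N].
Proof.
rewrite (_ : [set w | _] = [set w | #|occurring (fun I => [set w | face I (X w)]) w| = N]).
  by apply: (measurable_card_occurring_eq (R := R)) => I; apply: measurable_event; exact: measurable_face.
by apply/seteqP; split=> w /=; rewrite num_faces_walk.
Qed.

(** The hull is almost surely neighborly or some set is missing, hence the
probabilities of these events add up to at least one. *)
Lemma prob_neighborly :
  1 - fine (P [set w | num_faces k (walk_hull xi w) = 'C(m.+1, k.+1)]) <= expected_missing.
Proof.
pose A (o : unit + {set 'I_m.+1}) : set T := if o is inr B then [set w | missing B (X w)]
  else [set w | num_faces k (walk_hull xi w) = 'C(m.+1, k.+1)].
have mA o : measurable (A o).
  by case: o => [u|B]; [exact: measurable_neighborly|apply: measurable_event; exact: measurable_missing].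
have : 1 <= \sum_o fine (P (A o)).
  apply: expected_count_ge => //; apply: filterS generic_ae => w gw.
  rewrite ler1n card_gt0; apply/set0Pn.
  have [[B mB]|no_missing] := pselect (exists B, missing B (X w)).
    by exists (inr B); rewrite inE; apply/asboolP.
  exists (inl tt); rewrite inE; apply/asboolP => /=.
  rewrite num_faces_walk -(card_face_missing _ gw) [X in (_ + X)%N](_ : _ = 0%N) ?addn0 //.
  apply/eqP; rewrite cards_eq0; apply/eqP/setP => B; rewrite !inE; apply/negP => /asboolP mB.
  by apply: no_missing; exists B.
by rewrite big_sumType /= (big_pred1 tt) => [|[]] //; rewrite lerBlDr addrC.
Qed.

(** By exchangeability every order of the increments contributes the same. *)
Lemma sum_perm_missing :
  \sum_(sB : {perm 'I_m} * {set 'I_m.+1})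
    fine (P [set w | missing sB.2 (row_perm sB.1 (X w))]) = m`!%:R * expected_missing.
Proof.
rewrite -(pair_big predT predT (fun s B => fine (P [set w | missing B (row_perm s (X w))]))) /=.
rewrite (eq_bigr (fun=> expected_missing)) => [|s _].
  by rewrite sumr_const mulr_natl -(card_Sn m).
apply: eq_bigr => B _; congr fine.
by apply: exchangeable_law => //; exact: measurable_missing.
Qed.

(** By duality this is the number of descending pairs for the space of
relations, which does not depend on the order of the increments any more. *)
Lemma missing_count_ae : {ae P, forall w, exists2 W : set ('I_m.+1 -> R), lin_closed W /\ generic d W &
  #|occurring (fun sB : {perm 'I_m} * {set 'I_m.+1} =>
      [set w | missing sB.2 (row_perm sB.1 (X w))]) w| =
    chamber_count (ord0 : 'I_k.+1) m [set: 'I_k.+1]%SET W}.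
Proof.
apply: filterS generic_ae => w gw; exists (relations (X w)).
  by split; first exact: lin_closed_relations.
rewrite -descending_pairs_count; apply: eq_card => -[s B]; rewrite !inE /=.
apply/asboolP/andP => [[cB nB]|[/eqP cB /asboolP nB]].
  by split; [exact/eqP|apply/asboolP/(not_exposed_descends _ _ _ k)] => //; exact: leq_trans d_le_m.
by split=> //; apply/(not_exposed_descends _ _ _ k) => //; exact: leq_trans d_le_m.
Qed.

Lemma measurable_perm_missing (sB : {perm 'I_m} * {set 'I_m.+1}) :
  measurable [set w | missing sB.2 (row_perm sB.1 (X w))].
Proof. by apply: measurable_increments => //; exact: measurable_missing. Qed.

Lemma expected_missing_le : expected_missing <=
  \sum_(d.+1 <= j < m.+2) (stirling1 m.+1 j * surj j k.+1)%:R / (k.+1%:R * m`!%:R).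
Proof.
rewrite -mulr_suml -natr_sum ler_pdivlMr ?mulr_gt0 ?ltr0n ?fact_gt0 //.
rewrite [leLHS]mulrC -mulrA -sum_perm_missing [leLHS]mulrC -ler_pdivlMr ?ltr0n //.
apply: (expected_count_le P _ measurable_perm_missing) => //.
apply: filterS missing_count_ae => w [W [Wlin Wgen] ->].
rewrite ler_pdivlMr ?ltr0n // -natrM ler_nat mulnC.
by have := chamber_count_upper (ord0 : 'I_k.+1) _ _ [set: 'I_k.+1]%SET W Wlin Wgen d_le_m; rewrite cardsT card_ord.
Qed.

Lemma expected_missing_ge :
  (stirling1 m.+1 d.+2 * surj d.+2 k.+1)%:R / (k.+1%:R * m`!%:R) <= expected_missing.
Proof.
rewrite ler_pdivrMr ?mulr_gt0 ?ltr0n ?fact_gt0 //.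
rewrite [leRHS]mulrC -mulrA -sum_perm_missing [leRHS]mulrC -ler_pdivrMr ?ltr0n //.
apply: (expected_count_ge P _ measurable_perm_missing) => //.
apply: filterS missing_count_ae => w [W [Wlin Wgen] ->].
rewrite ler_pdivrMr ?ltr0n // -natrM ler_nat [X in (_ <= X)%N]mulnC.
have := chamber_count_lower (ord0 : 'I_k.+1) m d d.+2 [set: 'I_k.+1]%SET W Wlin Wgen.
by rewrite cardsT card_ord; apply; [rewrite inE|right].
Qed.

End Walk_hull.

(** * The threshold *)

Lemma eqO_near {R : realType} (f g : nat -> R) (C : R) :
  (\forall d \near \oo, 0 <= f d <= C * g d) -> (forall d, 0 <= g d) -> f =O_\oo g.
Proof.
move=> fg g0; apply/eqO_exP; exists (Num.max 1 C).
  by rewrite lt_max ltr01.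
apply: filterS fg => d /andP[f0 fC]; rewrite !ger0_norm //.
by apply: le_trans fC _; rewrite ler_wpM2r // le_max lexx orbT.
Qed.

Theorem theorem6p7 (R : realType) (alpha beta : R) (k n : nat -> nat)
    (disp : nat -> measure_display) (T : forall d, measurableType (disp d))
    (P : forall d, probability (T d) R)
    (xi : forall d, 'I_(n d).-1 -> T d -> 'rV[R]_d) :
  0 < alpha -> alpha < beta -> beta < 1 ->
  (forall d, 0 < k d)%N -> (forall d, 0 < n d)%N ->
  (fun d => (k d)%:R / (alpha * (n d)%:R) : R) @ \oo --> (1 : R) ->
  (fun d => d%:R / (beta * (n d)%:R) : R) @ \oo --> (1 : R) ->
  (\forall d \near \oo, [/\ (d <= (n d).-1)%N, random_vectors (xi d),
     exchangeable (P d) (xi d) & general_position (P d) (xi d)]) ->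
  let C d (w : T d) := walk_hull (xi d) w in
  let Ef d : R := fine 'E_(P d)[fun w => (num_faces (k d).-1 (C d w))%:R] in
  let J := rate alpha beta + alpha * ln alpha + (1 - alpha) * ln (1 - alpha) in
  (0 < J ->
     exists2 eta : R, 0 < eta &
       [/\ (fun d => 'C(n d, k d)%:R - Ef d) =O_\oo
             (fun d => expR (- eta * (n d)%:R)),
           (fun d => P d [set w | neighborly (n d) (k d) (C d w)]) @ \oo
             --> 1%E &
           (fun d => 1 - fine (P d [set w |
               num_faces (k d).-1 (C d w) = 'C(n d, k d)])) =O_\oo
             (fun d => expR (- eta * (n d)%:R))]) /\
  (J < 0 -> (fun d => 'C(n d, k d)%:R - Ef d) @ \oo --> +oo).
Proof.
move=> alpha_gt0 alpha_lt beta_lt1 k_gt0 n_gt0 k_sim d_sim walks C Ef J.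
have d_lt : \forall d \near \oo, (d <= (n d).-1)%N by apply: filterS walks => d [].
have k_le : \forall d \near \oo, (k d <= d)%N by apply: (k_le_d alpha beta k n).
pose miss d := expected_missing (P d) (xi d) (k d).-1.
pose t d j : R := term k n d j.
have bounds : \forall d \near \oo,
    [/\ 'C(n d, k d)%:R - Ef d = miss d,
        t d d.+2 <= miss d,
        miss d <= \sum_(d.+1 <= j < (n d).+1) t d j,
        1 - fine (P d [set w | num_faces (k d).-1 (C d w) = 'C(n d, k d)]) <= miss d &
        measurable [set w | num_faces (k d).-1 (C d w) = 'C(n d, k d)]].
  near=> d.
  have [d_le_m rxi exi gxi] : [/\ (d <= (n d).-1)%N, random_vectors (xi d),
     exchangeable (P d) (xi d) & general_position (P d) (xi d)] by near: d.
  have k_lt_d : ((k d).-1 < d)%N by rewrite prednK //; near: d.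
  have := expected_num_faces (P d) (xi d) rxi exi gxi (k d).-1 d_le_m k_lt_d.
  have := expected_missing_ge (P d) (xi d) rxi exi gxi (k d).-1 d_le_m k_lt_d.
  have := expected_missing_le (P d) (xi d) rxi exi gxi (k d).-1 d_le_m k_lt_d.
  have := prob_neighborly (P d) (xi d) rxi exi gxi (k d).-1 d_le_m k_lt_d.
  have := measurable_neighborly (xi d) rxi (k d).-1 'C(n d, k d).
  rewrite !prednK // => h1 h2 h3 h4 h5; split=> //.
  by rewrite /Ef /C h5 opprB addrC subrK.
split=> [J0|J0]; last first.
  have div : (fun d => t d d.+2) @ \oo --> +oo by apply: (single_term_diverges alpha beta k n).
  apply: (ger_cvgy _ div); apply: filterS bounds => d [-> tm _ _ _].
  exact: tm.
have [eta eta0 [C0 tail]] : exists2 eta : R, 0 < eta & exists C : R, \forall d \near \oo,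
    \sum_(d.+1 <= j < (n d).+1) t d j <= C * expR (- eta * (n d)%:R).
  by apply: (tail_negligible alpha beta k n).
have small : \forall d \near \oo, miss d <= C0 * expR (- eta * (n d)%:R).
  by apply: filterS2 bounds tail => d [_ _ + _ _]; exact: le_trans.
have miss_ge0 d : 0 <= miss d by apply: sumr_ge0 => I _; exact: fine_ge0.
have prob_le1 d : measurable [set w | num_faces (k d).-1 (C d w) = 'C(n d, k d)] ->
    0 <= 1 - fine (P d [set w | num_faces (k d).-1 (C d w) = 'C(n d, k d)]).
  move=> mE; rewrite subr_ge0 -lee_fin fineK ?fin_num_measure //; exact: probability_le1.
exists eta => //; split.
- apply: (eqO_near _ _ C0) => [|d]; last exact: expR_ge0.
  by apply: filterS2 bounds small => d [-> _ _ _ _] ->; rewrite miss_ge0.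
- apply/fine_cvgP; split.
    by apply: filterS bounds => d [_ _ _ _ mE]; exact: fin_num_measure.
  have exp0 : (fun d => 1 - C0 * expR (- eta * (n d)%:R)) @ \oo --> (1 : R).
    rewrite -[X in _ --> X]subr0; apply: cvgB; first exact: cvg_cst.
    rewrite -(mulr0 C0); apply: cvgMl_tmp.
    have n_y : (fun d => (n d)%:R : R) @ \oo --> +oo by exact: n_cvgy d_lt.
    have eta_n : (fun d => (n d)%:R * eta) @ \oo --> +oo.
      apply/cvgryPge => A; near=> d; rewrite -ler_pdivrMr //; near: d.
      by move/cvgryPge: n_y; apply.
    have := cvg_comp _ _ eta_n (@cvgr_expR R).
    by rewrite (_ : _ \o _ = fun d => expR (- eta * (n d)%:R)) //; apply/funext => d /=; rewrite mulNr mulrC.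
  apply: (@squeeze_cvgr _ _ _ _ (fun d => 1 - C0 * expR (- eta * (n d)%:R)) (cst (1 : R))) => //.
    apply: filterS2 bounds small => d [_ _ _ le_miss mE] le_small /=.
    have := prob_le1 d mE; rewrite subr_ge0 => ->; rewrite andbT.
    by rewrite lerBlDr -lerBlDl (le_trans le_miss).
  exact: cvg_cst.
- apply: (eqO_near _ _ C0) => [|d]; last exact: expR_ge0.
  by apply: filterS2 bounds small => d [_ _ _ le_miss mE] le_small; rewrite prob_le1 // (le_trans le_miss).
Unshelve. all: end_near.
Qed.
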